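(* Let $R=(R_t)_{t\ge0}$ be a Lévy process with Lévy–Itô decomposition $$R_t=\mu t+\sigma B_t+\int_0^t\int_{0<|x|\le1}x\big(\mu^R(dx,ds)-F^R(dx)\,ds\big)+\int_0^t\int_{|x|>1}x\,\mu^R(dx,ds),$$ and assume $\mathbb{E}|R_1|<\infty$. For $n\ge1$, $k\ge1$, $f\in[0,1]$ set $$r_{n,k}=e^{R_{k/n}-R_{(k-1)/n}}-1,\qquad W_t^{n,f}=\prod_{k=1}^{\lfloor nt\rfloor}\big(1+fr_{n,k}\big).$$ Then, for every $f\in[0,1]$ and $T>0$, as $n\to\infty$ the processes $W^{n,f}$ converge in law in $\mathbb{D}((0,T))$ to the process $W^f$, where $$W^f_t=\exp\left(fR_t+\frac{f(1-f)\sigma^2}{2}\,t+\int_0^t\int_{\mathbb{R}\setminus\{0\}}\Big[\ln\big(1+f(e^x-1)\big)-fx\Big]\mu^R(dx,ds)\right).$$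
   Context: Here $\mu\in\mathbb{R}$, $\sigma\ge0$, $B$ is a standard Brownian motion, $\mu^R(dx,ds)=\sum_{s>0:\,\triangle R_s\neq0}\delta_{(\triangle R_s,s)}(dx,ds)$ is the jump measure of $R$ (with $\triangle R_s=R_s-R_{s-}$), and $F^R$ is the Lévy measure of $R$ on $\mathbb{R}\setminus\{0\}$. $\lfloor x\rfloor$ is the integer part of $x$; the empty product equals $1$. $\mathbb{D}((0,T))$ is the Skorokhod space of right-continuous functions with left limits on $(0,T)$. The returns $r_{n,k}$ are the relative increments $(P_{k/n}-P_{(k-1)/n})/P_{(k-1)/n}$ of the price process $P_t=e^{R_t}$. *)

(* Defs.v *)
From HB Require Import structures.
From mathcomp Require Import all_boot all_order all_algebra.
From mathcomp Require Import all_classical all_reals all_analysis.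

Set Implicit Arguments.
Unset Strict Implicit.
Unset Printing Implicit Defensive.
Import Order.TTheory GRing.Theory Num.Theory.
Import numFieldNormedType.Exports.
Local Open Scope classical_set_scope.
Local Open Scope ring_scope.

Definition cadlag_on (R : realType) (I : set R) (x : R -> R) : Prop :=
  forall t : R, I t -> (x u @[u --> t^'+] --> x t) /\ cvg (x u @[u --> t^'-]).

(* A function on (0,T) is encoded by its extension by zero to the whole line,
   so that the encoding is one-to-one. *)
Record skorokhod (R : realType) (T : R) := Skorokhod {
  skor_fun :> R -> R;
  skor_cadlag : cadlag_on [set t | 0 < t < T] skor_fun;
  skor_out : forall t : R, ~~ (0 < t < T) -> skor_fun t = 0 }.

Definition time_change (R : realType) (T : R) (lam : R -> R) : Prop :=
  (forall s t : R, 0 < s < T -> 0 < t < T -> s < t -> lam s < lam t) /\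
  set_bij [set t | 0 < t < T] [set t | 0 < t < T] lam.

(* The J1 topology on an open interval: y is close to x when, after a change
   of time, it is uniformly close to x on a large compact interval [a,b].  Thus
   x_n tends to x iff there are time changes lam_n such that lam_n tends to the
   identity and x_n \o lam_n tends to x, locally uniformly on (0,T). *)
Definition skor_near (R : realType) (T a b e : R) (x y : R -> R) : Prop :=
  exists2 lam, time_change T lam &
    forall t : R, a <= t <= b -> `|lam t - t| < e /\ `|y (lam t) - x t| < e.

Definition skor_nbhs (R : realType) (T : R) (x : skorokhod T) :
    set (set (skorokhod T)) :=
  [set A | exists a b e : R, [/\ 0 < a, b < T, 0 < e &
    forall y : skorokhod T, skor_near T a b e x y -> A y]].

Section skorokhod_topology.
Variables (R : realType) (T : R).
Implicit Types (x y z : skorokhod T) (A : set (skorokhod T)).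

Lemma skor0_cadlag : cadlag_on [set t : R | 0 < t < T] (fun=> 0).
Proof. by move=> t _; split; [exact: cvg_cst|exact: is_cvg_cst]. Qed.

Definition skor0 : skorokhod T := Skorokhod skor0_cadlag (fun _ _ => erefl).

HB.instance Definition _ := gen_eqMixin (skorokhod T).
HB.instance Definition _ := gen_choiceMixin (skorokhod T).
HB.instance Definition _ := isPointed.Build (skorokhod T) skor0.
HB.instance Definition _ := hasNbhs.Build (skorokhod T) (@skor_nbhs R T).

Lemma time_change_id : time_change T id.
Proof.
split=> //; split=> //; first by move=> t ? ; exists t.
Qed.

Lemma time_change_comp lam nu :
  time_change T lam -> time_change T nu -> time_change T (nu \o lam).
Proof.
move=> [mlam blam] [mnu bnu]; split; last exact: set_bij_comp blam bnu.
have lamI := set_bij_homo blam.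
by move=> s t sI tI st; apply: mnu; [exact: lamI|exact: lamI|exact: mlam].
Qed.

Lemma skor_near_refl a b e x : 0 < e -> skor_near T a b e x x.
Proof.
by move=> e0; exists id => [|t _]; [exact: time_change_id|rewrite !subrr normr0].
Qed.

Lemma skor_nbhs_filter x : ProperFilter (nbhs x).
Proof.
split.
  by move=> [a [b [e [a0 bT e0 /(_ x)]]]]; apply; exact: skor_near_refl.
split.
- by exists 1, (T - 1), 1; split => //; rewrite gtrBl.
- move=> A1 A2 [a1 [b1 [e1 [a10 b1T e10 h1]]]] [a2 [b2 [e2 [a20 b2T e20 h2]]]].
  exists (Num.min a1 a2), (Num.max b1 b2), (Num.min e1 e2).
  split; [by rewrite lt_min a10|by rewrite gt_max b1T|by rewrite lt_min e10|].
  move=> y [lam tlam h]; split; [apply: h1|apply: h2]; exists lam => // t.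
    move=> /andP[at1 tb1]; have [|+ +] := h t; first by rewrite ge_min le_max at1 tb1.
    by rewrite !lt_min => /andP[-> _] /andP[-> _].
  move=> /andP[at2 tb2]; have [|+ +] := h t; first by rewrite ge_min le_max at2 tb2 !orbT.
  by rewrite !lt_min => /andP[_ ->] /andP[_ ->].
- move=> A1 A2 A12 [a [b [e [a0 bT e0 h]]]].
  by exists a, b, e; split => // y /h /A12.
Qed.

Lemma skor_nbhs_singleton x A : nbhs x A -> A x.
Proof. by move=> [a [b [e [a0 bT e0 h]]]]; apply: h; exact: skor_near_refl. Qed.

Lemma skor_nbhs_nbhs x A : nbhs x A -> nbhs x (nbhs^~ A).
Proof.
move=> [a [b [e [a0 bT e0 h]]]].
have e20 : 0 < e / 2 by rewrite divr_gt0.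
exists a, b, (e / 2); split => // y [lam tlam hlam].
have [mlam blam] := tlam; have lamI := set_bij_homo blam.
have [ab|ba] := leP a b; last first.
  exists a, b, e; split => // z _; apply: h; exists id.
    exact: time_change_id.
  by move=> t /andP[at_ tb]; have := le_trans at_ tb; rewrite leNgt ba.
have aI : 0 < a < T by rewrite a0 (le_lt_trans ab).
have bI : 0 < b < T by rewrite bT (lt_le_trans a0).
have /andP[la0 _] := lamI a aI; have /andP[_ lbT] := lamI b bI.
exists (lam a), (lam b), (e / 2); split => // z [nu tnu hnu].
apply: h; exists (nu \o lam); first exact: time_change_comp.
move=> t tab; have /andP[at_ tb] := tab.
have tI : 0 < t < T by rewrite (lt_le_trans a0 at_) (le_lt_trans tb bT).
have [h1 h2] := hlam t tab.
have lle s u : 0 < s < T -> 0 < u < T -> s <= u -> lam s <= lam u.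
  by move=> sI uI; rewrite le_eqVlt => /predU1P[->//|/(mlam _ _ sI uI)/ltW].
have [|h3 h4] := hnu (lam t); first by rewrite !lle.
rewrite (splitr e) /=.
by split;
  [rewrite -(subrK (lam t) (nu _)) -addrA|rewrite -(subrK (y (lam t)) (z _)) -addrA];
  rewrite (le_lt_trans (ler_normD _ _))// ltrD.
Qed.

HB.instance Definition _ := Nbhs_isNbhsTopological.Build (skorokhod T)
  skor_nbhs_filter skor_nbhs_singleton skor_nbhs_nbhs.

End skorokhod_topology.

Section convergence_in_law.
Variables (R : realType) (d : measure_display) (Omega : measurableType d).
Variables (P : probability Omega R) (T : R).

(* Y is a random element of D((0,T)), for its Borel sigma-algebra, whose paths
   are almost surely those of the process X. *)
Definition random_path (X : R -> Omega -> R) (Y : Omega -> skorokhod T) : Prop :=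
  measurable_fun setT (Y : Omega -> g_sigma_algebraType (@open (skorokhod T))) /\
  {ae P, forall w, forall t : R, 0 < t < T -> Y w t = X t w}.

(* The random elements only serve to discard a null set on which the paths may
   fail to be cadlag; their laws do not depend on the choice. *)
Definition cvg_in_law (Xn : nat -> R -> Omega -> R) (X : R -> Omega -> R) : Prop :=
  exists (Yn : nat -> Omega -> skorokhod T) (Y : Omega -> skorokhod T),
    [/\ forall n, random_path (Xn n) (Yn n), random_path X Y &
      forall phi : skorokhod T -> R,
        continuous phi -> (exists M : R, forall x, `|phi x| <= M) ->
        ('E_P[phi \o Yn n] @[n --> \oo] --> 'E_P[phi \o Y])%E].

End convergence_in_law.

Section jump_measure.
Variables (R : realType) (x : R -> R).

Definition jump (s : R) : R := x s - lim (x u @[u --> s^'-]).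

Definition jump_times : set R := [set s | 0 < s /\ jump s != 0].

Definition jump_measure (A : set (R * R)) : \bar R :=
  (\esum_(s in jump_times) \d_(jump s, s) A)%E.

Let jump_measure0 : jump_measure set0 = 0%E.
Proof. by rewrite /jump_measure esum1// => s _; rewrite measure0. Qed.

Let jump_measure_ge0 A : (0 <= jump_measure A)%E.
Proof. exact: esum_ge0. Qed.

Let jump_measure_sigma_additive : semi_sigma_additive jump_measure.
Proof.
move=> F mF tF mUF; rewrite [X in _ --> X](_ : _ =
  limn (fun n => \sum_(0 <= i < n) jump_measure (F i))%E).
  by apply: is_cvg_ereal_nneg_natsum => k _; exact: jump_measure_ge0.
rewrite nneseries_esumT; last by move=> n; exact: jump_measure_ge0.
rewrite /jump_measure esum_esum//.
under eq_esum => s _.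
  rewrite measure_semi_bigcup// nneseries_esumT//.
  over.
rewrite esum_esum//.
rewrite (reindex_esum (setT `*`` (fun=> jump_times)) _ (fun k => (k.2, k.1)))//.
split.
- by move=> [i s] [].
- by move=> [i s] [j u] _ _ [-> ->].
- by move=> [s i] [] /= js _; exists (i, s).
Qed.

HB.instance Definition _ := isMeasure.Build _ _ _ jump_measure
  jump_measure0 jump_measure_ge0 jump_measure_sigma_additive.

End jump_measure.

Section levy_process.
Variables (R : realType) (d : measure_display) (Omega : measurableType d).
Variable P : probability Omega R.
Implicit Types X B M : R -> Omega -> R.

Definition increment X (s t : R) (w : Omega) : R := X t w - X s w.

Definition independent_increments X : Prop :=
  forall (m : nat) (t : nat -> R) (A : nat -> set R),
    0 <= t 0%N -> (forall i, t i <= t i.+1) -> (forall i, measurable (A i)) ->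
    P (\bigcap_(i < m) (increment X (t i) (t i.+1) @^-1` A i)) =
    (\prod_(i < m) P (increment X (t i) (t i.+1) @^-1` A i))%E.

Definition stationary_increments X : Prop :=
  forall (s t : R) (A : set R), 0 <= s -> 0 <= t -> measurable A ->
    P (increment X s (s + t) @^-1` A) = P (increment X 0 t @^-1` A).

Definition stochastically_continuous X : Prop :=
  forall t e : R, 0 <= t -> 0 < e ->
    P [set w | e <= `|X s w - X t w|]
      @[s --> within [set s | 0 <= s] (nbhs t)] --> 0%E.

Definition is_levy_process X : Prop :=
  [/\ forall t : R, 0 <= t -> measurable_fun setT (X t),
      {ae P, forall w, X 0 w = 0},
      independent_increments X,
      stationary_increments X &
      stochastically_continuous X /\
      {ae P, forall w, X u w @[u --> 0^'+] --> X 0 w /\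
                       cadlag_on [set t | 0 < t] (X^~ w)}].

(* The second parameter of [normal_prob] is the standard deviation. *)
Definition is_brownian_motion B : Prop :=
  [/\ forall t : R, 0 <= t -> measurable_fun setT (B t),
      {ae P, forall w, B 0 w = 0},
      independent_increments B,
      forall (s t : R) (A : set R), 0 <= s -> s < t -> measurable A ->
        P (increment B s t @^-1` A) = normal_prob 0 (Num.sqrt (t - s)) A &
      {ae P, forall w, {within [set t | 0 <= t], continuous (B^~ w)}}].

(* Finiteness of the integral of min(1,x^2) is automatic for a Levy process; it
   is listed because it is part of being a Levy measure. *)
Definition is_levy_measure X (F : {measure set R -> \bar R}) : Prop :=
  [/\ F [set 0] = 0%E,
      (\int[F]_x (Num.min 1 (x ^+ 2))%:E < +oo)%E &
      forall A : set R, measurable A -> ~ A 0 ->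
        F A = (\int[P]_w jump_measure (X^~ w) (A `*` [set s | (0 < s <= 1)%R]))%E].

Definition compensated_jumps X (F : {measure set R -> \bar R}) (e t : R)
    (w : Omega) : R :=
  \int[jump_measure (X^~ w)]_(z in [set z | e < `|z.1| <= 1 /\ 0 < z.2 <= t]) z.1
  - t * \int[F]_(x in [set x | e < `|x| <= 1]) x.

(* M_t is the integral over (0,t] x {0 < |x| <= 1} of x against mu^X - F ds,
   that is, the L^2 limit of the integrals over {e < |x| <= 1} as e tends to 0;
   the two parts of the integral need not converge separately. *)
Definition is_small_jump_integral X (F : {measure set R -> \bar R}) M : Prop :=
  forall t : R, 0 <= t ->
    measurable_fun setT (M t) /\
    ('E_P[(fun w => (compensated_jumps X F e t w - M t w) ^+ 2)%R]
       @[e --> 0^'+] --> 0)%E.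

Definition large_jump_sum X (t : R) (w : Omega) : R :=
  \int[jump_measure (X^~ w)]_(z in [set z | 1 < `|z.1| /\ 0 < z.2 <= t]) z.1.

Definition levy_ito_decomposition X (mu sigma : R) B
    (F : {measure set R -> \bar R}) : Prop :=
  exists2 M, is_small_jump_integral X F M &
    {ae P, forall w, forall t : R, 0 <= t ->
      X t w = mu * t + sigma * B t w + M t w + large_jump_sum X t w}.

End levy_process.

Section wealth.
Variables (R : realType) (Omega : Type) (X : R -> Omega -> R).

Definition simple_return (n k : nat) (w : Omega) : R :=
  expR (X (k%:R / n%:R) w - X (k.-1%:R / n%:R) w) - 1.

Definition wealth (f : R) (n : nat) (t : R) (w : Omega) : R :=
  \prod_(1 <= k < (Num.truncn (n%:R * t)).+1) (1 + f * simple_return n k w).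

Definition limit_wealth (sigma f t : R) (w : Omega) : R :=
  expR (f * X t w + f * (1 - f) * sigma ^+ 2 / 2 * t +
    \int[jump_measure (X^~ w)]_(z in [set z | z.1 != 0 /\ 0 < z.2 <= t])
      (ln (1 + f * (expR z.1 - 1)) - f * z.1)).

End wealth.

(* Main.v *)
Require Import Defs.
From HB Require Import structures.
From mathcomp Require Import all_boot all_order all_algebra.
From mathcomp Require Import all_classical all_reals all_analysis.
From mathcomp Require Import measurable_realfun.
From mathcomp Require Import ring lra.
Set Implicit Arguments.
Unset Strict Implicit.
Unset Printing Implicit Defensive.
Import Order.TTheory GRing.Theory Num.Theory.
Import numFieldNormedType.Exports.
Local Open Scope classical_set_scope.
Local Open Scope ring_scope.

(* Over a period with log-return [x] the wealth is multiplied by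
   [exp (f x + h x)], where [h x = ln (1 + f (e^x - 1)) - f x] is nonnegative
   and equivalent to [f (1 - f) / 2 * x^2] at [0].  The linear terms telescope,
   so everything rests on the sums of [h] over the increments of [X]: they have
   to tend, uniformly in time and in probability, to [f (1 - f) / 2 * sigma^2 t]
   plus the sum of [h] over the jumps.

   The part of [h] that vanishes near [0] is handled path by path: for a cadlag
   path, sums over the increments tend to sums over the jumps.  Near [0], [h] is
   compared with [q x = 1 - exp (- x^2)].  The increment [X (1/n)] is the sum of
   [sigma B (1/n)], of a remainder with small second moment and of large jumps
   that occur with probability O(1/n); since [q] has an explicit mean under a
   Gaussian law, [n E q(X (1/n))], restricted to small increments, tends to
   [sigma^2].  Chebyshev's inequality on a finite grid and monotonicity in time
   then give the uniform convergence.  The moments of the compensated sums of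
   jumps come by Fatou's lemma from those of sums of increments, once the Levy
   measure is identified as the limit of [n E phi(X (1/n))].

   As a consequence the wealth is close to the limit process at the grid times,
   and a cadlag path composed with the discretization of time tends to that path
   in the Skorokhod topology. *)

(** * Elementary functions *)

(** The hypotheses do not state that [B] is independent of the jumps, nor that the jumps form a
    Poisson measure, and [M] is known only as an L2 limit at each fixed time. So an increment, the
    sum of [sigma B], a remainder [V] and large jumps, is never treated through a joint law: [q] at
    the increment is compared pointwise with [q (sigma B)], and every error term involves one
    variable only, through [q], [q^2], [V^2] or the indicator of a large jump. The function [q] is
    bounded, whereas [x^2] need not be integrable, and both [q] and [q^2] have explicit Gaussian
    means: that of [q] is of order 1/n, that of [q^2] of order 1/n^2, so an error carrying [q^2] may
    have an arbitrarily large constant. Independence of the increments enters through variances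
    only.

    A further obstacle is measurability: paths are cadlag only on a set [G] of full probability, and
    the integrals in the definitions have integrands that are not known to be measurable off [G]. *)

Section calculus.
Variable R : realType.
Implicit Types (x y z e k f r : R).

(** A continuous stand-in for the indicator of [|x| > e]: it vanishes for [|x| <= e], grows with
    slope [k] and reaches 1 at [|x| = e + 1 / k]. *)
Definition ramp e k x : R := Num.min 1 (k * Num.max 0 (`|x| - e)).

Lemma ramp_ge0 e k x : 0 <= k -> 0 <= ramp e k x.
Proof. by move=> k0; rewrite le_min ler01 mulr_ge0// le_max lexx. Qed.

Lemma ramp_le1 e k x : ramp e k x <= 1.
Proof. by rewrite ge_min lexx. Qed.

Lemma ramp_eq0 e k x : `|x| <= e -> ramp e k x = 0.
Proof.
by move=> xe; rewrite /ramp max_l ?subr_le0// mulr0 min_r// ler01.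
Qed.

Lemma ramp_eq1 e k x : 0 < k -> e + k^-1 <= `|x| -> ramp e k x = 1.
Proof.
move=> k0 xe; rewrite /ramp min_l// -ler_pdivrMl// mulr1.
by rewrite le_max lerBrDl xe orbT.
Qed.

Lemma continuous_ramp e k : continuous (ramp e k).
Proof.
move=> x; rewrite /ramp; apply: (@continuous_min R R (cst 1) (fun x => k * Num.max 0 (`|x| - e))).
  exact: cvg_cst.
apply: cvgM; first exact: cvg_cst.
apply: (@continuous_max R R (cst 0) (fun x => `|x| - e)); first exact: cvg_cst.
by apply: cvgB; [exact: norm_continuous|exact: cvg_cst].
Qed.

(* A bounded substitute for [x^2] whose mean under a Gaussian law is explicit. *)
Definition gauss_test x : R := 1 - expR (- x ^+ 2).
Local Notation q := gauss_test.

Lemma gauss_test_ge0 x : 0 <= q x.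
Proof. by rewrite subr_ge0 expR_le1 oppr_le0 sqr_ge0. Qed.

Lemma gauss_test_le1 x : q x <= 1.
Proof. by rewrite gerBl expR_ge0. Qed.

Lemma gauss_test_le_sqr x : q x <= x ^+ 2.
Proof. by have := expR_ge1Dx (- x ^+ 2); rewrite /q; lra. Qed.

(** Convexity: the graph of [expR] lies above its tangent at [- a]. *)
Lemma expRB_le (a b : R) : expR (- a) - expR (- b) <= expR (- a) * (b - a).
Proof.
have -> : - b = - a + (a - b) by ring.
rewrite expRD -{1}(mulr1 (expR (- a))) -mulrBr ler_pM2l ?expR_gt0//.
by have := expR_ge1Dx (a - b); lra.
Qed.

Lemma sqr_expR_le x : x ^+ 2 * expR (- x ^+ 2) <= q x.
Proof.
have := expRB_le 0 (x ^+ 2); rewrite oppr0 expR0 => _.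
have := expR_ge1Dx (x ^+ 2); rewrite -(ler_pM2r (expR_gt0 (- x ^+ 2))).
by rewrite -expRD addrN expR0 /q; lra.
Qed.

Lemma sqr_le_gauss_test x : x ^+ 2 <= (1 + x ^+ 2) * q x.
Proof.
have := expR_ge1Dx (x ^+ 2); rewrite -(ler_pM2r (expR_gt0 (- x ^+ 2))).
by rewrite -expRD addrN expR0 /q; lra.
Qed.

Lemma gauss_test_mono x y : `|x| <= `|y| -> q x <= q y.
Proof.
move=> xy; rewrite lerB// ler_expR lerN2 -(ger0_norm (sqr_ge0 x)).
by rewrite -(ger0_norm (sqr_ge0 y)) !normrX lerXn2r ?nnegrE.
Qed.

Lemma gauss_test_gt0 x : x != 0 -> 0 < q x.
Proof. by move=> x0; rewrite subr_gt0 expR_lt1 oppr_lt0 exprn_even_gt0. Qed.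

(** The first-order term [2 x y expR (- x^2)] is split by Young's inequality, and
    [x^2 expR (- x^2) <= q x] absorbs the part in [x]. The bound separates [x] from [y], so means
    can be taken without any independence. *)
Lemma gauss_test_increment r x y : 0 < r ->
  `|q (x + y) - q x| <= r * q x + (3 + r^-1) * y ^+ 2.
Proof.
have step s u v : 0 < s ->
    q (u + v) - q u <= s * q u + (s^-1 + 1) * v ^+ 2.
  move=> s0.
  have h1 : q (u + v) - q u <= expR (- u ^+ 2) * (2 * u * v + v ^+ 2).
    have := expRB_le (u ^+ 2) ((u + v) ^+ 2).
    rewrite /q (_ : (u + v) ^+ 2 - u ^+ 2 = 2 * u * v + v ^+ 2); last by ring.
    lra.
  apply: le_trans h1 _.
  have E1 : expR (- u ^+ 2) <= 1 by rewrite expR_le1 oppr_le0 sqr_ge0.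
  have E0 := expR_ge0 (- u ^+ 2); have h2 := sqr_expR_le u.
  set E := expR _ in E1 E0 h2 *.
  (* AM-GM: [2 u v E <= s u^2 E^2 + v^2 / s] *)
  have h3 : 2 * (u * E) * v <= s * (u * E) ^+ 2 + s^-1 * v ^+ 2.
    rewrite -subr_ge0 (_ : _ - _ = s^-1 * (s * (u * E) - v) ^+ 2).
      by rewrite mulr_ge0 ?invr_ge0 ?sqr_ge0// ltW.
    by field; rewrite gt_eqF.
  have h4 : s * (u * E) ^+ 2 <= s * q u.
    rewrite ler_pM2l//; apply: le_trans h2.
    rewrite exprMn ler_wpM2l ?sqr_ge0// expr2 -{3}(mulr1 E).
    by rewrite ler_wpM2l.
  have h5 : E * v ^+ 2 <= v ^+ 2 by rewrite ler_piMl ?sqr_ge0.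
  lra.
move=> r0; rewrite ler_norml; apply/andP; split.
(* The lower bound is the upper one applied from [z] back to [x]. The choice of [s] gives
   [s (1 + r) = r], and with [1 / s = 1 / r + 1] the coefficients of [y^2] add up to [3 + 1 / r]. *)
- set z := x + y; set s := r / (1 + r).
  have s0 : 0 < s by rewrite divr_gt0// addr_gt0.
  have h1 : q x - q z <= s * q z + (s^-1 + 1) * y ^+ 2.
    have := step s z (- y) s0; rewrite sqrrN (_ : z - y = x)//.
    by rewrite /z addrK.
  have h2 := step r x y r0.
  have h3 : s * q z <= s * ((1 + r) * q x + (r^-1 + 1) * y ^+ 2).
    by rewrite ler_pM2l// -/z in h2 *; lra.
  rewrite (_ : s * (_ + _) = r * q x + y ^+ 2) in h3; last first.
    by rewrite /s; field; rewrite !gt_eqF ?addr_gt0.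
  rewrite (_ : s^-1 = r^-1 + 1) in h1; last first.
    by rewrite /s; field; rewrite !gt_eqF ?addr_gt0.
  lra.
- have h2 := step r x y r0; have y2 := sqr_ge0 y; lra.
Qed.

Lemma continuous_gauss_test : continuous q.
Proof.
move=> x; apply: cvgB; first exact: cvg_cst.
apply: (@cvg_comp _ _ _ (fun x : R => - x ^+ 2) expR _ _ _ _ (@continuous_expR R _)).
by apply: cvgN; exact: exprn_continuous.
Qed.

(* With a fraction [f] invested, a log-return [x] multiplies the wealth by
   [expR (f * x + log_excess f x)]. *)
Definition log_excess f x : R := ln (1 + f * (expR x - 1)) - f * x.

Section log_excess.
Variable f : R.
Hypotheses (f0 : 0 <= f) (f1 : f <= 1).
Local Notation h := (log_excess f).

Lemma growth_gt0 x : 0 < 1 + f * (expR x - 1).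
Proof.
have := expR_gt0 x; move: f0 f1; rewrite le_eqVlt => /predU1P[<- _|f00 f11] e0.
  by rewrite mul0r addr0.
have : 0 < f * expR x by rewrite mulr_gt0.
lra.
Qed.

(** This is [expR (f x) <= 1 - f + f expR x], by convexity: the bounds [1 + u <= expR u] at
    [u = x - f x] and [u = - f x] are weighted by [f] and [1 - f], so that the linear terms cancel,
    and multiplied by [expR (f x)]. *)
Lemma log_excess_ge0 x : 0 <= h x.
Proof.
rewrite subr_ge0 -[leLHS]expRK ler_ln ?posrE ?expR_gt0 ?growth_gt0//.
have h1 := expR_ge1Dx (x - f * x); have h2 := expR_ge1Dx (- (f * x)).
have : f * (1 + (x - f * x)) <= f * expR (x - f * x) by rewrite ler_wpM2l.
have : (1 - f) * (1 - f * x) <= (1 - f) * expR (- (f * x)).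
  by rewrite ler_wpM2l ?subr_ge0.
move=> h3 h4.
have h5 : 1 <= f * expR (x - f * x) + (1 - f) * expR (- (f * x)) by nra.
have E : expR x = expR (x - f * x) * expR (f * x) by rewrite -expRD subrK.
have E2 : expR (- (f * x)) * expR (f * x) = 1 by rewrite -expRD addNr expR0.
have e0 := expR_gt0 (f * x).
have := ler_wpM2r (ltW e0) h5; rewrite mul1r E mulrDl -!mulrA E2; lra.
Qed.

Lemma log_excess0 : h 0 = 0.
Proof. by rewrite /h expR0 subrr !mulr0 addr0 ln1 subrr. Qed.

Lemma is_derive_log_excess x :
  is_derive x 1 h (f * expR x / (1 + f * (expR x - 1)) - f).
Proof.
have g0 := growth_gt0 x.
have dg : is_derive x 1 (fun x => 1 + f * (expR x - 1)) (f * expR x).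
  have -> : (fun x => 1 + f * (expR x - 1)) = cst (1 - f) + f *: expR.
    by apply/funext => y; rewrite /cst !fctE /GRing.scale/=; ring.
  have := is_deriveD (is_derive_cst (1 - f) x 1)
    (is_deriveZ f (is_derive_expR x)).
  by rewrite add0r.
have := @is_derive1_comp R (@ln R) (fun x => 1 + f * (expR x - 1)) x _ _
  (is_derive1_ln g0) dg => dl.
have -> : h = (@ln R \o (fun x => 1 + f * (expR x - 1))) - f *: id.
  by apply/funext => y; rewrite /h !fctE.
apply: is_derive_eq.
by rewrite /GRing.scale/= mulr1; congr (_ - _); rewrite mulrC.
Qed.

Lemma continuous_log_excess : continuous h.
Proof.
move=> x; apply: differentiable_continuous; apply/derivable1_diffP.
by case: (is_derive_log_excess x).
Qed.

(** Mean value theorem for the remainder [k], which vanishes at 0 and has a derivative [dk] of order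
    [y^2]. For [|y| <= 1 / 4] the denominator [D] of [dk] is at least [1 / 2] and its numerator at
    most [4 y^2], whence the constant 8. *)
Lemma log_excess_taylor x : `|x| <= 1 / 4 ->
  `|h x - f * (1 - f) / 2 * x ^+ 2| <= 8 * `|x| ^+ 3.
Proof.
move=> x14.
pose k y := h y - f * (1 - f) / 2 * y ^+ 2.
pose dk y := f * expR y / (1 + f * (expR y - 1)) - f - f * (1 - f) * y.
have kE : k = h - (f * (1 - f) / 2) *: (id ^+ 2).
  by apply/funext => y; rewrite /k !fctE.
have Dk y : is_derive y 1 k (dk y).
  rewrite kE; have dh := is_derive_log_excess y.
  apply: is_derive_eq.
  by rewrite /dk /GRing.scale/= !mulr1 expr1; lra.
have Ck : continuous k.
  move=> y; apply: differentiable_continuous; apply/derivable1_diffP.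
  by case: (Dk y).
have k00 : k 0 = 0 by rewrite /k log_excess0 expr0n/= mulr0 subr0.
have dkb y : `|y| <= `|x| -> `|dk y| <= 8 * `|x| ^+ 2.
  move=> yx; have y14 := le_trans yx x14.
  apply: (@le_trans _ _ (8 * `|y| ^+ 2)); last first.
    by rewrite ler_pM2l// lerXn2r ?nnegrE.
  have g0 := growth_gt0 y; rewrite real_normK ?num_real//.
  set E := expR y; set D := 1 + f * (E - 1).
  have e1 : 1 + y <= E := expR_ge1Dx y.
  have e2 : E * (1 - y) <= 1.
    have := expR_ge1Dx (- y); rewrite -(ler_pM2r (expR_gt0 y)) -expRD addNr expR0.
    by rewrite -/E; lra.
  have [ya yb] : - (1 / 4) <= y /\ y <= 1 / 4 by move: y14; rewrite ler_norml => /andP.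
  have e3 : E - 1 - y <= 2 * y ^+ 2.
    suff : (E - 1 - y) * (1 - y) <= y ^+ 2.
      move=> h1; have : 0 <= (E - 1 - y) * (1 / 4 - y).
        by rewrite mulr_ge0//; lra.
      by nra.
    by nra.
  have a1 : `|E - 1| <= 2 * `|y|.
    rewrite ler_norml; apply/andP; split.
      by have := ler_norm (- y); rewrite normrN; have := normr_ge0 y; lra.
    have : y ^+ 2 <= 1 / 4 * `|y|.
      by rewrite -real_normK ?num_real// expr2 ler_wpM2r.
    have := ler_norm y; have := normr_ge0 y; lra.
  have a2 : `|D - 1| <= 2 * `|y|.
    rewrite /D addrC addKr normrM (ger0_norm f0).
    by apply: le_trans a1; rewrite ler_piMl.
  have D12 : 1 / 2 <= D.
    move: a2; rewrite ler_norml => /andP[]; move: y14; lra.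
  (* Over the common denominator the terms of first order in [y] cancel, leaving two of second
     order. *)
  have dkE : dk y = f * (1 - f) * ((E - 1 - y) - y * (D - 1)) / D.
    by rewrite /dk -/E -/D; rewrite /D in D12 g0 *; field; rewrite gt_eqF.
  have c01 : 0 <= f * (1 - f) <= 1.
    by rewrite mulr_ge0 ?mulr_ile1 ?subr_ge0// gerBl.
  rewrite dkE normrM normfV (gtr0_norm g0) ler_pdivrMr//.
  rewrite normrM (ger0_norm (andP c01).1).
  have n1 : `|(E - 1 - y) - y * (D - 1)| <= 4 * y ^+ 2.
    apply: le_trans (ler_normB _ _) _.
    rewrite ger0_norm ?normrM; last by lra.
    have : `|y| * `|D - 1| <= 2 * y ^+ 2.
      rewrite -[y ^+ 2]real_normK ?num_real// expr2 mulrCA.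
      by rewrite ler_wpM2l.
    lra.
  have := ler_wpM2l (andP c01).1 n1.
  have y2 := sqr_ge0 y.
  have : f * (1 - f) * (4 * y ^+ 2) <= 4 * y ^+ 2.
    by apply: ler_piMl; [rewrite mulr_ge0|exact: (andP c01).2].
  have : 4 * y ^+ 2 <= 8 * y ^+ 2 * D by nra.
  rewrite -/E -/D; lra.
rewrite -/(k x) exprSr mulrA.
have [x0|x0] := leP 0 x.
- have [c] := @MVT_segment R k dk 0 x x0 (fun y _ => Dk y) (@continuous_subspaceT _ _ _ _ Ck).
  rewrite in_itv/= => /andP[c0 cx]; rewrite k00 !subr0 => ->.
  rewrite normrM ler_wpM2r//; apply: dkb.
  by rewrite !ger0_norm.
- have [c] := @MVT_segment R k dk x 0 (ltW x0) (fun y _ => Dk y) (@continuous_subspaceT _ _ _ _ Ck).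
  rewrite in_itv/= => /andP[c0 cx]; rewrite k00 sub0r => E.
  rewrite -normrN E sub0r normrM normrN ler_wpM2r//; apply: dkb.
  by rewrite !ler0_norm ?lerN2// ltW.
Qed.

End log_excess.
End calculus.

(** * Cadlag paths *)

Section cousin.
Variable R : realType.
Implicit Types u v w r : R.

(** Induction on the continuum: the supremum of the points that can be reached from [a] is itself
    reached by the left hypothesis, and is not below [b] by the right one. The two sides are
    separate because a cadlag path is controlled on either side of a point, not across it. *)
Lemma cousin (Q : R -> R -> Prop) (a b : R) : a <= b ->
  (forall u v w, a <= u -> u <= v -> v <= w -> w <= b -> Q u v -> Q v w -> Q u w) ->
  (forall u, a <= u <= b -> exists2 r : R, 0 < r & forall v, u <= v < u + r -> Q u v) ->
  (forall u, a < u <= b -> exists2 r : R, 0 < r & forall v, u - r < v < u -> a <= v -> Q v u) ->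
  Q a b.
Proof.
move=> ab Qtrans Qr Ql.
pose S := [set t | a <= t <= b /\ Q a t].
have Sa : S a.
  have [|r r0 h] := Qr a; first by rewrite lexx.
  by split; [rewrite lexx|apply: h; rewrite lexx ltrDl].
have supS : has_sup S by split; [exists a|exists b => t [/andP[]]].
set s := sup S.
have as_ : a <= s by apply: sup_upper_bound.
have sb : s <= b by apply: ge_sup; [exists a|move=> t [/andP[]]].
have Qas : Q a s.
  move: as_; rewrite le_eqVlt => /predU1P[<-|as_]; first by case: Sa.
  have [|r r0 h] := Ql s; first by rewrite as_.
  have [t [/andP[at_ tb] Qat] st] := sup_adherent r0 supS.
  have ts : t <= s by apply: sup_upper_bound => //; split => //; rewrite at_.
  move: ts; rewrite le_eqVlt => /predU1P[<-//|ts].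
  by apply: (Qtrans a t s) => //; [exact: ltW|apply: h => //; rewrite st].
move: sb; rewrite le_eqVlt => /predU1P[<-//|sb].
have [|r r0 h] := Qr s; first by rewrite as_ ltW.
pose v := Num.min b (s + r / 2).
have sv : s < v by rewrite lt_min sb ltrDl divr_gt0.
have vb : v <= b by rewrite ge_min lexx.
have Qsv : Q s v.
  apply: h; rewrite ltW//= gt_min; apply/orP; right.
  by rewrite ltrD2l gtr_pMr// invf_lt1// ltr1n.
have : v <= s.
  apply: sup_upper_bound => //; split; first by rewrite vb (le_trans as_)// ltW.
  by apply: (Qtrans a s v) => //; exact: ltW.
by rewrite leNgt sv.
Qed.

End cousin.

Section path.
Variables (R : realType).
Implicit Types (x : R -> R) (phi : R -> R) (u v w s t r d e T : R).

Definition cadlag0 x :=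
  x u @[u --> 0^'+] --> x 0 /\ cadlag_on [set t | 0 < t] x.

Definition left_lim x s : R := lim (x u @[u --> s^'-]).

Section fixed_path.
Variable x : R -> R.
Hypothesis cx : cadlag0 x.

Lemma cadlag_right u e : 0 <= u -> 0 < e ->
  exists2 r : R, 0 < r & forall v, u <= v < u + r -> `|x v - x u| < e.
Proof.
move=> u0 e0.
have : x v @[v --> u^'+] --> x u.
  move: u0; rewrite le_eqVlt => /predU1P[<-|u0]; first by case: cx.
  by have [] := cx.2 u u0.
move=> /cvgrPdist_lt /(_ _ e0)[r /= r0 h].
exists r => // v /andP[]; rewrite le_eqVlt => /predU1P[<- _|uv vr].
  by rewrite subrr normr0.
by rewrite distrC; apply: h => //=; rewrite distrC ger0_norm ?subr_ge0 ?ltrBlDl// ltW.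
Qed.

Lemma cadlag_left u e : 0 < u -> 0 < e ->
  exists2 r : R, 0 < r & forall v, u - r < v < u -> `|x v - left_lim x u| < e.
Proof.
move=> u0 e0; have [_ cl] := cx.2 u u0.
move: (cl) => /cvgrPdist_lt /(_ _ e0)[r /= r0 h].
exists r => // v /andP[uv vu].
rewrite distrC; apply: h => //=; rewrite ger0_norm ?subr_ge0 1?ltW//; lra.
Qed.

Lemma jump_small u r d : 0 < r -> 0 < u ->
  (forall v, u - r < v < u -> `|x u - x v| <= d) -> `|jump x u| <= d.
Proof.
move=> r0 u0 h; apply/ler_addgt0Pr => e e0.
have [s s0 hs] := cadlag_left u0 e0.
pose m := Num.min r s; have m0 : 0 < m by rewrite lt_min r0.
have mr : m <= r by rewrite ge_min lexx.
have ms : m <= s by rewrite ge_min lexx orbT.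
have h1 : `|x u - x (u - m / 2)| <= d by apply: h; apply/andP; split; lra.
have h2 : `|x (u - m / 2) - left_lim x u| < e by apply: hs; apply/andP; split; lra.
rewrite /jump -/(left_lim x u).
rewrite (_ : x u - _ = (x u - x (u - m / 2)) + (x (u - m / 2) - left_lim x u)); last by ring.
by apply: le_trans (ler_normD _ _) _; rewrite lerD// ltW.
Qed.

Lemma cadlag_local u d : 0 <= u -> 0 < d ->
  exists2 r : R, 0 < r &
    (forall s t, u <= s < u + r -> u <= t < u + r -> `|x t - x s| <= d) /\
    (0 < u -> forall s t, u - r < s < u -> u - r < t < u -> `|x t - x s| <= d).
Proof.
move=> u0 d0; have d20 : 0 < d / 2 by rewrite divr_gt0.
have [r1 r10 h1] := cadlag_right u0 d20.
have [r2 r20 h2] : exists2 r : R, 0 < r & 0 < u -> forall v, u - r < v < u ->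
    `|x v - left_lim x u| < d / 2.
  move: u0; rewrite le_eqVlt => /predU1P[<-|u0]; first by exists 1; rewrite ?ltxx.
  by have [r r0 h] := cadlag_left u0 d20; exists r.
have tri (a b c : R) : `|a - c| < d / 2 -> `|b - c| < d / 2 -> `|a - b| <= d.
  move=> ac bc; rewrite (splitr d) (_ : a - b = (a - c) - (b - c)); last by ring.
  by apply: le_trans (ler_normB _ _) _; rewrite lerD// ltW.
exists (Num.min r1 r2); first by rewrite lt_min r10.
split.
  move=> s t /andP[us sr] /andP[ut tr].
  by apply: (tri _ _ (x u)); apply: h1; rewrite ?us ?ut/= ?(lt_le_trans sr) ?(lt_le_trans tr)// lerD2l ge_min lexx.
move=> u1 s t /andP[us sr] /andP[ut tr].
have m2 : u - r2 <= u - Num.min r1 r2 by rewrite lerD2l lerN2 ge_min lexx orbT.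
by apply: (tri _ _ (left_lim x u)); apply: h2; rewrite // ?sr ?tr andbT; exact: le_lt_trans m2 _.
Qed.

(** A jump at [s] is read off from values on the side of [u] where [s] lies, and there the path
    oscillates by at most [d]. *)
Lemma cadlag_local_jump u d : 0 <= u -> 0 < d ->
  exists2 r : R, 0 < r &
    forall s, u - r < s < u + r -> 0 < s -> s != u -> `|jump x s| <= d.
Proof.
move=> u0 d0; have [r r0 [hr hl]] := cadlag_local u0 d0.
exists r => // s /andP[us su] s0 su'.
move: su'; rewrite neq_lt => /orP[su'|su'].
- apply: (@jump_small s (s - (u - r)) d) => //; first by rewrite subr_gt0.
  by move=> v /andP[v1 v2]; apply: hl; [lra|apply/andP; split; lra|apply/andP; split; lra].
- apply: (@jump_small s (s - u) d) => //; first by rewrite subr_gt0.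
  by move=> v /andP[v1 v2]; apply: hr; apply/andP; split; lra.
Qed.

(** By [cousin]: close to [u], only [u] itself can carry a jump larger than [d]. *)
Lemma finite_large_jumps T d : 0 < d ->
  finite_set [set s | 0 < s <= T /\ d < `|jump x s| ].
Proof.
move=> d0; have [T0|T0] := ltP T 0.
  rewrite (_ : mkset _ = set0)//; apply/seteqP; split => // s [/andP[s1 s2]].
  by have := lt_le_trans s1 s2; rewrite ltNge ltW.
apply: (@cousin R (fun u v => finite_set [set s | u < s <= v /\ d < `|jump x s|])) => //.
- move=> u v w u0 uv vw wT f1 f2; apply: (@sub_finite_set _ _ (_ `|` _)); last first.
    by rewrite finite_setU; split; [exact: f1|exact: f2].
  move=> s [/andP[us sw] ds]; have [sv|vs] := leP s v; [left|right]; split=> //.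
    by rewrite us.
  by rewrite vs.
- move=> u /andP[u0 _]; have [r r0 h] := cadlag_local_jump u0 d0.
  exists r => // v /andP[uv vr]; rewrite (_ : mkset _ = set0)//.
  apply/seteqP; split => // s [/andP[us sv]]; rewrite ltNge => /negP; apply.
  by apply: h; [apply/andP; split; lra|lra|rewrite gt_eqF].
- move=> u /andP[u0 _]; have [r r0 h] := cadlag_local_jump (ltW u0) d0.
  exists r => // v /andP[uv vr] v0; apply: (@sub_finite_set _ _ [set u]) => //.
  move=> s [/andP[us sv]] ds; apply/eqP; apply: contraTT ds => su.
  by rewrite -leNgt; apply: h => //; [apply/andP; split; lra|lra].
Qed.

Lemma cadlag_bounded T : 0 <= T ->
  exists M, forall t, 0 <= t <= T -> `|x t| <= M.
Proof.
move=> T0.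
apply: (@cousin R (fun u v => exists M, forall t, u <= t <= v -> `|x t| <= M)) => //.
- move=> u v w u0 uv vw wT [M1 h1] [M2 h2]; exists (Num.max M1 M2) => t /andP[ut tw].
  have [tv|vt] := leP t v; rewrite le_max; first by rewrite h1// ut.
  by rewrite h2 ?orbT// tw ltW.
- move=> u /andP[u0 _]; have [r r0 h] := cadlag_right u0 ltr01.
  exists r => // v /andP[uv vr]; exists (`|x u| + 1) => t /andP[ut tv].
  have := h t; rewrite ut (le_lt_trans tv vr)/= => /(_ isT) h1.
  rewrite -[x t](subrK (x u)); apply: le_trans (ler_normD _ _) _.
  by rewrite addrC lerD2l ltW.
- move=> u /andP[u0 _]; have [r r0 h] := cadlag_left u0 ltr01.
  exists r => // v /andP[uv vr] v0.
  exists (Num.max `|x u| (`|left_lim x u| + 1)) => t /andP[ut tv].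
  rewrite le_max; move: tv; rewrite le_eqVlt => /predU1P[->|tu]; first by rewrite lexx.
  have := h t; rewrite tu (lt_le_trans uv ut)/= => /(_ isT) h1.
  rewrite -{2}[x t](subrK (left_lim x u)); apply/orP; right.
  by apply: le_trans (ler_normD _ _) _; rewrite addrC lerD2l ltW.
Qed.


Section jump_sum.
Variables (phi : R -> R) (d : R).
Hypotheses (d0 : 0 < d) (phi0 : forall y : R, `|y| <= d -> phi y = 0).

Lemma finite_jump_support s t : 0 <= s ->
  finite_set (`]s, t] `&` [set u | d < `|jump x u| ]).
Proof.
move=> s0; apply: sub_finite_set (finite_large_jumps t d0) => u [] /=.
by rewrite in_itv/= => /andP[su ut] du; rewrite ut (le_lt_trans s0 su).
Qed.

Lemma jump_sum_supp (V : nmodType) (F : R -> V) s t :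
  (forall u, `|jump x u| <= d -> F u = 0) ->
  \sum_(u \in `]s, t]) F u =
  \sum_(u \in `]s, t] `&` [set u | d < `|jump x u| ]) F u.
Proof.
move=> F0; apply/esym/fsbig_widen; first by move=> u [].
by move=> u [] /= ut /not_andP[//|/negP]; rewrite -leNgt; exact: F0.
Qed.

End jump_sum.

(** A sum over an uncountable index set, meaningful for [phi] vanishing near 0: only finitely many
    jumps then contribute. *)
Definition jump_sum phi t : R := \sum_(s \in `]0, t]) phi (jump x s).

Lemma jump_sumB phi d s t : 0 < d -> (forall y, `|y| <= d -> phi y = 0) ->
  0 <= s -> s <= t ->
  jump_sum phi t - jump_sum phi s = \sum_(u \in `]s, t]) phi (jump x u).
Proof.
move=> d0 phi0 s0 st; apply/eqP; rewrite subr_eq addrC; apply/eqP.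
have F0 u : `|jump x u| <= d -> phi (jump x u) = 0 by exact: phi0.
rewrite /jump_sum !(@jump_sum_supp d R _ _ _ F0) -fsbigU.
- apply: eq_fsbigl; rewrite -setIUl; congr (_ `&` _).
  apply/seteqP; split => u /=; rewrite !in_itv/=.
    by move=> /andP[u0 ut]; have [us|su] := leP u s; [left; rewrite u0|right].
  by move=> [/andP[u0 us]|/andP[su ut]]; rewrite ?u0 ?ut ?(le_trans us)// (le_lt_trans s0).
- exact: finite_jump_support.
- exact: finite_jump_support.
- move=> u [[h1 _] [h2 _]] /=; move: h1 h2; rewrite /= !in_itv/= => /andP[_ us] /andP[su _].
  by have := le_lt_trans us su; rewrite ltxx.
Qed.

Lemma jump_sum0 phi : jump_sum phi 0 = 0.
Proof. by rewrite /jump_sum set_interval.set_itv_ge ?bnd_simp ?ltxx// fsbig_set0. Qed.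

Lemma inv_nat_lt e : 0 < e -> exists N, forall n, (N <= n)%N ->
  (0 < n)%N /\ n%:R^-1 < e.
Proof.
move=> e0; exists (Num.truncn e^-1).+1 => n Nn.
have n0 : (0 < n)%N by exact: leq_trans Nn.
split=> //; rewrite invf_plt ?posrE ?ltr0n//.
by apply: lt_le_trans (truncnS_gt _) _; rewrite ler_nat.
Qed.

(** * Sums over the increments on a grid against sums over the jumps *)

Section riemann.
Variables (phi : R -> R) (d : R).
Hypotheses (d0 : 0 < d) (phi0 : forall y : R, `|y| <= d -> phi y = 0).
Hypothesis (cphi : continuous phi).

(** The discrepancy at the grid time [k / n]. Its variation between two grid times depends only on
    the path between them, which permits the local-to-global argument by [cousin]. *)
Let g n k : R := \sum_(j < k) phi (x (j.+1%:R / n%:R) - x (j%:R / n%:R)) -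
  jump_sum phi (k%:R / n%:R).

Let gS n k : g n k.+1 - g n k = phi (x (k.+1%:R / n%:R) - x (k%:R / n%:R)) -
  \sum_(u \in `]k%:R / n%:R, k.+1%:R / n%:R]) phi (jump x u).
Proof.
rewrite -(@jump_sumB _ d)// ?divr_ge0//; last by rewrite ler_wpM2r ?invr_ge0// ler_nat.
by rewrite /g big_ord_recr/=; ring.
Qed.

Let jump_sum_small s t : (forall u, s < u <= t -> `|jump x u| <= d) ->
  \sum_(u \in `]s, t]) phi (jump x u) = 0.
Proof. by move=> h; apply: fsbig1 => u /=; rewrite in_itv/= => /h/phi0. Qed.

(** Near [u], the grid steps that do not straddle [u] have increments at most [d], and the jumps at
    other times are at most [d], so [phi] kills both. In the one step containing [u] the increment
    tends to the jump at [u], and [phi] is continuous. The radius [r] does not depend on the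
    accuracy [e], as [cousin] requires. *)
Let riemann_local u : 0 <= u -> exists2 r : R, 0 < r & forall e, 0 < e ->
  exists N, forall n, (N <= n)%N -> forall a k, (a <= k)%N ->
  u - r < a%:R / n%:R -> k%:R / n%:R < u + r -> `|g n k - g n a| <= e.
Proof.
move=> u0.
have [r1 r10 h1] := cadlag_local_jump u0 d0.
have [r2 r20 [h2 h3]] := cadlag_local u0 d0.
exists (Num.min r1 r2); first by rewrite lt_min r10.
set r := Num.min r1 r2.
have rr1 : r <= r1 by rewrite ge_min lexx.
have rr2 : r <= r2 by rewrite ge_min lexx orbT.
move=> e e0.
have [p p0 hp] : exists2 p : R, 0 < p &
    forall y, `|y - jump x u| < p -> `|phi y - phi (jump x u)| <= e.
  have := @cphi (jump x u) => /cvgrPdist_le /(_ _ e0)[p /= p0 hp].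
  by exists p => // y yp; rewrite distrC; apply: hp; rewrite /= distrC.
have p20 : 0 < p / 2 by rewrite divr_gt0.
have [r3 r30 h4] := cadlag_right u0 p20.
have [r4 r40 h5] : exists2 r : R, 0 < r & 0 < u -> forall v, u - r < v < u ->
    `|x v - left_lim x u| < p / 2.
  move: u0; rewrite le_eqVlt => /predU1P[<-|u0]; first by exists 1; rewrite ?ltxx.
  by have [r4 r40 h] := cadlag_left u0 p20; exists r4.
have [N hN] := @inv_nat_lt (Num.min r3 r4) ltac:(by rewrite lt_min r30).
exists N => n /hN[n0]; rewrite lt_min => /andP[nr3 nr4] a k ak ua.
(* The difference of the two booleans is 1 if the step containing [u] lies between [a] and [k], and
   0 otherwise: the error [e] is paid at most once. *)
have ind : (a <= k)%N -> k%:R / n%:R < u + r ->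
    `|g n k - g n a| <= e * ((u <= k%:R / n%:R)%R%:R - (u <= a%:R / n%:R)%R%:R).
  elim: k {ak} => [|k IH].
    by rewrite leqn0 => /eqP -> _; rewrite !subrr normr0 mulr0.
  rewrite leq_eqVlt => /predU1P[-> _|]; first by rewrite !subrr normr0 mulr0.
  rewrite ltnS => ak kr.
  have kkS : k%:R / n%:R < k.+1%:R / n%:R :> R.
    by rewrite ltr_pM2r ?invr_gt0 ?ltr0n// ltr_nat.
  have {IH} := IH ak (lt_trans kkS kr).
  have uk : u - r < k%:R / n%:R.
    by apply: lt_le_trans ua _; rewrite ler_wpM2r ?invr_ge0// ler_nat.
  have k0 : 0 <= k%:R / n%:R :> R by rewrite divr_ge0.
  have kS : k.+1%:R / n%:R = k%:R / n%:R + n%:R^-1 :> R.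
    by rewrite -natr1 mulrDl mul1r.
  suff h : `|g n k.+1 - g n k| <=
      e * ((u <= k.+1%:R / n%:R)%R%:R - (u <= k%:R / n%:R)%R%:R).
    move=> IH; rewrite -(subrK (g n k) (g n k.+1)) -addrA.
    by apply: le_trans (ler_normD _ _) _; lra.
  rewrite gS; move: kkS kr uk k0 kS; set s := k%:R / n%:R; set t := k.+1%:R / n%:R.
  move=> st tr us s0 tE.
  have [ut|tu] := leP u t; last first.
    rewrite (leNgt u s) (lt_trans st tu)/= subrr mulr0.
    rewrite jump_sum_small; last first.
      by move=> v /andP[sv vt]; apply: h1; [lra|lra|rewrite lt_eqF//; lra].
    by rewrite phi0 ?subrr ?normr0//; apply: h3; lra.
  have [us'|su] := leP u s.
    rewrite subrr mulr0 jump_sum_small; last first.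
      by move=> v /andP[sv vt]; apply: h1; [lra|lra|rewrite gt_eqF//; lra].
    by rewrite phi0 ?subrr ?normr0//; apply: h2; lra.
  have u1 : 0 < u by lra.
  rewrite /= mulr1n subr0 mulr1.
  rewrite -(@fsbig_widen _ _ _ _ [set u])/=; last 2 first.
  - by move=> v ->/=; rewrite in_itv/= su.
  - move=> v [] /=; rewrite in_itv/= => /andP[sv vt] /eqP vu.
    by apply: phi0; apply: h1 => //; lra.
  rewrite fsbig_set1; apply: hp.
  rewrite (_ : x t - x s - _ = (x t - x u) - (x s - left_lim x u)); last first.
    by rewrite /jump -/(left_lim x u); ring.
  rewrite (splitr p); apply: le_lt_trans (ler_normB _ _) _; apply: ltrD.
    by apply: h4; lra.
  by apply: h5 => //; lra.
move=> kr; apply: le_trans (ind ak kr) _.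
by case: (u <= _ / _); case: (u <= _ / _); rewrite /= ?mulr1n ?mulr0n; lra.
Qed.

Lemma riemann_jump_sum T e : 0 <= T -> 0 < e ->
  exists N, forall n, (N <= n)%N -> forall k, k%:R <= n%:R * T ->
  `|\sum_(j < k) phi (x (j.+1%:R / n%:R) - x (j%:R / n%:R)) -
    jump_sum phi (k%:R / n%:R)| <= e.
Proof.
move=> T0 e0.
pose tr n u := Num.truncn (n%:R * u : R).
have trle n u : (0 < n)%N -> 0 <= u -> (tr n u)%:R / n%:R <= u.
  move=> n0 u0; rewrite ler_pdivrMr ?ltr0n// mulrC.
  by rewrite truncn_le mulr_ge0.
have trgt n u : (0 < n)%N -> 0 <= u -> u - n%:R^-1 < (tr n u)%:R / n%:R.
  move=> n0 u0; rewrite ltrBlDr -{2}[n%:R^-1]mul1r -mulrDl natr1.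
  by rewrite ltr_pdivlMr ?ltr0n// mulrC truncnS_gt.
(* Intervals are represented by the indices [tr n u] and [tr n v], so that adjacent ones share an
   index and the estimates add up. As [tr n u / n] may lie to the left of [u] by up to [1 / n], the
   local estimate has to hold on both sides of [u]. *)
pose Q u v := forall e, 0 < e -> exists N, forall n, (N <= n)%N ->
  forall k, (tr n u <= k <= tr n v)%N -> `|g n k - g n (tr n u)| <= e.
suff : Q 0 T.
  move=> /(_ _ e0)[N hN]; exists N => n Nn k kT.
  have := hN n Nn k; rewrite /tr mulr0 truncn0 /=.
  rewrite truncn_ge_nat ?mulr_ge0// kT => /(_ isT).
  by rewrite {2}/g big_ord0 mul0r jump_sum0 !subr0.
apply: (@cousin R) => //.
- move=> u v w u0 uv vw wT h1 h2 {e0}e e0.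
  have e20 : 0 < e / 2 by rewrite divr_gt0.
  have [N1 hN1] := h1 _ e20; have [N2 hN2] := h2 _ e20.
  exists (maxn N1 N2) => n; rewrite geq_max => /andP[n1 n2] k /andP[uk kw].
  have uv' : (tr n u <= tr n v)%N by apply: le_truncn; rewrite ler_wpM2l.
  have [kv|vk] := leqP k (tr n v).
    by apply: le_trans (hN1 n n1 k _) _; rewrite ?uk//; lra.
  rewrite -(subrK (g n (tr n v)) (g n k)) -addrA (splitr e).
  apply: le_trans (ler_normD _ _) _; apply: lerD.
    by apply: hN2 => //; rewrite ltnW.
  by apply: hN1; rewrite // uv' leqnn.
- move=> u /andP[u0 _]; have [r r0 h] := riemann_local u0.
  exists r => // v /andP[uv vr] {e0}e e0.
  have [N1 hN1] := h _ e0; have [N2 hN2] := inv_nat_lt r0.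
  exists (maxn N1 N2) => n; rewrite geq_max => /andP[n1 /hN2[n0 nr]] k /andP[uk kv].
  apply: hN1 => //; first by have := trgt n u n0 u0; lra.
  apply: le_lt_trans vr; apply: le_trans (trle n v n0 (le_trans u0 uv)).
  by rewrite ler_wpM2r ?invr_ge0// ler_nat.
- move=> u /andP[u0 _]; have [r r0 h] := riemann_local (ltW u0).
  exists r => // v /andP[uv vr] v0 {e0}e e0.
  have [N1 hN1] := h _ e0; have [N2 hN2] := @inv_nat_lt (v - (u - r)) ltac:(by lra).
  exists (maxn N1 N2) => n; rewrite geq_max => /andP[n1 /hN2[n0 nr]] k /andP[uk kv].
  apply: hN1 => //; first by have := trgt n v n0 v0; lra.
  have := trle n u n0 (ltW u0).
  have : k%:R / n%:R <= (tr n u)%:R / n%:R :> R.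
    by rewrite ler_wpM2r ?invr_ge0// ler_nat.
  lra.
Qed.

End riemann.

End fixed_path.
End path.

(** * Sums over the jumps of a path *)

Section jump_sum_theory.
Variables (R : realType) (x : R -> R).
Hypothesis cx : cadlag0 x.
Implicit Types (phi psi : R -> R) (s t d e : R).

Definition vanishing d phi := 0 < d /\ forall y, `|y| <= d -> phi y = 0.

Lemma vanishing_le d e phi : 0 < e -> e <= d -> vanishing d phi -> vanishing e phi.
Proof. by move=> e0 ed [d0 h]; split => // y ye; apply: h; exact: le_trans ed. Qed.

Let J t d := `]0, t]%classic `&` [set u | d < `|jump x u| ].

Let finJ t d : 0 < d -> finite_set (J t d).
Proof. by move=> d0; exact: finite_jump_support. Qed.

Lemma jump_sumE d phi t : vanishing d phi ->
  jump_sum x phi t = \sum_(u \in J t d) phi (jump x u).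
Proof. by move=> [d0 h]; apply: (@jump_sum_supp R x d R) => u /h. Qed.

Lemma jump_sumD d phi psi t : vanishing d phi -> vanishing d psi ->
  jump_sum x (phi \+ psi) t = jump_sum x phi t + jump_sum x psi t.
Proof.
move=> vp vs; have vps : vanishing d (phi \+ psi).
  by split => [|y yd]; [case: vp|rewrite /= vp.2// vs.2// addr0].
rewrite !(@jump_sumE d)// -(@fsbig_split R R 0 +%R)//.
by apply: finJ; case: vp.
Qed.

Lemma jump_sumZ (k : R) phi t : jump_sum x (fun y => k * phi y) t = k * jump_sum x phi t.
Proof. by rewrite /jump_sum -mulr_fsumr. Qed.

Lemma jump_sumBf d phi psi t : vanishing d phi -> vanishing d psi ->
  jump_sum x (fun y => phi y - psi y) t = jump_sum x phi t - jump_sum x psi t.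
Proof.
move=> vp vs.
rewrite -[X in _ - X]mul1r -mulNr -jump_sumZ -(@jump_sumD d)//.
  by apply: eq_fsbigr => u _ /=; rewrite mulN1r.
by split => [|y yd]; [case: vs|rewrite vs.2// mulr0].
Qed.

Lemma jump_sum_ge0 phi t : (forall y, 0 <= phi y) -> 0 <= jump_sum x phi t.
Proof. by move=> h; apply: fsumr_ge0. Qed.

Lemma jump_sum_le d phi psi t : vanishing d phi -> vanishing d psi ->
  (forall y, phi y <= psi y) -> jump_sum x phi t <= jump_sum x psi t.
Proof.
move=> vp vs le; rewrite -subr_ge0 -(@jump_sumBf d)//.
by apply: jump_sum_ge0 => y; rewrite subr_ge0.
Qed.

Lemma jump_sum_nondecreasing d phi s t : vanishing d phi -> (forall y, 0 <= phi y) ->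
  0 <= s -> s <= t -> jump_sum x phi s <= jump_sum x phi t.
Proof.
move=> [d0 vp] p0 s0 st; rewrite -subr_ge0 (@jump_sumB R x cx phi d)//.
by apply: fsumr_ge0.
Qed.

Lemma jump_sum_ge_term d phi s t : vanishing d phi -> (forall y, 0 <= phi y) ->
  0 < s -> s <= t -> phi (jump x s) <= jump_sum x phi t.
Proof.
move=> vp p0 s0 st; have [sd|ds] := leP `|jump x s| d.
  by rewrite vp.2//; exact: jump_sum_ge0.
rewrite (jump_sumE _ vp) (@fsbigD1 _ _ _ _ s)//.
- by rewrite lerDl; apply: fsumr_ge0.
- by apply: finJ; case: vp.
- by split => //=; rewrite in_itv/= s0.
Qed.

Lemma jump_sum_eq0 phi t : (forall s, 0 < s <= t -> phi (jump x s) = 0) ->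
  jump_sum x phi t = 0.
Proof. by move=> h; apply: fsbig1 => s /=; rewrite in_itv/= => /h. Qed.

(** The common [d] makes all the sums run over the same finite set of jumps. *)
Lemma jump_sum_cvg d (phi_ : nat -> R -> R) phi t :
  (forall n, vanishing d (phi_ n)) -> vanishing d phi ->
  (forall y, phi_ n y @[n --> \oo] --> phi y) ->
  jump_sum x (phi_ n) t @[n --> \oo] --> jump_sum x phi t.
Proof.
move=> vn vp h.
have d0 := vp.1.
have E psi : vanishing d psi -> jump_sum x psi t =
    \sum_(u <- finmap.enum_fset (fset_set (J t d))) psi (jump x u).
  by move=> v; rewrite (jump_sumE _ v) fsbig_finite//; exact: finJ.
rewrite (E _ vp) (_ : (fun n => _) = fun n =>
    \sum_(u <- finmap.enum_fset (fset_set (J t d))) phi_ n (jump x u)); last first.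
  by apply/funext => n; rewrite E.
by apply: cvg_big => [|u _]; [exact: add_continuous|exact: h].
Qed.

Lemma jump_sum_right d phi t : vanishing d phi -> 0 <= t ->
  exists2 r : R, 0 < r & forall v, t <= v < t + r -> jump_sum x phi v = jump_sum x phi t.
Proof.
move=> [d0 vp] t0; have [r r0 h] := cadlag_local_jump cx t0 d0.
exists r => // v /andP[tv vr]; apply/eqP.
rewrite -subr_eq0 (@jump_sumB R x cx phi d)//; apply/eqP/fsbig1 => u /=.
rewrite in_itv/= => /andP[tu uv]; apply/vp/h.
- by rewrite (le_lt_trans uv vr) (lt_trans _ tu)// ltrBlDr ltrDl.
- exact: le_lt_trans tu.
- by rewrite gt_eqF.
Qed.

Let window t : set (R * R) := [set z | 0 < z.2 <= t].

Lemma measurable_window t : measurable (window t).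
Proof.
rewrite (_ : window t = snd @^-1` `]0, t]); last first.
  by apply/seteqP; split => z /=; rewrite in_itv.
by rewrite -[X in measurable X]setTI; exact: measurable_snd.
Qed.

(** On the jumps larger than [d] in the window, the jump measure is a finite sum of Dirac masses by
    [finite_large_jumps]; elsewhere in the window [phi] is 0. *)
Lemma integral_jump_measure d phi t : measurable_fun setT phi ->
  vanishing d phi -> (forall y, 0 <= phi y) ->
  (\int[jump_measure x]_(z in [set z | (0 < z.2 <= t)%R]) (phi z.1)%:E)%E =
    (jump_sum x phi t)%:E.
Proof.
move=> mphi vp phi0; have d0 := vp.1.
have mf : measurable_fun setT (EFin \o (phi \o fst : R * R -> R)).
  by apply/measurable_EFinP; apply: (measurableT_comp mphi); exact: measurable_fst.
pose D := window t `&` [set z | d < `|z.1| ].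
have mD : measurable D.
  apply: measurableI; first exact: measurable_window.
  rewrite (_ : mkset _ = (Num.norm \o fst) @^-1` `]d, +oo[); last first.
    by apply/seteqP; split => z /=; rewrite in_itv/= andbT.
  rewrite -[X in measurable X]setTI.
  have : measurable_fun setT ((@Num.norm R R) \o fst : R * R -> R).
    by apply: measurableT_comp; [exact: normr_measurable|exact: measurable_fst].
  by apply.
have -> : (\int[jump_measure x]_(z in window t) (phi z.1)%:E =
           \int[jump_measure x]_(z in D) (phi z.1)%:E)%E.
  rewrite integral_mkcond [RHS]integral_mkcond; apply: eq_integral => z _.
  rewrite !patchE; case: ifPn => [|]; last first.
    by move=> /negP h; case: ifPn => // /set_mem[] /mem_set.
  move=> zt; case: ifPn => // /negP h; congr EFin; apply: vp.2; rewrite leNgt.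
  by apply/negP => dz; apply: h; apply: mem_set; split => //; exact: set_mem.
pose K := finmap.enum_fset (fset_set (J t d)).
pose pt i := (jump x (nth 0 K i), nth 0 K i).
pose m_ i : {measure set (R * R)%type -> \bar R} := \d_(pt i).
have inK u : u \in K -> J t d u by rewrite /K in_fset_set ?inE//; exact: finJ.
rewrite (@eq_measure_integral _ _ _ _ (msum m_ (size K))); last first.
  move=> A mA AD; rewrite /msum /= /jump_measure.
  rewrite (_ : (\esum_(s in _) _)%E = \esum_(s in J t d) \d_(jump x s, s) A)%E.
    rewrite esum_fset//; last exact: finJ.
    rewrite fsbig_finite; last exact: finJ.
    by rewrite (big_nth 0) big_mkord.
  rewrite esum_mkcond [RHS]esum_mkcond; apply: eq_esum => s _.
  case: ifPn; case: ifPn => //.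
  - move=> /negP h _; rewrite diracE; case: (boolP (_ \in A)) => // /set_mem/AD[/= st ds].
    by exfalso; apply: h; apply: mem_set; split => //=; rewrite in_itv.
  - move=> /set_mem[/=]; rewrite in_itv/= => /andP[s0 st] ds /negP[].
    by apply: mem_set; split => //; rewrite -normr_gt0 (lt_trans d0).
rewrite ge0_integral_measure_sum//; [|by move=> z _; rewrite lee_fin|exact: measurable_funTS].
rewrite (jump_sumE _ vp) fsbig_finite; last exact: finJ.
rewrite -/K (big_nth 0) big_mkord -sumEFin; apply: eq_bigr => i _.
rewrite integral_dirac//; last exact: measurable_funTS.
rewrite diracE mem_set ?mul1e//.
have [/=] := inK _ (mem_nth 0 (ltn_ord i)).
by rewrite in_itv.
Qed.

Lemma Rintegral_jump_measure d phi (E : set R) t : measurable_fun setT phi ->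
  measurable E -> 0 < d -> (forall y, `|y| <= d -> ~ E y) ->
  (\int[jump_measure x]_(z in [set z | E z.1 /\ 0 < z.2 <= t]) phi z.1)%R =
    jump_sum x (phi \_ E) t.
Proof.
move=> mphi mE d0 Ed; rewrite /Rintegral integral_mkcond.
have vE : vanishing d (phi \_ E).
  by split => // y /Ed yE; rewrite patchE; case: ifPn => // /set_mem.
have mp : measurable_fun setT (phi \_ E).
  by apply/(measurable_restrictT _ _).1 => //; exact: measurable_funTS.
rewrite (_ : _ \_ _ = (fun z => ((phi \_ E) z.1)%:E) \_ (window t)); last first.
  apply/funext => z; rewrite !patchE; case: ifPn => [/set_mem[Ez zt]|/negP h].
    have -> : z \in window t by exact: mem_set.
    by have -> : z.1 \in E by exact: mem_set.
  case: ifPn => // /set_mem zt; case: ifPn => // /set_mem Ez.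
  by exfalso; apply: h; exact: mem_set.
rewrite -integral_mkcond integralE.
have vp : vanishing d (fun y => Num.max ((phi \_ E) y) 0).
  by split => // y yd; rewrite vE.2// maxxx.
have vn : vanishing d (fun y => Num.max (- (phi \_ E) y) 0).
  by split => // y yd; rewrite vE.2// oppr0 maxxx.
under eq_integral => z _ do rewrite funeposE -EFin_max.
under [X in (_ - X)%E]eq_integral => z _ do rewrite funenegE -EFinN -EFin_max.
rewrite (@integral_jump_measure d (fun y => Num.max ((phi \_ E) y) 0))//; last 2 first.
- by apply: measurable_maxr => //; exact: measurable_cst.
- by move=> y; rewrite le_max lexx orbT.
rewrite (@integral_jump_measure d (fun y => Num.max (- (phi \_ E) y) 0))//; last 2 first.
- apply: measurable_maxr; last exact: measurable_cst.
  by apply: measurableT_comp mp; exact: oppr_measurable.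
- by move=> y; rewrite le_max lexx orbT.
rewrite -EFinB /= -(@jump_sumBf d)//.
apply: eq_fsbigr => u _; set v := (phi \_ E) _.
by case: (leP v 0) => h; case: (leP (- v) 0) => h'; lra.
Qed.

Lemma jump_measure_count d (E : set R) t : measurable E -> 0 < d ->
  (forall y, `|y| <= d -> ~ E y) ->
  jump_measure x (E `*` [set s | (0 < s <= t)%R]) = (jump_sum x (\1_E : R -> R) t)%:E.
Proof.
move=> mE d0 Ed; rewrite -(@integral_jump_measure d)//; last first.
  by split => // y /Ed yE; rewrite indicE memNset.
have mW : measurable [set z : R * R | 0 < z.2 <= t] := measurable_window t.
have mE1 : measurable (fst @^-1` E : set (R * R)).
  by rewrite -[X in measurable X]setTI; exact: measurable_fst.
rewrite (_ : (fun z : R * R => _) = (fun z => (\1_(fst @^-1` E) z)%:E)); last first.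
  by apply/funext => z; rewrite !indicE.
by rewrite integral_indic//; congr (jump_measure x _); apply/seteqP; split => z [].
Qed.

End jump_sum_theory.

(** * Truncation of the jumps near 0 *)

Section cutoff.
Variable R : realType.
Implicit Types (y : R) (i : nat).

(** It is 0 for [|y| <= 1 / (i + 1)] and 1 for [|y| >= 2 / (i + 1)], and increases with [i] to the
    indicator of [y != 0]. *)
Definition cut i y : R := ramp i.+1%:R^-1 i.+1%:R y.

Lemma cut_ge0 i y : 0 <= cut i y.
Proof. exact: ramp_ge0. Qed.

Lemma cut_le1 i y : cut i y <= 1.
Proof. exact: ramp_le1. Qed.

Lemma continuous_cut i : continuous (cut i).
Proof. exact: continuous_ramp. Qed.

Lemma measurable_cut i : measurable_fun setT (cut i).
Proof. by apply: continuous_measurable_fun; exact: continuous_cut. Qed.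

Lemma vanishing_cut i : vanishing i.+1%:R^-1 (cut i).
Proof. by split=> [|y]; [rewrite invr_gt0|exact: ramp_eq0]. Qed.

Lemma vanishing_mul_cut (g : R -> R) i : vanishing i.+1%:R^-1 (fun y => g y * cut i y).
Proof. by have [d0 h] := vanishing_cut i; split => // y /h ->; rewrite mulr0. Qed.

Lemma cut_mono i j y : (i <= j)%N -> cut i y <= cut j y.
Proof.
move=> ij; rewrite /cut /ramp le_min ge_min lexx/=.
rewrite ge_min; apply/orP; right; apply: ler_pM => //.
- by rewrite ler_nat ltnS.
- rewrite ge_max !le_max lexx/=; apply/orP; right.
  by rewrite lerB// lef_pV2 ?posrE// ler_nat.
Qed.

Lemma cut_eq1 i y : 2 / i.+1%:R <= `|y| -> cut i y = 1.
Proof. by move=> h; apply: ramp_eq1 => //; rewrite -mulr2n -[_ *+ 2]mulr_natl. Qed.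

Lemma cut_cvg y : y != 0 -> \forall i \near \oo, cut i y = 1.
Proof.
rewrite -normr_gt0 => y0; have y20 : 0 < `|y| / 2 by rewrite divr_gt0.
have [N hN] := inv_nat_lt y20; exists N => // i /= Ni; apply: cut_eq1.
have [_] := hN i.+1 (leq_trans Ni (leqnSn i)).
by move=> h; rewrite -ler_pdivlMl// mulrC ltW.
Qed.

End cutoff.

Section jump_integral.
Variables (R : realType) (x : R -> R) (g : R -> R).
Hypotheses (cx : cadlag0 x) (g0 : forall y, 0 <= g y) (mg : measurable_fun setT g).
Implicit Types (t T : R).

Let J i t := jump_sum x (fun y => g y * cut i y) t.

(** For [g = log_excess f] this is, by conversion, the integral in [limit_wealth]. *)
Definition jump_integral t : R :=
  \int[jump_measure x]_(z in [set z | z.1 != 0 /\ 0 < z.2 <= t]) g z.1.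

Let J_mono i j t : (i <= j)%N -> J i t <= J j t.
Proof.
move=> ij; apply: (@jump_sum_le _ _ cx j.+1%:R^-1).
- by apply: vanishing_le (vanishing_mul_cut _ _); rewrite ?invr_gt0// lef_pV2 ?posrE// ler_nat.
- exact: vanishing_mul_cut.
- by move=> y; rewrite ler_wpM2l// cut_mono.
Qed.

Let JB_mono i j s t : (i <= j)%N -> 0 <= s -> s <= t -> J j s - J i s <= J j t - J i t.
Proof.
move=> ij s0 st.
have v : vanishing j.+1%:R^-1 (fun y => g y * cut i y).
  by apply: vanishing_le (vanishing_mul_cut _ _); rewrite ?invr_gt0// lef_pV2 ?posrE// ler_nat.
have v' := vanishing_mul_cut g j.
rewrite /J -!(@jump_sumBf _ _ cx _ _ _ _ v' v).
apply: (@jump_sum_nondecreasing _ _ cx j.+1%:R^-1) => //.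
  by split => [|y yd]; rewrite ?invr_gt0// v.2// v'.2// subrr.
by move=> y; rewrite subr_ge0 ler_wpM2l// cut_mono.
Qed.

Lemma jump_integral_cvg_ereal t :
  (J i t)%:E @[i --> \oo] -->
    (\int[jump_measure x]_(z in [set z | (z.1 != 0 /\ 0 < z.2 <= t)%R]) (g z.1)%:E)%E.
Proof.
set D := [set z | _].
pose D' : set (R * R) := [set z | 0 < z.2 <= t].
have mD' : measurable D' := measurable_window t.
have mD1 : measurable [set z : R * R | z.1 != 0].
  rewrite (_ : mkset _ = fst @^-1` (~` [set 0])); last first.
    by apply/seteqP; split => z /= => [/eqP//|/eqP].
  rewrite -[X in measurable X]setTI; apply: measurable_fst => //.
  by apply: measurableC; exact: measurable_set1.
have -> : D = D' `&` [set z | z.1 != 0] by apply/seteqP; split => z [].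
have mgf : measurable_fun setT (g \o fst : R * R -> R).
  by apply: measurableT_comp => //; exact: measurable_fst.
pose G i (z : R * R) := (g z.1 * cut i z.1)%:E.
have mG i : measurable_fun D' (G i).
  apply: measurable_funTS; apply/measurable_EFinP; apply: measurable_funM => //.
  by apply: (measurableT_comp (measurable_cut i)); exact: measurable_fst.
have G0 i z : D' z -> (0%R <= G i z)%E by move=> _; rewrite lee_fin mulr_ge0// cut_ge0.
have Gm z : D' z -> {homo G^~ z : n m / (n <= m)%N >-> (n <= m)%E}.
  by move=> _ n m nm; rewrite lee_fin ler_wpM2l// cut_mono.
have := @cvg_monotone_convergence _ _ _ (jump_measure x) _ mD' G mG G0 Gm.
have -> : (fun n => \int[jump_measure x]_(z in D') G n z)%E = (fun i => (J i t)%:E).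
  apply/funext => i; apply: (@integral_jump_measure _ _ cx i.+1%:R^-1).
  - by apply: measurable_funM => //; exact: measurable_cut.
  - exact: vanishing_mul_cut.
  - by move=> y; rewrite mulr_ge0// cut_ge0.
suff -> : (\int[jump_measure x]_(z in D') limn (G^~ z) =
  \int[jump_measure x]_(z in D' `&` [set z | (z.1 != 0)%R]) (g z.1)%:E)%E by [].
rewrite integral_mkcondr; apply: eq_integral => z _.
apply/cvg_lim => //; rewrite patchE; have [z0|z0] := eqVneq z.1 0.
  rewrite memNset//=; last by rewrite z0 eqxx.
  apply: cvg_near_cst; apply: nearW => i; rewrite /G /cut ramp_eq0 ?mulr0//.
  by rewrite z0 normr0 invr_ge0.
rewrite mem_set//=; apply: cvg_near_cst.
by near=> i; rewrite /G (_ : cut _ _ = 1) ?mulr1//; near: i; exact: cut_cvg.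
Unshelve. all: by end_near. Qed.

Variables (T M : R).
Hypotheses (T0 : 0 <= T) (JM : forall i, J i T <= M).

Let J_le i t : 0 <= t -> t <= T -> J i t <= M.
Proof.
move=> t0 tT; apply: le_trans (JM i); apply: (@jump_sum_nondecreasing _ _ cx i.+1%:R^-1) => //.
- exact: vanishing_mul_cut.
- by move=> y; rewrite mulr_ge0// cut_ge0.
Qed.

(** The bound [M] on the truncated sums makes the extended integral finite; the real-valued integral
    of an infinite one would be the default value 0. *)
Lemma jump_integral_cvg t : 0 <= t -> t <= T -> J i t @[i --> \oo] --> jump_integral t.
Proof.
move=> t0 tT.
have Jcv : cvgn (J^~ t).
  apply: nondecreasing_is_cvgn; first by move=> i j; exact: J_mono.
  by exists M => _ [i _ <-]; exact: J_le.
have := @jump_integral_cvg_ereal t.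
have h : (J i t)%:E @[i --> \oo] --> (limn (J^~ t))%:E by apply: cvg_EFin => //; exact: nearW.
rewrite /jump_integral /Rintegral.
by move=> H; rewrite -(cvg_lim _ H)// (cvg_lim _ h).
Qed.

(** The neglected part is itself a sum of nonnegative terms over the jumps, hence nondecreasing in
    time: its value at [T] bounds it at all times, which gives uniform convergence. *)
Lemma jump_integral_tail i t : 0 <= t -> t <= T ->
  0 <= jump_integral t - J i t <= jump_integral T - J i T.
Proof.
move=> t0 tT; have ct := jump_integral_cvg t0 tT; have cT := jump_integral_cvg T0 (lexx T).
apply/andP; split.
  rewrite subr_ge0 -(cvg_lim _ ct)//.
  apply: limr_ge; first by apply/cvg_ex; eexists; exact: ct.
  by near=> j; apply: J_mono; near: j; exact: nbhs_infty_ge.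
have c1 : (J j t - J i t) @[j --> \oo] --> jump_integral t - J i t.
  by apply: cvgB => //; exact: cvg_cst.
have c2 : (J j T - J i T) @[j --> \oo] --> jump_integral T - J i T.
  by apply: cvgB => //; exact: cvg_cst.
apply: ler_cvg_to c1 c2 _.
by near=> j; apply: JB_mono => //; near: j; exact: nbhs_infty_ge.
Unshelve. all: by end_near. Qed.

Lemma jump_integral_nondecreasing s t : 0 <= s -> s <= t -> t <= T ->
  jump_integral s <= jump_integral t.
Proof.
move=> s0 st tT.
apply: ler_cvg_to (jump_integral_cvg s0 (le_trans st tT)) (jump_integral_cvg (le_trans s0 st) tT) _.
apply: nearW => i; apply: (@jump_sum_nondecreasing _ _ cx i.+1%:R^-1) => //.
- exact: vanishing_mul_cut.
- by move=> y; rewrite mulr_ge0// cut_ge0.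
Qed.

(** A truncated sum is constant just after [t], and the tails are uniformly small on [[0, T]]. *)
Lemma jump_integral_right t : 0 <= t -> t < T ->
  jump_integral u @[u --> t^'+] --> jump_integral t.
Proof.
move=> t0 tT; apply/cvgrPdist_le => e e0.
have e20 : 0 < e / 2 by rewrite divr_gt0.
have [i hi] : exists i, jump_integral T - J i T <= e / 2.
  have := jump_integral_cvg T0 (lexx T) => /cvgrPdist_le /(_ _ e20)[N _ hN].
  by exists N; have := hN N (leqnn N); apply: le_trans; exact: ler_norm.
have [r r0 hr] := jump_sum_right cx (vanishing_mul_cut g i) t0.
near=> u.
have tu : t <= u by apply: ltW; near: u; exact: nbhs_right_gt.
have uT : u <= T by apply: ltW; near: u; exact: nbhs_right_lt.
have ur : u < t + r by near: u; apply: nbhs_right_lt; rewrite ltrDl.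
have E : J i u = J i t by apply: hr; rewrite tu ur.
have /andP[a1 b1] := jump_integral_tail i t0 (ltW tT).
have /andP[a2 b2] := jump_integral_tail i (le_trans t0 tu) uT.
have m := jump_integral_nondecreasing t0 tu uT.
by rewrite ler_norml; apply/andP; split; lra.
Unshelve. all: by end_near. Qed.

Lemma jump_integral_left t : 0 < t -> t < T -> cvg (jump_integral u @[u --> t^'-]).
Proof.
move=> t0 tT; apply/cvg_ex.
(* Clamping the time to [[0, T]] makes the function monotone on the whole line. *)
have h : nondecreasing_fun (fun u => jump_integral (Num.min T (Num.max 0 u))).
  move=> u v uv; apply: jump_integral_nondecreasing.
  - by rewrite le_min T0 le_max lexx.
  - by rewrite le_min !ge_min lexx/=; apply/orP; right; rewrite ge_max !le_max lexx uv !orbT.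
  - by rewrite ge_min lexx.
have /cvg_ex[l hl] : cvg ((fun u => jump_integral (Num.min T (Num.max 0 u))) u @[u --> t^'-]).
  apply: nondecreasing_at_left_is_cvgr; first by apply: nearW => a u v _ _; exact: h.
  apply: nearW => a; exists (jump_integral T) => _ [u _ <-].
  by apply: jump_integral_nondecreasing; rewrite ?ge_min ?le_min ?T0 ?le_max ?lexx.
exists l; apply: cvg_trans hl; apply: near_eq_cvg; near=> u.
rewrite max_r ?min_r//; first by apply: ltW; apply: (lt_trans _ tT); near: u; exact: nbhs_left_lt.
by apply: ltW; near: u; exact: nbhs_left_gt.
Unshelve. all: by end_near. Qed.

End jump_integral.

(** * Discretized paths in the Skorokhod space *)

Section oscillation.
Variables (R : realType) (x : R -> R).
Implicit Types u s t r d : R.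

Lemma right_oscillation u d : x v @[v --> u^'+] --> x u -> 0 < d ->
  exists2 r : R, 0 < r &
    forall s t, u <= s < u + r -> u <= t < u + r -> `|x t - x s| <= d.
Proof.
move=> h d0; have d20 : 0 < d / 2 by rewrite divr_gt0.
move: h => /cvgrPdist_le /(_ _ d20)[r /= r0 h].
have h' s : u <= s < u + r -> `|x s - x u| <= d / 2.
  move=> /andP[]; rewrite le_eqVlt => /predU1P[<- _|us sr].
    by rewrite subrr normr0 ltW.
  by rewrite distrC; apply: h => //=; rewrite distrC gtr0_norm ?subr_gt0// ltrBlDl.
exists r => // s t /h' hs /h' ht; rewrite (splitr d).
rewrite (_ : x t - x s = (x t - x u) - (x s - x u)); last by ring.
by apply: le_trans (ler_normB _ _) _; exact: lerD.
Qed.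

Lemma left_oscillation u d : cvg (x v @[v --> u^'-]) -> 0 < d ->
  exists2 r : R, 0 < r &
    forall s t, u - r < s < u -> u - r < t < u -> `|x t - x s| <= d.
Proof.
move=> h d0; have d20 : 0 < d / 2 by rewrite divr_gt0.
move: (h) => /cvgrPdist_le /(_ _ d20)[r /= r0 hr].
set l := lim _ in hr.
have h' s : u - r < s < u -> `|x s - l| <= d / 2.
  by move=> /andP[us su]; rewrite distrC; apply: hr => //=; rewrite gtr0_norm ?subr_gt0// ltrBlDl -ltrBlDr.
exists r => // s t /h' hs /h' ht; rewrite (splitr d).
rewrite (_ : x t - x s = (x t - l) - (x s - l)); last by ring.
by apply: le_trans (ler_normB _ _) _; exact: lerD.
Qed.

End oscillation.

Section increasing_bijection.
Variable R : realType.
Implicit Types (lam mu : R -> R) (s t u v w p q e : R).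

(** An increasing bijection of [[u, v]] onto [[lam u, lam v]]; asking for surjectivity instead of
    continuity makes gluing elementary. *)
Definition inc_bij lam u v :=
  (forall s t, u <= s -> s < t -> t <= v -> lam s < lam t) /\
  (forall s, lam u <= s -> s <= lam v -> exists2 t, u <= t <= v & lam t = s).

Lemma inc_bij_id lam u : inc_bij lam u u.
Proof.
split=> [s t us st tu|s us su].
  by have := lt_le_trans (le_lt_trans us st) tu; rewrite ltxx.
by exists u; rewrite ?lexx//; apply/eqP; rewrite eq_le us.
Qed.

Definition glue lam mu v t := if t <= v then lam t else mu t.

Lemma inc_bij_glue lam mu u v w : u <= v -> v <= w -> lam v = mu v ->
  inc_bij lam u v -> inc_bij mu v w -> inc_bij (glue lam mu v) u w.
Proof.
move=> uv vw lm [l1 l2] [m1 m2]; rewrite /glue; split=> [s t us st tw|s].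
  case: (leP t v) => tv; first by rewrite (le_trans (ltW st) tv) l1.
  case: (leP s v) => sv; last by apply: m1 => //; exact: ltW.
  have h : mu v < mu t by apply: m1.
  apply: le_lt_trans h; rewrite -lm; move: sv; rewrite le_eqVlt => /predU1P[->//|sv].
  by apply/ltW/l1.
rewrite uv => us; have -> : (if w <= v then lam w else mu w) = mu w.
  by case: leP => // wv; rewrite (_ : w = v) ?lm//; apply/eqP; rewrite eq_le wv.
move=> sw; have [sv|vs] := leP s (lam v).
  have [t /andP[ut tv] ts] := l2 s us sv.
  by exists t; rewrite ?ut ?(le_trans tv)// tv.
have [|//|t /andP[vt tw] ts] := m2 s; first by rewrite -lm ltW.
exists t; first by rewrite tw (le_trans uv).
by case: (leP t v) => // tv; rewrite -ts (_ : t = v) ?lm//; apply/eqP; rewrite eq_le tv.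
Qed.

Definition affine u v p q t := p + (t - u) * ((q - p) / (v - u)).

Lemma affine_left u v p q : affine u v p q u = p.
Proof. by rewrite /affine subrr mul0r addr0. Qed.

Lemma affine_right u v p q : u < v -> affine u v p q v = q.
Proof.
move=> uv; rewrite /affine mulrCA divff ?mulr1 ?subrKC//.
by rewrite gt_eqF// subr_gt0.
Qed.

Lemma inc_bij_affine u v p q : u < v -> p < q -> inc_bij (affine u v p q) u v.
Proof.
move=> uv pq; have k0 : 0 < (q - p) / (v - u) by rewrite divr_gt0 ?subr_gt0.
split=> [s t us st tv|s]; first by rewrite ltrD2l ltr_pM2r// ltrD2r.
rewrite affine_left affine_right// => ps sq.
exists (u + (s - p) / ((q - p) / (v - u))).
  rewrite lerDl divr_ge0 ?subr_ge0 ?(ltW k0)//= -lerBrDl ler_pdivrMr//.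
  by rewrite mulrCA divff ?mulr1 ?lerD2r// gt_eqF ?subr_gt0.
by rewrite /affine [u + _]addrC addrK mulfVK ?gt_eqF// subrKC.
Qed.

Lemma affine_dist u v p q e t : u < v -> `|p - u| <= e -> `|q - v| <= e ->
  u <= t <= v -> `|affine u v p q t - t| <= e.
Proof.
move=> uv pu qv /andP[ut tv].
set k := (t - u) / (v - u).
have vu0 : 0 < v - u by rewrite subr_gt0.
have k0 : 0 <= k by apply: divr_ge0; [rewrite subr_ge0|exact: ltW].
have k1 : 0 <= 1 - k by rewrite subr_ge0 ler_pdivrMr// mul1r lerD2r.
have -> : affine u v p q t - t = (1 - k) * (p - u) + k * (q - v).
  by rewrite /affine /k; field; rewrite gt_eqF.
apply: le_trans (ler_normD _ _) _; rewrite (normrM (1 - k)) (normrM k) (ger0_norm k0) (ger0_norm k1).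
have := ler_wpM2l k0 qv; have := ler_wpM2l k1 pu; lra.
Qed.

Lemma time_change_inc_bij lam (T : R) : 0 < T -> lam 0 = 0 -> lam T = T ->
  inc_bij lam 0 T -> time_change T lam.
Proof.
move=> T0 l0 lT [l1 l2]; split=> [s t /andP[s0 sT] /andP[t0 tT] st|].
  by apply: l1 => //; exact: ltW.
split.
- move=> t /andP[t0 tT] /=; apply/andP; split.
    by rewrite -l0; apply: l1 => //; exact: ltW.
  by rewrite -lT; apply: l1 => //; exact: ltW.
- move=> s t /set_mem/andP[s0 sT] /set_mem/andP[t0 tT] st.
  apply/eqP; apply: contra_eqT st; rewrite neq_lt => /orP[] h.
    by rewrite lt_eqF//; apply: l1; rewrite ?ltW.
  by rewrite gt_eqF//; apply: l1; rewrite ?ltW.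
- move=> s /andP[s0 sT] /=.
  have [||t /andP[t0 tT] ts] := l2 s; [by rewrite l0 ltW|by rewrite lT ltW|].
  exists t => //=; apply/andP; split; rewrite lt_neqAle.
    by rewrite t0 andbT; apply: contraTneq s0 => h; rewrite -ts -h l0 ltxx.
  by rewrite tT andbT; apply: contraTneq sT => h; rewrite -ts h lT ltxx.
Qed.

End increasing_bijection.

Section discretization.
Variables (R : realType).
Implicit Types (s t u v d : R) (n : nat).

Definition nceil n u : nat := `|Num.ceil (n%:R * u)|%N.

Lemma nceilP n u : 0 <= u -> n%:R * u <= (nceil n u)%:R < n%:R * u + 1.
Proof.
move=> u0; have c0 : 0 <= Num.ceil (n%:R * u).
  by rewrite ceil_ge0 (lt_le_trans (ltrN10 _))// mulr_ge0.
have E : (nceil n u)%:R = (Num.ceil (n%:R * u))%:~R :> R.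
  by rewrite /nceil natr_absz ger0_norm.
have /andP[h1 h2] := ceil_itv (n%:R * u).
by rewrite E h2; move: h1; rewrite rmorphB/= ltrBlDr.
Qed.

Let c n u : R := (nceil n u)%:R / n%:R.

Lemma nceil_div n u : (0 < n)%N -> 0 <= u -> u <= c n u < u + n%:R^-1.
Proof.
move=> n0 u0; have /andP[h1 h2] := nceilP n u0.
rewrite /c ler_pdivlMr ?ltr0n// ltr_pdivrMr ?ltr0n// mulrDl mulVf ?gt_eqF ?ltr0n//.
by rewrite !(mulrC u) h1.
Qed.

(* The time change sends a time [u] of the partition to the first grid point
   [nceil n u / n] at which the discretized path sees the value at [u]. *)
Lemma discretization_time_change (x : R -> R) u v d : 0 < u -> u <= v -> 0 < d ->
  (forall t, u <= t -> t <= v -> x s @[s --> t^'+] --> x t) ->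
  (forall t, u < t -> t <= v -> cvg (x s @[s --> t^'-])) ->
  exists N, forall n, (N <= n)%N -> exists lam,
    [/\ inc_bij lam u v, lam u = c n u, lam v = c n v,
        forall t, u <= t <= v -> `|lam t - t| <= n%:R^-1 &
        forall t, u <= t < v -> `|x ((Num.truncn (n%:R * lam t))%:R / n%:R) - x t| <= d].
Proof.
move=> u0 uv d0 xr xl.
pose Q a b := exists N, forall n, (N <= n)%N -> exists lam,
    [/\ inc_bij lam a b, lam a = c n a, lam b = c n b,
        forall t, a <= t <= b -> `|lam t - t| <= n%:R^-1 &
        forall t, a <= t < b -> `|x ((Num.truncn (n%:R * lam t))%:R / n%:R) - x t| <= d].
(* Where the path oscillates by at most [d], the affine map onto [[c n a, c n b]] works: the integer
   part of [n lam t] is then at least [nceil n a] and less than [nceil n b], so the grid point read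
   by the discretized path lies in [[a, b)]. *)
have seg a b : u <= a -> a < b ->
    (forall s t, a <= s < b -> a <= t < b -> `|x t - x s| <= d) -> Q a b.
  move=> ua ab osc; have ba0 : 0 < b - a by rewrite subr_gt0.
  have a0 : 0 <= a by rewrite (le_trans (ltW u0)).
  have b0 : 0 <= b by rewrite (le_trans a0)// ltW.
  have [N hN] := inv_nat_lt ba0; exists N => n /hN[n0 nba].
  have /andP[a1 a2] := nceil_div n0 a0; have /andP[b1 b2] := nceil_div n0 b0.
  have cab : c n a < c n b by lra.
  have ni : 0 < n%:R^-1 :> R by rewrite invr_gt0 ltr0n.
  exists (affine a b (c n a) (c n b)); split.
  - exact: inc_bij_affine.
  - exact: affine_left.
  - exact: affine_right.
  - by move=> t tab; apply: affine_dist => //; rewrite ger0_norm; lra.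
  - move=> t /andP[at_ tb].
    have [m1 _] := inc_bij_affine ab cab.
    set l := affine _ _ _ _ _.
    have cl : c n a <= l.
      rewrite /l -{1}(affine_left a b (c n a) (c n b)).
      by move: at_; rewrite le_eqVlt => /predU1P[->//|at_]; apply/ltW/m1 => //; exact: ltW.
    have lc : l < c n b.
      by rewrite -[X in _ < X](affine_right (c n a) (c n b) ab); apply: m1.
    have l0 : 0 <= n%:R * l by rewrite mulr_ge0// (le_trans _ cl)// divr_ge0.
    have /andP[t1 t2] := truncn_itv l0.
    apply: osc; first by rewrite at_.
    have na : (nceil n a <= Num.truncn (n%:R * l))%N.
      rewrite truncn_ge_nat//; move: cl; rewrite /c ler_pdivrMr ?ltr0n//.
      by rewrite mulrC.
    have nb : (Num.truncn (n%:R * l) < nceil n b)%N.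
      rewrite truncn_lt_nat//; move: lc; rewrite /c ltr_pdivlMr ?ltr0n//.
      by rewrite mulrC.
    apply/andP; split.
      by apply: le_trans a1 _; rewrite /c ler_wpM2r ?invr_ge0// ler_nat.
    rewrite ltr_pdivrMr ?ltr0n//; have /andP[_ b3] := nceilP n b0.
    have : (Num.truncn (n%:R * l)).+1%:R <= (nceil n b)%:R :> R by rewrite ler_nat.
    by rewrite -natr1 mulrC; lra.
suff : Q u v by [].
apply: (@cousin R) => //.
- move=> a b e ua ab be ev [N1 h1] [N2 h2]; exists (maxn N1 N2) => n.
  rewrite geq_max => /andP[/h1[l [l1 l2 l3 l4 l5]] /h2[m [m1 m2 m3 m4 m5]]].
  exists (glue l m b); split.
  - by apply: inc_bij_glue => //; rewrite l3 m2.
  - by rewrite /glue ab.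
  - rewrite /glue; case: leP => // eb; rewrite (_ : e = b) ?l3//.
    by apply/eqP; rewrite eq_le eb.
  - move=> t /andP[at_ te]; rewrite /glue; case: (leP t b) => tb; first by rewrite l4// at_.
    by rewrite m4// te ltW.
  - move=> t /andP[at_ te]; rewrite /glue; case: (ltgtP t b) => [tb|bt|tb].
    + by rewrite l5// at_.
    + by rewrite m5// te ltW.
    + by rewrite tb l3 -m2 m5// lexx -tb.
- move=> a /andP[ua av]; have [r r0 h] := right_oscillation (xr a ua av) d0.
  exists r => // b /andP[]; rewrite le_eqVlt => /predU1P[<- _|ab br].
    exists 1%N => n n0; exists (fun=> c n a); split => //.
    - exact: inc_bij_id.
    - move=> t /andP[at_ ta]; have -> : t = a by apply/eqP; rewrite eq_le ta.
      have /andP[a1 a2] := nceil_div n0 (le_trans (ltW u0) ua).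
      by rewrite ger0_norm; lra.
    - by move=> t /andP[at_ ta]; have := le_lt_trans at_ ta; rewrite ltxx.
  apply: seg => // s t /andP[s1 s2] /andP[t1 t2]; apply: h; rewrite ?s1 ?t1/=.
    exact: lt_trans br.
  exact: lt_trans br.
- move=> a /andP[ua av]; have [r r0 h] := left_oscillation (xl a ua av) d0.
  exists r => // b /andP[ab ba] ub.
  apply: seg => // s t /andP[s1 s2] /andP[t1 t2]; apply: h; rewrite ?s2 ?t2 ?andbT.
    exact: lt_le_trans s1.
  exact: lt_le_trans t1.
Qed.

End discretization.

(** * Neighbourhoods in the Skorokhod space and discretized paths *)

Section skorokhod_space.
Variables (R : realType) (T : R).
Hypothesis T0 : 0 < T.
Implicit Types (x y z : skorokhod T) (e : R).

Lemma cadlag_on_restrict (x : R -> R) : cadlag_on [set t | 0 < t < T] x ->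
  cadlag_on [set t | 0 < t < T] (fun t => if 0 < t < T then x t else 0).
Proof.
move=> h t /= /andP[t0 tT]; have [h1 h2] := h t ltac:(by rewrite /= t0).
rewrite t0 tT /=; split.
  apply: cvg_trans h1; apply: near_eq_cvg; near=> u.
  rewrite (lt_trans t0)/=; last by near: u; exact: nbhs_right_gt.
  by rewrite (_ : u < T = true)//; near: u; exact: nbhs_right_lt.
have /cvg_ex[l hl] := h2; apply/cvg_ex; exists l.
apply: cvg_trans hl; apply: near_eq_cvg; near=> u.
rewrite (_ : 0 < u = true)/=; last by near: u; exact: nbhs_left_gt.
rewrite (_ : u < T = true)//; apply: lt_trans tT.
by near: u; exact: nbhs_left_lt.
Unshelve. all: by end_near. Qed.

Lemma restrict_out (x : R -> R) t : ~~ (0 < t < T) ->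
  (if 0 < t < T then x t else 0) = 0.
Proof. by move=> /negbTE ->. Qed.

Definition skor_of (x : R -> R) (cx : cadlag_on [set t | 0 < t < T] x) : skorokhod T :=
  Skorokhod (cadlag_on_restrict cx) (@restrict_out x).

Lemma cadlag_step (g : nat -> R) n :
  cadlag_on [set t : R | 0 < t] (fun t => g (Num.truncn (n%:R * t))).
Proof.
move=> t /= t0; case: n => [|n].
  under eq_fun do rewrite mul0r truncn0.
  by rewrite mul0r truncn0; split; [exact: cvg_cst|exact: is_cvg_cst].
have n0 : 0 < n.+1%:R :> R by [].
have nt0 : 0 < n.+1%:R * t by rewrite mulr_gt0.
split.
  have /andP[k1 k2] := truncn_itv (ltW nt0).
  apply: cvg_near_cst; near=> u; congr g.
  have tu : t < u by near: u; exact: nbhs_right_gt.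
  apply: truncn_def.
  rewrite (le_trans k1) ?ler_pM2l 1?ltW//=.
  rewrite mulrC -ltr_pdivlMr//; near: u; apply: nbhs_right_lt.
  by rewrite ltr_pdivlMr// mulrC.
(* The left limit is the value on the last step before [t]; its index is a ceiling minus 1, whether
   or not [t] is a grid point. *)
apply/cvg_ex; exists (g (nceil n.+1 t).-1).
have /andP[k1 k2] := nceilP n.+1 (ltW t0).
have c0 : (0 < nceil n.+1 t)%N by rewrite -(ltr_nat R) (lt_le_trans nt0).
apply: cvg_near_cst; near=> u; congr g.
have ut : u < t by near: u; exact: nbhs_left_lt.
apply: truncn_def; apply/andP; split; last first.
  by rewrite prednK// (lt_le_trans _ k1)// ltr_pM2l.
rewrite mulrC -ler_pdivrMr//; apply: ltW; near: u; apply: nbhs_left_gt.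
rewrite ltr_pdivrMr// mulrC -(ltrD2r 1) natr1 prednK//.
Unshelve. all: by end_near. Qed.

Lemma cadlag_step_on (g : nat -> R) n :
  cadlag_on [set t : R | 0 < t < T] (fun t => g (Num.truncn (n%:R * t))).
Proof. by move=> t /andP[t0 _]; exact: cadlag_step. Qed.

Definition step_skor (g : nat -> R) n : skorokhod T := skor_of (cadlag_step_on g n).

(** One parameter serves for the distance to the ends of [(0, T)] and for the tolerance. These sets
    form a base of neighbourhoods and satisfy approximate forms of symmetry and of the triangle
    inequality, so they can be used like balls. *)
Definition unif_near e x y := skor_near T e (T - e) e x y.

Lemma skor_near_mono (a b a' b' e e' : R) (x y : R -> R) :
  a' <= a -> b <= b' -> e' <= e -> skor_near T a' b' e' x y -> skor_near T a b e x y.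
Proof.
move=> aa bb ee [lam tl h]; exists lam => // t /andP[at_ tb].
have [|h1 h2] := h t; first by rewrite (le_trans aa)// (le_trans tb).
by rewrite !(lt_le_trans _ ee).
Qed.

Lemma unif_near_mono e e' x y : e' <= e -> unif_near e' x y -> unif_near e x y.
Proof. by move=> ee; apply: skor_near_mono; rewrite // lerD2l lerN2. Qed.

Lemma nbhs_unif_near x A : nbhs x A <-> exists2 e, 0 < e & forall y, unif_near e x y -> A y.
Proof.
split=> [[a [b [e [a0 bT e0 h]]]]|[e e0 h]].
  exists (Num.min a (Num.min (T - b) e)); first by rewrite !lt_min a0 subr_gt0 bT.
  move=> y xy; apply: h; apply: skor_near_mono xy; first by rewrite ge_min lexx.
    by rewrite lerBrDr -lerBrDl !ge_min lexx orbT.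
  by rewrite !ge_min lexx !orbT.
by exists e, (T - e), e; split => //; rewrite gtrBl.
Qed.

(** The intervals shrink along with the accuracy: [lam] moves a time of [[2 e, T - 2 e]] by less
    than [e], hence into [[e, T - e]], where [mu] is controlled. *)
Lemma unif_near_trans e x y z : 0 < e ->
  unif_near e x y -> unif_near e y z -> unif_near (e + e) x z.
Proof.
move=> e0 [lam tl h] [mu tm k]; exists (mu \o lam); first exact: time_change_comp.
move=> t /andP[t1 t2]; have [|h1 h2] := h t; first by apply/andP; split; lra.
have [|k1 k2] := k (lam t).
  by move: h1; rewrite ltr_norml => /andP[]; lra.
split=> /=; [rewrite -(subrK (lam t) (mu _)) -addrA|rewrite -(subrK (y (lam t)) (z _)) -addrA];
  by rewrite (le_lt_trans (ler_normD _ _))// ltrD.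
Qed.

(** The time change is inverted. Since [lam] moves [e] and [T - e] by less than [e], its inverse
    maps [[2 e, T - 2 e]] into [[e, T - e]]. *)
Lemma unif_near_sym e x y : 0 < e -> unif_near e x y -> unif_near (e + e) y x.
Proof.
move=> e0 [lam [lm lb] h].
have [eT|Te] := leP (e + e) (T - (e + e)); last first.
  exists id; first exact: time_change_id.
  by move=> t /andP[t1 t2]; have := lt_le_trans (lt_le_trans Te t1) t2; rewrite ltxx.
have eI : 0 < e < T by apply/andP; split; lra.
have eI' : 0 < T - e < T by apply/andP; split; lra.
have [le _] := h e ltac:(by apply/andP; split; lra).
have [lE _] := h (T - e) ltac:(by apply/andP; split; lra).
have lamI := set_bij_homo lb; have lami := set_bij_inj lb.
have /choice[mu hmu] : forall s, exists t, 0 < s < T -> 0 < t < T /\ lam t = s.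
  move=> s; have [sI|sI] := boolP (0 < s < T); last by exists 0.
  by have [t tI <-] := set_bij_surj lb sI; exists t.
have mono s t : 0 < s < T -> 0 < t < T -> lam s < lam t -> s < t.
  move=> sI tI; rewrite !ltNge; apply: contra; rewrite le_eqVlt => /predU1P[->//|ts].
  exact/ltW/lm.
exists mu.
  split=> [s t sI tI st|].
    by have [s1 s2] := hmu s sI; have [t1 t2] := hmu t tI; apply: mono => //; rewrite s2 t2.
  split.
  - by move=> s sI; have [] := hmu s sI.
  - by move=> s t /set_mem sI /set_mem tI st; have [_ <-] := hmu s sI; have [_ <-] := hmu t tI; rewrite st.
  - move=> s sI; exists (lam s); first exact: lamI.
    have [m1 m2] := hmu (lam s) (lamI s sI); apply: lami => //; exact: mem_set.
move=> s /andP[s1 s2].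
have sI : 0 < s < T by apply/andP; split; lra.
have [mI ms] := hmu s sI.
have e1 : e < mu s by apply: mono => //; move: le; rewrite ms ltr_norml => /andP[]; lra.
have e2 : mu s < T - e by apply: mono => //; move: lE; rewrite ms ltr_norml => /andP[]; lra.
have [|h1 h2] := h (mu s); first by rewrite !ltW.
by rewrite ms in h1 h2; rewrite distrC (distrC (x _)); split; lra.
Qed.

(** The time change of [discretization_time_change], built on [[e, b]], is extended affinely to the
    ends of [(0, T)]. The hypothesis on [z] starts at [1 / n] because for smaller [t] the grid point
    is 0, where [y] has only its default value. *)
Lemma discretization_near y e : 0 < e -> exists N, forall n, (N <= n)%N ->
  forall z, (forall t : R, 0 < t < T -> n%:R^-1 <= t ->
    `|z t - y ((Num.truncn (n%:R * t))%:R / n%:R)| <= e / 2) -> unif_near e y z.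
Proof.
move=> e0.
have [eT|Te] := leP e (T - e); last first.
  exists 0%N => n _ z _; exists id; first exact: time_change_id.
  by move=> t /andP[t1 t2]; have := lt_le_trans (lt_le_trans Te t1) t2; rewrite ltxx.
(* With [b] strictly between [T - e] and [T], the times up to [T - e] are covered, and for
   [1 / n < e / 4] the image of [b], less than [b + 1 / n], is still below [T]. *)
pose b := T - e / 2.
have eb : e < b by rewrite /b; lra.
have bT : b < T by rewrite /b; lra.
have e40 : 0 < e / 4 by rewrite divr_gt0.
have cy t : e <= t -> t <= b -> (y s @[s --> t^'+] --> y t) /\ cvg (y s @[s --> t^'-]).
  move=> et tb; apply: skor_cadlag => /=.
  by rewrite (lt_le_trans e0 et) (le_lt_trans tb bT).
have [N1 h] := @discretization_time_change R y e b (e / 4) e0 (ltW eb) e40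
  (fun t et tb => (cy t et tb).1) (fun t et tb => (cy t (ltW et) tb).2).
have [N2 hN2] := inv_nat_lt e40.
exists (maxn N1 N2) => n; rewrite geq_max => /andP[/h[l [l1 l2 l3 l4 l5]] /hN2[n0 ne]] z hz.
have /andP[c1 c2] := nceil_div n0 (ltW e0).
have /andP[c3 c4] := nceil_div n0 (ltW (lt_trans e0 eb)).
set ce := _ / _ in l2 c1 c2; set cb := _ / _ in l3 c3 c4.
have cb' : cb < T by rewrite /b in c4 *; lra.
pose L := glue (affine 0 e 0 ce) (glue l (affine b T cb T) b) e.
have Le t : e <= t <= b -> L t = l t.
  move=> /andP[et tb]; rewrite /L /glue tb; case: leP => // te.
  by rewrite (_ : t = e) ?affine_right ?l2//; apply/eqP; rewrite eq_le te.
exists L.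
  apply: time_change_inc_bij => //.
  - by rewrite /L /glue (ltW e0) affine_left.
  - rewrite /L /glue leNgt (lt_trans eb bT)/= leNgt bT/=.
    by rewrite affine_right.
  - apply: inc_bij_glue; [exact: ltW|by rewrite ltW// (lt_trans eb)| | |].
    + by rewrite affine_right// /glue (ltW eb) l2.
    + by apply: inc_bij_affine => //; exact: lt_le_trans c1.
    + apply: inc_bij_glue; [exact: ltW|exact: ltW| |exact: l1|].
        by rewrite affine_left l3.
      by apply: inc_bij_affine.
move=> t /andP[t1 t2].
have tb : t < b by rewrite /b; lra.
rewrite Le ?t1 ?(ltW tb)//.
have h4 := l4 t ltac:(by rewrite t1 ltW); have h5 := l5 t ltac:(by rewrite t1).
split; first by apply: le_lt_trans h4 _; lra.
move: (h4); rewrite ler_norml => /andP[k3 k4].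
have := hz (l t) ltac:(apply/andP; split; lra) ltac:(lra).
move=> h6; rewrite -(subrK (y ((Num.truncn (n%:R * l t))%:R / n%:R)) (z _)) -addrA.
by apply: le_lt_trans (ler_normD _ _) _; lra.
Qed.

Lemma skorokhod_ext x y : (forall t, 0 < t < T -> x t = y t) -> x = y.
Proof.
move=> h; have {}h : skor_fun x = skor_fun y.
  apply/funext => t; have [tI|tI] := boolP (0 < t < T); first exact: h.
  by rewrite !skor_out.
case: x y h => [x xc xo] [y yc yo] /= h; subst y.
by congr Skorokhod; exact: Prop_irrelevance.
Qed.

Lemma step_skorE (g : nat -> R) n t : 0 < t < T ->
  step_skor g n t = g (Num.truncn (n%:R * t)).
Proof. by rewrite /step_skor /= => ->. Qed.

End skorokhod_space.

(** * Measurability of random paths *)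

Section skorokhod_measurability.
Context (R : realType) (T : R) (T0 : 0 < T).
Context d (Omega : measurableType d).
Implicit Types Y : Omega -> skorokhod T.

(** [Y w] lies in an open [U] iff, for some [m], eventually [Yn n w] lies in [G m], the set of paths
    whose [1 / (m + 1)]-neighbourhood is inside [U]. The sets [G m] need not be Borel, so the
    preimages under [Yn n] are required to be measurable for arbitrary sets. *)
Lemma measurable_skorokhod_limit Y (Yn : nat -> Omega -> skorokhod T) :
  (forall n A, measurable (Yn n @^-1` A)) ->
  (forall w e, 0 < e -> exists N, forall n, (N <= n)%N -> unif_near e (Y w) (Yn n w)) ->
  measurable_fun setT (Y : Omega -> g_sigma_algebraType (@open (skorokhod T))).
Proof.
move=> mY cY; apply: (@measurability _ _ Omega (g_sigma_algebraType (@open (skorokhod T))) setT Y (@open (skorokhod T))) => //.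
move=> _ [U oU <-]; rewrite setTI.
pose G m := [set y : skorokhod T | forall z, unif_near m.+1%:R^-1 y z -> U z].
rewrite (_ : _ @^-1` U = \bigcup_m \bigcup_k \bigcap_(n in [set n | (k <= n)%N]) (Yn n @^-1` (G m))).
  apply: bigcupT_measurable => m; apply: bigcupT_measurable => k.
  by apply: bigcap_measurable => //; exists k => /=.
apply/seteqP; split => w /=.
- move=> Uw; have /nbhs_unif_near[e e0 he] : nbhs (Y w) U by exact: open_nbhs_nbhs.
  have e20 : 0 < e / 2 by rewrite divr_gt0.
  have [m hm] := inv_nat_lt e20; have [_ me] := hm m.+1 (leqnSn m).
  have [N hN] := cY w _ e20; exists m => //; exists N => // n Nn z yz.
  apply: he; rewrite (splitr e); apply: unif_near_trans (hN n Nn) _ => //.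
  by apply: unif_near_mono yz; exact: ltW.
- move=> [m _ [k _ h]].
  have e0 : 0 < m.+1%:R^-1 / 2 :> R by rewrite divr_gt0.
  have [N hN] := cY w _ e0.
  have kn : [set n | (k <= n)%N] (maxn k N) by rewrite /= leq_maxl.
  apply: (h _ kn); rewrite (splitr m.+1%:R^-1); apply: unif_near_sym => //.
  by apply: hN; rewrite leq_maxr.
Qed.

(** Discretizing time and rounding the values to multiples of [1 / n] gives random paths with
    countably many values, for which every preimage is measurable; they tend to [Y] by
    [discretization_near]. *)
Lemma measurable_skorokhod Y :
  (forall t, 0 < t < T -> measurable_fun setT (fun w => Y w t)) ->
  measurable_fun setT (Y : Omega -> g_sigma_algebraType (@open (skorokhod T))).
Proof.
move=> mY.
pose r n w k : int := Num.floor (n%:R * Y w (k%:R / n%:R)).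
apply: (@measurable_skorokhod_limit Y
  (fun n w => step_skor T (fun k => (r n w k)%:~R / n%:R) n)).
- move=> n A; pose K := (Num.truncn (n%:R * T)).+1.
  pose S (v : {ffun 'I_K -> int}) : skorokhod T :=
    step_skor T (fun k => (v (inord k))%:~R / n%:R) n.
  rewrite (_ : _ @^-1` A = \bigcup_(v in [set v | A (S v)])
      \bigcap_(k in [set k | (k < K)%N]) [set w | r n w k = v (inord k)]).
    rewrite bigcup_mkcond; apply: countable_bigcupT_measurable => [|v].
      exact: countableP.
    case: ifPn => [_|_]; last exact: measurable0.
    apply: bigcap_measurableType => k _.
    have mk : measurable_fun setT (fun w => n%:R * Y w (k%:R / n%:R)).
      apply: measurable_funM; first exact: measurable_cst.
      move: (k%:R / n%:R) => t.
      have [tI|tI] := boolP (0 < t < T); first exact: mY.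
      by under eq_fun do rewrite skor_out//; exact: measurable_cst.
    rewrite (_ : mkset _ = (fun w => n%:R * Y w (k%:R / n%:R)) @^-1`
       `[(v (inord k))%:~R, (v (inord k) + 1)%:~R[).
      by rewrite -[X in measurable X]setTI; exact: mk.
    apply/seteqP; split => w /=; rewrite in_itv/=.
      by move=> <-; exact: floor_itv.
    by move=> h; apply: floor_def.
  have E w (v : {ffun 'I_K -> int}) : (forall k, (k < K)%N -> r n w k = v (inord k)) ->
      step_skor T (fun k => (r n w k)%:~R / n%:R) n = S v.
    move=> h; apply: skorokhod_ext => t tI; rewrite !step_skorE// h//.
    rewrite ltnS le_truncn// ler_wpM2l//.
    by move: tI => /andP[_ /ltW].
  apply/seteqP; split => w /=.
    move=> Aw; pose v := [ffun k : 'I_K => r n w k].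
    have hv k : (k < K)%N -> r n w k = v (inord k) by move=> kK; rewrite ffunE inordK.
    by exists v => //=; rewrite -(E w v hv).
  by move=> [v Av h]; rewrite (E w v).
- move=> w e e0; have [N1 h1] := discretization_near T0 (Y w) e0.
  have e20 : 0 < e / 2 by rewrite divr_gt0.
  have [N2 h2] := inv_nat_lt e20.
  exists (maxn N1 N2) => n; rewrite geq_max => /andP[/h1 h /h2[n0 ne]].
  apply: h => t tI _; rewrite step_skorE//; set k := Num.truncn _.
  have /andP[f1 f2] := floor_itv (n%:R * Y w (k%:R / n%:R)).
  apply: le_trans (ltW ne); rewrite /r; set y := Y w _ in f1 f2 *.
  have n0' : 0 < n%:R :> R by rewrite ltr0n.
  set m := Num.floor _ in f1 f2 *.
  have -> : m%:~R / n%:R - y = (m%:~R - n%:R * y) / n%:R.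
    by field; rewrite gt_eqF.
  rewrite normrM (gtr0_norm (x := n%:R^-1)) ?invr_gt0// ler_piMl ?invr_ge0//.
  by move: f2; rewrite rmorphD/= => f2; rewrite ler_norml; apply/andP; split; lra.
Qed.

End skorokhod_measurability.

(** * Integration *)

Section integral_without_measurability.
Local Open Scope ereal_scope.
Import HBNNSimple.
Context d (T : measurableType d) (R : realType) (mu : {measure set T -> \bar R}).

(* The integral of a nonmeasurable nonnegative function is still defined, as a
   supremum over the simple functions below it. *)
Lemma le_integral_nonmeasurable (g f : T -> \bar R) :
  (forall x, 0 <= g x) -> (forall x, g x <= f x) ->
  \int[mu]_x g x <= \int[mu]_x f x.
Proof.
move=> g0 gf; rewrite !ge0_integralE//; last by move=> x _; exact: le_trans (gf x).
rewrite !patch_setT; apply: le_ereal_sup => _ [h hg <-]; exists h => //= x.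
exact: le_trans (hg x) (gf x).
Qed.

(** A simple function below [f] keeps its integral when it is set to 0 off [G]. Cutting the simple
    functions rather than [f] covers nonmeasurable integrands, so the integrals over jumps can be
    evaluated on [G] alone. *)
Lemma integral_conegligible (G : set T) (f : T -> \bar R) : measurable G ->
  mu (~` G) = 0 -> (forall x, 0 <= f x) -> \int[mu]_x f x = \int[mu]_(x in G) f x.
Proof.
move=> mG G0 f0; apply/eqP; rewrite eq_le; apply/andP; split; last first.
  rewrite integral_mkcond; apply: le_integral_nonmeasurable => x; rewrite patchE.
    by case: ifPn.
  by case: ifPn => // _; exact: f0.
rewrite [leLHS]ge0_integralE//; apply: ge_ereal_sup => _ [h hf <-].
rewrite patch_setT in hf.
rewrite -integralT_nnsfun [leRHS]integral_mkcond.
rewrite (@ge0_negligible_integral _ _ _ _ _ (~` G))//; last 3 first.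
- exact: measurableC.
- by apply/measurable_EFinP; exact: measurable_funPT.
- by move=> x _; rewrite lee_fin.
rewrite setTD setCK integral_mkcond.
apply: le_integral_nonmeasurable => x; rewrite !patchE; case: ifPn => // _.
by rewrite lee_fin.
Qed.

End integral_without_measurability.

Section bounded_random_variables.
Context d (Omega : measurableType d) (R : realType) (P : probability Omega R).
Implicit Types f g : Omega -> R.

Definition bdd (u : R -> R) := exists M : R, forall y : R, `|u y| <= M.

Definition brv f := measurable_fun setT f /\ exists M, forall w, `|f w| <= M.

Definition Ex f : R := \int[P]_w f w.

Lemma brv_integrable f : brv f -> P.-integrable setT (EFin \o f).
Proof.
move=> [mf [M fM]]; apply: measurable_bounded_integrable => //.
  by rewrite -ge0_fin_numE//; exact: fin_num_measure.
by exists M; split => [|N MN w _ /=]; [exact: num_real|rewrite (le_trans (fM w))// ltW].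
Qed.

Lemma brv_cst r : brv (cst r).
Proof. by split; [exact: measurable_cst|exists `|r|]. Qed.

Lemma brvD f g : brv f -> brv g -> brv (fun w => f w + g w).
Proof.
move=> [mf [M fM]] [mg [N gN]]; split; first exact: measurable_funD.
by exists (M + N) => w; rewrite (le_trans (ler_normD _ _))// lerD.
Qed.

Lemma brvM f g : brv f -> brv g -> brv (fun w => f w * g w).
Proof.
move=> [mf [M fM]] [mg [N gN]]; split; first exact: measurable_funM.
by exists (M * N) => w; rewrite normrM ler_pM.
Qed.

Lemma brvZ r f : brv f -> brv (fun w => r * f w).
Proof. by move=> bf; apply: brvM => //; exact: brv_cst. Qed.

Lemma brvB f g : brv f -> brv g -> brv (fun w => f w - g w).
Proof.
move=> bf bg; have := brvD bf (brvZ (-1) bg).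
by congr brv; apply/funext => w; rewrite mulN1r.
Qed.

Lemma brvX f : brv f -> brv (fun w => f w ^+ 2).
Proof. by move=> bf; have := brvM bf bf; congr brv; apply/funext => w; rewrite expr2. Qed.

Lemma brv_sum (Z : nat -> Omega -> R) m : (forall j, brv (Z j)) ->
  brv (fun w => \sum_(j < m) Z j w).
Proof.
move=> bZ; elim: m => [|m IH].
  by have := brv_cst 0; congr brv; apply/funext => w; rewrite big_ord0.
by have := brvD IH (bZ m); congr brv; apply/funext => w; rewrite big_ord_recr.
Qed.

Lemma brv_comp (u : R -> R) f : measurable_fun setT u -> bdd u ->
  measurable_fun setT f -> brv (u \o f).
Proof. by move=> mu [M uM] mf; split; [exact: measurableT_comp|exists M => w; exact: uM]. Qed.

Lemma measurable_ord_sum (Z : nat -> Omega -> R) m (D : set Omega) :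
  (forall j, measurable_fun D (Z j)) -> measurable_fun D (fun w => \sum_(j < m) Z j w).
Proof.
move=> mZ; elim: m => [|m IH].
  by under eq_fun do rewrite big_ord0; exact: measurable_cst.
by under eq_fun do rewrite big_ord_recr; exact: measurable_funD.
Qed.

Lemma Ex_cst r : Ex (cst r) = r.
Proof.
transitivity (r * fine (P setT)); first by rewrite /Ex Rintegral_cst.
by rewrite probability_setT mulr1.
Qed.

Lemma ExD f g : brv f -> brv g -> Ex (fun w => f w + g w) = Ex f + Ex g.
Proof. by move=> bf bg; rewrite /Ex RintegralD//; exact: brv_integrable. Qed.

Lemma ExZ r f : brv f -> Ex (fun w => r * f w) = r * Ex f.
Proof. by move=> bf; rewrite /Ex RintegralZl//; exact: brv_integrable. Qed.

Lemma ExB f g : brv f -> brv g -> Ex (fun w => f w - g w) = Ex f - Ex g.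
Proof. by move=> bf bg; rewrite /Ex RintegralB//; exact: brv_integrable. Qed.

Lemma Ex_sum (Z : nat -> Omega -> R) m : (forall j, brv (Z j)) ->
  Ex (fun w => \sum_(j < m) Z j w) = \sum_(j < m) Ex (Z j).
Proof.
move=> bZ; elim: m => [|m IH].
  rewrite big_ord0 -[RHS]Ex_cst; congr Ex; apply/funext => w.
  by rewrite big_ord0.
rewrite big_ord_recr/= -IH -ExD//; last exact: brv_sum.
by congr Ex; apply/funext => w; rewrite big_ord_recr.
Qed.

Lemma Ex_le f g : brv f -> brv g -> (forall w, f w <= g w) -> Ex f <= Ex g.
Proof. by move=> bf bg fg; apply: le_Rintegral => //; exact: brv_integrable. Qed.

Lemma Ex_ge0 f : (forall w, 0 <= f w) -> 0 <= Ex f.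
Proof. by move=> f0; apply: Rintegral_ge0. Qed.

Lemma ExE f : brv f -> (\int[P]_w (f w)%:E)%E = (Ex f)%:E.
Proof.
move=> /brv_integrable bf.
by rewrite /Ex /Rintegral fineK//; exact: integrable_fin_num.
Qed.

Lemma Ex_le_norm f g : brv f -> brv g -> (forall w, `|f w| <= g w) -> `|Ex f| <= Ex g.
Proof.
move=> bf bg fg; rewrite ler_norml -[X in - X]mul1r -mulNr -ExZ//.
apply/andP; split; apply: Ex_le => //; [exact: brvZ| |].
  by move=> w; rewrite mulN1r; have := fg w; rewrite ler_norml => /andP[].
by move=> w; exact: le_trans (ler_norm _) (fg w).
Qed.

Lemma Ex_cvg (f_ : nat -> Omega -> R) f M : (forall n, measurable_fun setT (f_ n)) ->
  measurable_fun setT f -> (forall n w, `|f_ n w| <= M) ->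
  {ae P, forall w, f_ n w @[n --> \oo] --> f w} -> Ex (f_ n) @[n --> \oo] --> Ex f.
Proof.
move=> mf_ mf bf cf.
have := @dominated_convergence _ _ _ P setT measurableT (fun n => EFin \o f_ n)
  (EFin \o f) (EFin \o cst M).
case.
- by move=> n; exact/measurable_EFinP.
- exact/measurable_EFinP.
- by apply: filterS cf => w h _; apply: cvg_EFin => //; exact: nearW.
- exact/brv_integrable/brv_cst.
- by apply: aeW => w n _ /=; rewrite lee_fin.
move=> /integrable_fin_num fi _ /=.
by rewrite /Ex /Rintegral -[X in _ --> X -> _](fineK (fi measurableT)) => /fine_cvgP[].
Qed.

Lemma chebyshev_brv f a : brv f -> 0 < a ->
  (P [set w | (a <= `|f w|)%R] <= (Ex (fun w => f w ^+ 2) / a ^+ 2)%:E)%E.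
Proof.
move=> bf a0; have a20 : 0 < a ^+ 2 by rewrite exprn_gt0.
have mf2 : measurable_fun setT (fun w => (f w ^+ 2)%:E).
  by apply/measurable_EFinP; case: (brvX bf).
rewrite EFinM lee_pdivlMr// muleC -(ExE (brvX bf)).
have := @le_integral_abse _ _ _ P setT measurableT _ (a ^+ 2) mf2 a20.
rewrite setTI => h; apply: le_trans (le_trans h _).
  rewrite lee_pmul2l// le_measure ?inE//.
  - rewrite -[X in measurable X]setTI; apply: measurable_fun_ler => //.
    by apply: measurableT_comp; [exact: normr_measurable|case: bf].
  - rewrite -[X in measurable X]setTI; apply: emeasurable_fun_c_infty => //.
    exact: measurableT_comp.
  - move=> w /= aw; rewrite lee_fin ger0_norm ?sqr_ge0// -[f w ^+ 2]real_normK ?num_real//.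
    by rewrite lerXn2r ?nnegrE// ltW.
by under eq_integral do rewrite /= ger0_norm ?sqr_ge0//.
Qed.

(** The centred variables are pairwise orthogonal, so their second moments add up, and each variance
    is at most [s]. *)
Lemma Ex_sqr_sum (Z : nat -> Omega -> R) m e s : (forall j, brv (Z j)) ->
  (forall j, (j < m)%N -> Ex (Z j) = e) ->
  (forall j, (j < m)%N -> Ex (fun w => Z j w ^+ 2) = s) ->
  (forall i j, (i < j < m)%N -> Ex (fun w => Z i w * Z j w) = e * e) ->
  Ex (fun w => (\sum_(j < m) Z j w - m%:R * e) ^+ 2) <= m%:R * s.
Proof.
move=> bZ Ze Zs Zee.
pose Y j w := Z j w - e.
have bY j : brv (Y j) by apply: brvB => //; exact: brv_cst.
have Y0 j : (j < m)%N -> Ex (Y j) = 0.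
  by move=> jm; rewrite ExB ?Ex_cst ?Ze ?subrr//; exact: brv_cst.
have YY i j : (i < j < m)%N -> Ex (fun w => Y i w * Y j w) = 0.
  move=> /andP[ij jm]; have im := ltn_trans ij jm.
  have -> : (fun w => Y i w * Y j w) =
      (fun w => (Z i w * Z j w - e * (Z i w + Z j w)) + cst (e * e) w).
    by apply/funext => w; rewrite /Y /cst; ring.
  have b1 : brv (fun w => Z i w * Z j w) by exact: brvM.
  have b2 : brv (fun w => Z i w + Z j w) by exact: brvD.
  rewrite ExD ?Ex_cst; [|apply: brvB => //; exact: brvZ|exact: brv_cst].
  by rewrite ExB ?ExZ ?ExD ?Zee ?Ze ?ij//; [ring|exact: brvZ].
have Y2 j : (j < m)%N -> Ex (fun w => Y j w ^+ 2) <= s.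
  move=> jm; have -> : (fun w => Y j w ^+ 2) =
      (fun w => (Z j w ^+ 2 - (2 * e) * Z j w) + cst (e * e) w).
    by apply/funext => w; rewrite /Y /cst; ring.
  rewrite ExD ?Ex_cst; [|apply: brvB; [exact: brvX|exact: brvZ]|exact: brv_cst].
  rewrite ExB ?ExZ ?Zs ?Ze//; [|exact: brvX|exact: brvZ].
  by have := sqr_ge0 e; rewrite expr2; lra.
suff h k : (k <= m)%N -> Ex (fun w => (\sum_(j < k) Y j w) ^+ 2) <= k%:R * s.
  apply: le_trans (h m (leqnn m)); rewrite le_eqVlt; apply/orP; left; apply/eqP.
  congr Ex; apply/funext => w; congr (_ ^+ 2).
  by rewrite /Y big_split/= sumr_const card_ord mulNrn mulr_natl.
elim: k => [_|k IH km].
  rewrite mul0r -[leRHS]Ex_cst le_eqVlt; apply/orP; left; apply/eqP.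
  by congr Ex; apply/funext => w; rewrite big_ord0 expr0n.
have bS : brv (fun w => \sum_(j < k) Y j w) by exact: brv_sum.
have -> : (fun w => (\sum_(j < k.+1) Y j w) ^+ 2) =
   (fun w => ((\sum_(j < k) Y j w) ^+ 2 + Y k w ^+ 2) + 2 * \sum_(j < k) (Y j w * Y k w)).
  by apply/funext => w; rewrite big_ord_recr/= sqrrD -mulr_suml mulr_natl; ring.
have bYk : forall j, brv (fun w => Y j w * Y k w) by move=> j; exact: brvM.
rewrite ExD ?ExD ?ExZ ?(Ex_sum (Z := fun j w => Y j w * Y k w))//.
- rewrite big1 ?mulr0 ?addr0.
    by rewrite -natr1 mulrDl mul1r lerD ?IH ?Y2// ltnW.
  by move=> j _; rewrite YY// ltn_ord.
- exact: (brv_sum (Z := fun j w => Y j w * Y k w)).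
- exact: brvX.
- exact: brvX.
- by apply: brvD; exact: brvX.
- by apply: brvZ; exact: (brv_sum (Z := fun j w => Y j w * Y k w)).
Qed.

Section independence.
Variables xi eta : Omega -> R.
Hypotheses (mxi : measurable_fun setT xi) (meta : measurable_fun setT eta).
Hypothesis ind : forall A B : set R, measurable A -> measurable B ->
  P (xi @^-1` A `&` eta @^-1` B) = (P (xi @^-1` A) * P (eta @^-1` B))%E.

(** By uniqueness of product measures the joint law is the product of the laws, and Tonelli's
    theorem applies. *)
Let ge0_Ex_indep (u v : R -> R) : measurable_fun setT u -> measurable_fun setT v ->
  (forall y, 0 <= u y) -> (forall y, 0 <= v y) ->
  (\int[P]_w (u (xi w) * v (eta w))%:E =
    (\int[P]_w (u (xi w))%:E) * (\int[P]_w (v (eta w))%:E))%E.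
Proof.
move=> mu mv u0 v0.
pose X1 : {RV P >-> R} := mfun_Sub (mem_set mxi).
pose X2 : {RV P >-> R} := mfun_Sub (mem_set meta).
pose pr w := (xi w, eta w).
have mpr : measurable_fun setT (pr : Omega -> (R * R)%type) by exact: measurable_fun_pair.
pose f (z : R * R) := (u z.1 * v z.2)%:E.
have mf : measurable_fun setT f.
  apply/measurable_EFinP; apply: measurable_funM.
    by apply: (measurableT_comp mu); exact: measurable_fst.
  by apply: (measurableT_comp mv); exact: measurable_snd.
have f0 z : (0 <= f z)%E by rewrite lee_fin mulr_ge0.
pose X3 : {mfun Omega >-> (R * R)%type} := mfun_Sub (mem_set mpr).
have m' : forall X, measurable X ->
    (distribution P X1 \x distribution P X2)%E X = distribution P X3 X.
  move=> X mX; apply: (@product_measure_unique _ _ _ _ _ (distribution P X1) (distribution P X2)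
    (distribution P X3)) mX => A B mA mB; exact: ind.
have -> : (\int[P]_w (u (xi w) * v (eta w))%:E =
    \int[distribution P X1 \x distribution P X2]_z f z)%E.
  transitivity (\int[distribution P X3]_z f z)%E; last first.
    by apply: eq_measure_integral => X mX _; exact/esym/m'.
  by rewrite ge0_integral_pushforward.
rewrite fubini_tonelli1//.
have E1 : (\int[P]_w (u (xi w))%:E = \int[distribution P X1]_x (u x)%:E)%E.
  rewrite ge0_integral_pushforward//; first exact/measurable_EFinP.
  by move=> y _; rewrite lee_fin.
have E2 : (\int[P]_w (v (eta w))%:E = \int[distribution P X2]_x (v x)%:E)%E.
  rewrite ge0_integral_pushforward//; first exact/measurable_EFinP.
  by move=> y _; rewrite lee_fin.
rewrite E1 E2 -ge0_integralZr//; last 3 first.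
- exact/measurable_EFinP.
- by move=> x _; rewrite lee_fin.
- by apply: integral_ge0 => x _; rewrite lee_fin.
apply: eq_integral => x _; rewrite /fubini_F /f.
under eq_integral do rewrite EFinM /=.
rewrite ge0_integralZl ?lee_fin//; first exact/measurable_EFinP.
by move=> y _; rewrite lee_fin.
Qed.

(** Adding the bounds [M] and [N] makes both factors nonnegative; the extra terms are linear and
    cancel. *)
Lemma Ex_indep (u v : R -> R) : measurable_fun setT u -> measurable_fun setT v ->
  bdd u -> bdd v ->
  Ex (fun w => u (xi w) * v (eta w)) = Ex (u \o xi) * Ex (v \o eta).
Proof.
move=> mu mv [M uM] [N vN].
have bu : brv (u \o xi) by apply: brv_comp => //; exists M.
have bv : brv (v \o eta) by apply: brv_comp => //; exists N.
have bu' : brv (fun w => u (xi w) + M) by apply: brvD => //; exact: brv_cst.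
have bv' : brv (fun w => v (eta w) + N) by apply: brvD => //; exact: brv_cst.
have h : Ex (fun w => (u (xi w) + M) * (v (eta w) + N)) =
    Ex (fun w => u (xi w) + M) * Ex (fun w => v (eta w) + N).
  apply: EFin_inj; rewrite EFinM -!ExE//; last exact: brvM.
  apply: (@ge0_Ex_indep (fun y => u y + M) (fun y => v y + N)).
  - by apply: measurable_funD => //; exact: measurable_cst.
  - by apply: measurable_funD => //; exact: measurable_cst.
  - by move=> y; have := uM y; rewrite ler_norml => /andP[]; lra.
  - by move=> y; have := vN y; rewrite ler_norml => /andP[]; lra.
rewrite !ExD ?Ex_cst// in h; [|exact: brv_cst|exact: brv_cst].
have E : (fun w => (u (xi w) + M) * (v (eta w) + N)) =
    (fun w => u (xi w) * v (eta w) + (N * u (xi w) + (M * v (eta w) + cst (M * N) w))).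
  by apply/funext => w; rewrite /cst; ring.
rewrite E !ExD ?ExZ ?Ex_cst// in h; first by rewrite -/(u \o xi) -/(v \o eta) in h *; lra.
all: repeat (apply: brvD || apply: brvZ || apply: brvM || exact: brv_cst) => //.
Qed.

End independence.

End bounded_random_variables.

(** * Increments of a Levy process *)

Section same_law.
Context d (Omega : measurableType d) (R : realType) (P : probability Omega R).

Lemma ge0_integral_same_law (xi eta : Omega -> R) (u : R -> \bar R) :
  measurable_fun setT xi -> measurable_fun setT eta ->
  (forall A : set R, measurable A -> P (xi @^-1` A) = P (eta @^-1` A)) ->
  measurable_fun setT u -> (forall y, (0 <= u y)%E) ->
  (\int[P]_w u (xi w) = \int[P]_w u (eta w))%E.
Proof.
move=> mxi meta law mu u0.
pose X1 : {RV P >-> R} := mfun_Sub (mem_set mxi).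
pose X2 : {RV P >-> R} := mfun_Sub (mem_set meta).
transitivity (\int[distribution P X1]_y u y)%E; first by rewrite ge0_integral_pushforward.
transitivity (\int[distribution P X2]_y u y)%E; last by rewrite ge0_integral_pushforward.
by apply: eq_measure_integral => A mA _; exact: law.
Qed.

Lemma Ex_same_law (xi eta : Omega -> R) (u : R -> R) :
  measurable_fun setT xi -> measurable_fun setT eta ->
  (forall A : set R, measurable A -> P (xi @^-1` A) = P (eta @^-1` A)) ->
  measurable_fun setT u -> bdd u ->
  Ex P (u \o xi) = Ex P (u \o eta).
Proof.
move=> mxi meta law mu [M uM].
have b1 : brv (u \o xi) by apply: brv_comp => //; exists M.
have b2 : brv (u \o eta) by apply: brv_comp => //; exists M.
have bM : brv (cst M : Omega -> R) by exact: brv_cst.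
apply: (addIr M); rewrite -[in LHS](Ex_cst P M) -[in RHS](Ex_cst P M) -!ExD//.
apply: EFin_inj; rewrite -!ExE//; [|exact: brvD|exact: brvD].
apply: (@ge0_integral_same_law _ _ (fun y => (u y + M)%:E)) => //.
  by apply/measurable_EFinP/measurable_funD => //; exact: measurable_cst.
by move=> y; rewrite lee_fin; have := uM y; rewrite ler_norml => /andP[]; lra.
Qed.

End same_law.

Section levy_increments.
Context (R : realType) d (Omega : measurableType d) (P : probability Omega R).
Variable X : R -> Omega -> R.
Hypothesis levyX : is_levy_process P X.

Definition grid_inc (N j : nat) w : R := X (j.+1%:R / N%:R) w - X (j%:R / N%:R) w.

Let grid0 (N j : nat) : 0 <= j%:R / N%:R :> R.
Proof. by rewrite divr_ge0. Qed.

Lemma measurable_grid_inc N j : measurable_fun setT (grid_inc N j).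
Proof. by case: levyX => mX _ _ _ _; apply: measurable_funB; apply: mX. Qed.

Lemma Ex_grid_inc (u : R -> R) N j : measurable_fun setT u ->
  bdd u -> Ex P (u \o grid_inc N j) = Ex P (u \o grid_inc N 0).
Proof.
move=> mu uM; apply: Ex_same_law => //; try exact: measurable_grid_inc.
move=> A mA; case: levyX => _ _ _ st _.
have N0 : 0 <= N%:R^-1 :> R by rewrite invr_ge0.
have := st (j%:R / N%:R) N%:R^-1 A (grid0 N j) N0 mA.
have -> : grid_inc N j = increment X (j%:R / N%:R) (j%:R / N%:R + N%:R^-1).
  by apply/funext => w; rewrite /grid_inc /increment -natr1 mulrDl mul1r.
by have -> : grid_inc N 0 = increment X 0 N%:R^-1; last by [];
  apply/funext => w; rewrite /grid_inc /increment mul0r mul1r.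
Qed.

Lemma Ex_grid_inc_indep (u v : R -> R) N i j : (i < j)%N ->
  measurable_fun setT u -> measurable_fun setT v ->
  bdd u -> bdd v ->
  Ex P (fun w => u (grid_inc N i w) * v (grid_inc N j w)) = Ex P (u \o grid_inc N 0) * Ex P (v \o grid_inc N 0).
Proof.
move=> ij mu mv uM vM; rewrite -(Ex_grid_inc N i)// -(Ex_grid_inc N j)//.
apply: Ex_indep => //; try exact: measurable_grid_inc.
move=> A B mA mB; case: levyX => _ _ ind _ _.
(* Independence is stated for all the consecutive increments up to [j]; the whole line is used for
   those other than [i] and [j]. *)
pose E k := if k == i then A else if k == j then B else setT.
have mE k : measurable (E k) by rewrite /E; case: ifP => // _; case: ifP.
have t1 k : k%:R / N%:R <= k.+1%:R / N%:R :> R by rewrite ler_wpM2r ?invr_ge0// ler_nat.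
have := ind j.+1 (fun k => k%:R / N%:R) E (grid0 N 0) t1 mE.
have -> : \bigcap_(k < j.+1) (increment X (k%:R / N%:R) (k.+1%:R / N%:R) @^-1` E k) =
    grid_inc N i @^-1` A `&` grid_inc N j @^-1` B.
  apply/seteqP; split => w /=.
    move=> h; split.
      by have := h i (ltn_trans ij (ltnSn j)); rewrite /= /E eqxx.
    by have := h j (ltnSn j); rewrite /= /E eqxx (gtn_eqF ij).
  move=> [hA hB] k /= kj; rewrite /E; case: eqP => [->//|_].
  by case: eqP => [->//|_].
have ij' : (i < j.+1)%N by rewrite ltnS ltnW.
have jj' : (j < j.+1)%N by rewrite ltnS.
move=> ->; rewrite (bigD1 (Ordinal ij'))//= (bigD1 (Ordinal jj'))/=; last first.
  by rewrite -val_eqE/= (gtn_eqF ij).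
rewrite big1 ?mule1.
  by rewrite /E !eqxx (gtn_eqF ij).
move=> [k kj]; rewrite -!val_eqE/= => /andP[/negbTE ki /negbTE kj'].
by rewrite /E ki kj' preimage_setT probability_setT.
Qed.

Lemma Ex_sqr_increments (u : R -> R) m N : measurable_fun setT u ->
  bdd u ->
  Ex P (fun w => (\sum_(j < m) u (grid_inc N j w) - m%:R * Ex P (u \o grid_inc N 0)) ^+ 2) <=
    m%:R * Ex P (fun w => u (grid_inc N 0 w) ^+ 2).
Proof.
move=> mu uM.
have b j : brv (u \o grid_inc N j) by apply: brv_comp => //; exact: measurable_grid_inc.
apply: (@Ex_sqr_sum _ _ _ P (fun j w => u (grid_inc N j w))) => //.
- by move=> j _; exact: Ex_grid_inc.
- move=> j _; apply: (@Ex_grid_inc (fun y => u y ^+ 2)); first exact: measurable_funX.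
  have [M h] := uM; exists (M ^+ 2) => y; rewrite normrX lerXn2r ?nnegrE//.
  exact: le_trans (h 0).
- by move=> i j /andP[ij _]; exact: Ex_grid_inc_indep.
Qed.

Lemma levy_good_set : exists G : set Omega, [/\ measurable G, P (~` G) = 0%E &
  forall w, G w -> X 0 w = 0 /\ cadlag0 (X^~ w)].
Proof.
case: levyX => _ [N1 [mN1 PN1 h1]] _ _ [_ [N2 [mN2 PN2 h2]]].
exists (~` (N1 `|` N2)); split.
- by apply: measurableC; exact: measurableU.
- by rewrite setCK measureU0.
- move=> w; rewrite setCU => -[n1 n2]; split.
    by apply: contrapT => h; apply: n1; apply: h1.
  by apply: contrapT => h; apply: n2; apply: h2.
Qed.

End levy_increments.

Section levy_jumps.
Context (R : realType) d (Omega : measurableType d) (P : probability Omega R).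
Variable X : R -> Omega -> R.
Hypothesis levyX : is_levy_process P X.
Variable G : set Omega.
Hypotheses (mG : measurable G) (PG : P (~` G) = 0%E).
Hypothesis goodG : forall w, G w -> X 0 w = 0 /\ cadlag0 (X^~ w).
Local Notation D := (grid_inc X).
Implicit Types phi : R -> R.

(** The functions for which sums over increments tend to sums over jumps along every cadlag path,
    bounded so that all moments exist. *)
Definition test_fun phi := [/\ continuous phi, exists e, vanishing e phi &
  bdd phi].

Lemma test_fun_measurable phi : test_fun phi -> measurable_fun setT phi.
Proof. by case=> c _ _; exact: continuous_measurable_fun. Qed.

Lemma aeG (Q : Omega -> Prop) : (forall w, G w -> Q w) -> {ae P, forall w, Q w}.
Proof.
move=> h; exists (~` G); split => //; first exact: measurableC.
by move=> w /= nQ Gw; apply: nQ; exact: h.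
Qed.

(* The path of [w] is only known to be cadlag for [w] in the set [G] of full
   probability; the value [0] elsewhere makes the sum measurable. *)
Definition good_jump_sum phi t w : R := if w \in G then jump_sum (X^~ w) phi t else 0.
Local Notation Jx := good_jump_sum.

Lemma good_jump_sumE phi t w : G w -> Jx phi t w = jump_sum (X^~ w) phi t.
Proof. by move=> Gw; rewrite /good_jump_sum mem_set. Qed.

(** The mesh is [1 / (n m)] so that [1 / n] is exactly the [m]-th grid point. *)
Lemma increments_cvg_good_jump_sum phi n w : test_fun phi -> G w -> (0 < n)%N ->
  \sum_(j < m) phi (D (n * m) j w) @[m --> \oo] --> Jx phi n%:R^-1 w.
Proof.
move=> [cphi [e [e0 ve]] _] Gw n0; have [_ cw] := goodG Gw.
have n0' : n%:R != 0 :> R by rewrite pnatr_eq0 -lt0n.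
rewrite good_jump_sumE//; apply/cvgrPdist_le => r r0.
have [N hN] := @riemann_jump_sum _ _ cw phi e e0 ve cphi n%:R^-1 r
  ltac:(by rewrite invr_ge0) r0.
exists N.+1 => // m /= Nm; rewrite distrC.
have m0 : m%:R != 0 :> R by rewrite pnatr_eq0 -lt0n (leq_trans _ Nm).
have := hN (n * m)%N (leq_trans (ltnW Nm) (leq_pmull m n0)) m.
rewrite natrM (_ : m%:R / (n%:R * m%:R) = n%:R^-1); last by field; rewrite n0' m0.
have -> : n%:R * m%:R * n%:R^-1 = m%:R :> R by field.
by move=> /(_ (lexx _)); congr (`|_ - _| <= r); apply: eq_bigr => j _; rewrite /grid_inc natrM.
Qed.

Lemma measurable_good_jump_sum phi e t : continuous phi -> vanishing e phi -> 0 <= t ->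
  measurable_fun setT (Jx phi t).
Proof.
move=> cphi [e0 ve] t0; have mphi := continuous_measurable_fun cphi.
apply/(measurable_restrictT _ mG).1.
(* The extra step puts the last grid time to the right of [t], where the jump sum eventually equals
   its value at [t]; stopping to the left of [t] would miss a jump at [t]. *)
pose k n := (Num.truncn (n%:R * t)).+1.
have cv w : G w -> \sum_(j < k n) phi (D n j w) @[n --> \oo] --> jump_sum (X^~ w) phi t.
  move=> Gw; have [_ cw] := goodG Gw.
  apply/cvgrPdist_le => r r0; have [s s0 hs] := jump_sum_right cw (conj e0 ve) t0.
  have [N1 h1] := @riemann_jump_sum _ _ cw phi e e0 ve cphi (t + 1) r
    ltac:(by rewrite addr_ge0) r0.
  have [N2 h2] := inv_nat_lt s0.
  exists (maxn N1 N2) => // n /=; rewrite geq_max => /andP[/h1 h /h2[n0 ns]].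
  have n0' : 0 < n%:R :> R by rewrite ltr0n.
  have /andP[k1 k2] := truncn_itv (mulr_ge0 (ltW n0') t0).
  have n1 : 1 <= n%:R :> R by rewrite ler1n.
  have kn : (k n)%:R / n%:R <= t + n%:R^-1.
    by rewrite ler_pdivrMr// mulrDl mulVf ?gt_eqF// /k -natr1 lerD2r (mulrC t).
  have /h : (k n)%:R <= n%:R * (t + 1).
    by move: kn; rewrite ler_pdivrMr// mulrDl mulVf ?gt_eqF// => kn; rewrite mulrDr mulr1; lra.
  rewrite hs; first by rewrite distrC.
  by rewrite ler_pdivlMr// mulrC ltW//= (le_lt_trans kn)// ltrD2l.
apply: (@measurable_fun_cvg _ _ _ _ (fun n w => \sum_(j < k n) phi (D n j w))) => //.
move=> n; apply: measurable_funTS.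
apply: (measurable_ord_sum (Z := fun j w => phi (D n j w))) => j.
by apply: measurableT_comp => //; exact: (measurable_grid_inc levyX).
Qed.


Lemma test_funX phi : test_fun phi -> test_fun (fun y => phi y ^+ 2).
Proof.
move=> [cphi [e [e0 ve]] [M bM]]; split.
- by move=> y; apply: (@continuous_comp _ _ _ phi (fun z => z ^+ 2)); [exact: cphi|exact: exprn_continuous].
- by exists e; split => // y ye; rewrite ve// expr0n.
- by exists (M ^+ 2) => y; rewrite normrX lerXn2r ?nnegrE// (le_trans _ (bM y)).
Qed.

Lemma good_jump_sum_ge0 phi t w : (forall y, 0 <= phi y) -> 0 <= Jx phi t w.
Proof. by move=> p0; rewrite /good_jump_sum; case: ifP => // _; exact: jump_sum_ge0. Qed.

(** * Convergence of the rates [N E phi(X(1/N))] for nonnegative test functions *)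

Section rate.
Variable phi : R -> R.
Hypotheses (tphi : test_fun phi) (phi0 : forall y, 0 <= phi y).

Let S N w := \sum_(j < N) phi (D N j w).
Let a N := N%:R * Ex P (phi \o D N 0).

Let bphi j N : brv (phi \o D N j).
Proof.
apply: brv_comp; [exact: test_fun_measurable|by case: tphi|exact: (measurable_grid_inc levyX)].
Qed.

Let bS N : brv (S N).
Proof. by apply: (brv_sum (Z := fun j => phi \o D N j)). Qed.

Let S_ge0 N w : 0 <= S N w.
Proof. by apply: sumr_ge0. Qed.

Let S_cvg w : G w -> S N w @[N --> \oo] --> Jx phi 1 w.
Proof.
move=> Gw; have := increments_cvg_good_jump_sum tphi Gw (ltn0Sn 0).
by rewrite invr1; under eq_fun do rewrite mul1n.
Qed.

Let ExS N : Ex P (S N) = a N.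
Proof.
rewrite /S (@Ex_sum _ _ _ P (fun j => phi \o D N j))//.
rewrite (eq_bigr (fun=> Ex P (phi \o D N 0))).
  by rewrite sumr_const card_ord -[LHS]mulr_natl.
by move=> j _; apply: (Ex_grid_inc levyX) => //; [exact: test_fun_measurable|case: tphi].
Qed.

Let var N (C : R) : (forall y, `|phi y| <= C) -> Ex P (fun w => (S N w - a N) ^+ 2) <= C * a N.
Proof.
move=> hC; have [_ _ bp] := tphi.
apply: le_trans (Ex_sqr_increments levyX N N (test_fun_measurable tphi) bp) _.
rewrite /a mulrCA ler_wpM2l// -ExZ//; apply: Ex_le => //; [exact: (brvX (bphi 0 N))|exact: (brvZ C (bphi 0 N))|].
move=> w; rewrite expr2 ler_wpM2r//.
exact: le_trans (ler_norm _) (hC _).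
Qed.

Let a_ge0 N : 0 <= a N.
Proof. by rewrite mulr_ge0// Ex_ge0// => w; exact: phi0. Qed.

(* If the means [a N] were unbounded, Chebyshev's inequality would push the
   sums [S N] to infinity, although they converge almost surely. *)
Lemma rate_bounded : exists K, forall N, a N <= K.
Proof.
have [_ _ [C hC]] := tphi.
have C0 : 0 <= C by exact: le_trans (hC 0).
(* [A K] collects the outcomes whose sums stay below [K] from index [K] on; as the sums converge
   almost surely, these sets increase to almost all of the space. *)
pose A K := \bigcap_(N in [set N | (K <= N)%N]) [set w | S N w <= K%:R].
have mA K : measurable (A K).
  apply: bigcap_measurableType => N _.
  rewrite -[X in measurable X]setTI; apply: measurable_fun_ler => //.
  by case: (bS N).
have PA : P (A K) @[K --> \oo] --> 1%E.
  have -> : 1%E = P (\bigcup_K A K).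
    apply/eqP; rewrite eq_le; apply/andP; split; last exact: probability_le1 (bigcupT_measurable _ mA).
    have <- : P G = 1%E.
      by have := probability_setC P (measurableC mG); rewrite setCK PG sube0.
    apply: le_measure; rewrite ?inE//; first exact: bigcupT_measurable.
    move=> w Gw; have := S_cvg Gw => /cvgrPdist_le /(_ _ ltr01)[N0 _ h].
    pose K := maxn N0 (Num.truncn (Jx phi 1 w + 1)).+1.
    exists K => // N /= KN; have := h N (leq_trans (leq_maxl _ _) KN).
    rewrite distrC ler_norml => /andP[_ h1].
    apply: (@le_trans _ _ (Jx phi 1 w + 1)); first by lra.
    apply: (le_trans (ltW (truncnS_gt _))).
    by rewrite ler_nat leq_maxr.
  apply: nondecreasing_cvg_mu => //; first exact: bigcupT_measurable.
  move=> K K' KK'; apply/subsetPset => w h N /= KN.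
  by apply: le_trans (h N (leq_trans KK' KN)) _; rewrite ler_nat.
have [K hK] : exists K, ((3 / 4)%:E < P (A K))%E.
  move/fine_cvgP: PA => [_ /cvgrPdist_lt /(_ (1 / 4))[|K _ /(_ K (leqnn K)) /= h]].
    by rewrite divr_gt0.
  exists K; rewrite -(fineK (fin_num_measure P _ (mA K))) lte_fin.
  by move: h; rewrite ltr_norml => /andP[_]; lra.
(* If the mean [a N] exceeds [2 K], then on [A K] the sum is off its mean by at least half of it, an
   event of probability at most [4 C / a N]. A mean above [16 C] makes this at most [1 / 4], against
   [P (A K) > 3 / 4]. The last term covers the finitely many [N < K]. *)
exists (Num.max (Num.max (2 * K%:R) (16 * C)) (K%:R * C)) => N; rewrite !le_max.
have [KN|NK] := leqP K N; last first.
  apply/orP; right; rewrite /a; apply: ler_pM => //.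
  - by rewrite Ex_ge0// => w; exact: phi0.
  - by rewrite ler_nat ltnW.
  - rewrite -(Ex_cst P C); apply: Ex_le => //; first exact: brv_cst.
    by move=> w; exact: le_trans (ler_norm _) (hC _).
rewrite leNgt (leNgt (a N) (16 * C)) -negb_and; apply/orP; left.
apply/negP => /andP[aK aC].
have a0 : 0 < a N by apply: le_lt_trans aK; rewrite mulr_ge0.
have bSa : brv (fun w => S N w - a N) by apply: brvB => //; exact: brv_cst.
have := chebyshev_brv P bSa (divr_gt0 a0 (ltr0n R 2)).
apply/negP; rewrite -ltNge.
apply: (@lt_le_trans _ _ (P (A K))); last first.
  apply: le_measure; rewrite ?inE//.
    rewrite -[X in measurable X]setTI; apply: measurable_fun_ler => //.
    by apply: measurableT_comp; [exact: normr_measurable|case: bSa].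
  by move=> w /(_ N KN)/= h; rewrite distrC ger0_norm; lra.
apply: le_lt_trans hK; rewrite lee_fin ler_pdivrMr ?exprn_gt0 ?divr_gt0//.
apply: le_trans (var N hC) _; rewrite expr_div_n expr2; nra.
Qed.

Lemma rate_sqr_bounded : exists K, forall N, Ex P (fun w => S N w ^+ 2) <= K.
Proof.
have [_ _ [C hC]] := tphi; have [K hK] := rate_bounded.
have C0 : 0 <= C by exact: le_trans (hC 0).
exists (C * K + K ^+ 2) => N.
have -> : (fun w => S N w ^+ 2) =
    (fun w => ((S N w - a N) ^+ 2 + (2 * a N) * S N w) - cst (a N ^+ 2) w).
  by apply/funext => w; rewrite /cst; ring.
have b1 : brv (fun w => (S N w - a N) ^+ 2) by apply: brvX; apply: brvB => //; exact: brv_cst.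
have b2 : brv (fun w => (2 * a N) * S N w) by exact: brvZ.
rewrite ExB; [|exact: (brvD b1 b2)|exact: brv_cst].
rewrite ExD// ExZ// Ex_cst ExS.
have := var N hC; have := hK N; have := a_ge0 N => h1 h2 h3.
have : C * a N <= C * K by rewrite ler_wpM2l.
have : a N ^+ 2 <= K ^+ 2 by rewrite lerXn2r ?nnegrE//; exact: le_trans h2.
by rewrite !expr2 in h3 *; nra.
Qed.

(** The sums converge almost surely and are bounded in L2, hence uniformly integrable. Concretely,
    truncating them at level [n] changes the mean by at most [K2 / n] whatever [N] is, and the
    truncated means converge by dominated convergence. *)
Lemma rate_cvg : exists I, (\int[P]_w (Jx phi 1 w)%:E)%E = I%:E /\ a N @[N --> \oo] --> I.
Proof.
have [K hK] := rate_bounded; have [K2 hK2] := rate_sqr_bounded.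
have mJ : measurable_fun setT (Jx phi 1) by case: tphi => cphi [e ve] _; exact: measurable_good_jump_sum ve _.
have J0 w : 0 <= Jx phi 1 w by exact: good_jump_sum_ge0.
have bmin (f : Omega -> R) (M : R) : measurable_fun setT f -> (forall w, 0 <= f w) -> 0 <= M ->
    brv (fun w => Num.min (f w) M).
  move=> mf f0 M0; split; first by apply: measurable_minr => //; exact: measurable_cst.
  by exists M => w; rewrite ger0_norm ?ge_min ?lexx ?orbT// le_min f0.
pose c (n : nat) := Ex P (fun w => Num.min (Jx phi 1 w) n%:R).
pose b N (n : nat) := Ex P (fun w => Num.min (S N w) n%:R).
have mS N : measurable_fun setT (S N) by case: (bS N).
have bc n : b N n @[N --> \oo] --> c n.
  apply: (@Ex_cvg _ _ _ _ _ _ n%:R).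
  - by move=> N; case: (bmin (S N) n%:R) => //.
  - by case: (bmin (Jx phi 1) n%:R) => //.
  - by move=> N w; rewrite ger0_norm ?ge_min ?lexx ?orbT// le_min S_ge0/=.
  - apply: aeG => w Gw; apply: (@cvg_comp _ _ _ (fun N => S N w) (fun z => Num.min z n%:R) _ _ _ (S_cvg Gw)).
    by apply: (@continuous_min R R id (cst n%:R)); [exact: cvg_id|exact: cvg_cst].
have ba N n : b N n <= a N.
  rewrite -ExS; apply: Ex_le => //; first by apply: bmin.
  by move=> w; rewrite ge_min lexx.
have cK n : c n <= K.
  have h := bc n; rewrite -(cvg_lim _ h)//; apply: limr_le; first by apply/cvg_ex; eexists; exact: h.
  by apply: nearW => N; exact: le_trans (ba N n) (hK N).
have ci : (c n)%:E @[n --> \oo] --> (\int[P]_w (Jx phi 1 w)%:E)%E.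
  pose g' (n : nat) w := (Num.min (Jx phi 1 w) n%:R)%:E.
  have := @cvg_monotone_convergence _ _ _ P setT measurableT g'.
  have -> : (fun n => \int[P]_w g' n w)%E = (fun n => (c n)%:E).
    by apply/funext => n; rewrite ExE//; exact: bmin.
  have -> : (\int[P]_w limn (g'^~ w) = \int[P]_w (Jx phi 1 w)%:E)%E.
    apply: eq_integral => w _; apply/cvg_lim => //; apply: cvg_near_cst.
    exists (Num.truncn (Jx phi 1 w)).+1 => // n /= Jn; rewrite /g' min_l//.
    by apply: (le_trans (ltW (truncnS_gt _))); rewrite ler_nat.
  apply.
  - by move=> n; apply/measurable_EFinP; case: (bmin (Jx phi 1) n%:R).
  - by move=> n w _; rewrite lee_fin le_min J0/=.
  - move=> w _ n m nm; rewrite lee_fin le_min !ge_min lexx/= ler_nat nm orbT//.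
pose I := fine (\int[P]_w (Jx phi 1 w)%:E)%E.
have IE : (\int[P]_w (Jx phi 1 w)%:E)%E = I%:E.
  rewrite /I fineK// ge0_fin_numE; last by apply: integral_ge0 => w _; rewrite lee_fin.
  apply: (@le_lt_trans _ _ K%:E); last exact: ltry.
  rewrite -(cvg_lim _ ci)//; apply: lime_le; first by apply/cvg_ex; eexists; exact: ci.
  by apply: nearW => n; rewrite lee_fin.
exists I; split=> //.
have {}ci : c n @[n --> \oo] --> I by move: ci; rewrite IE => /fine_cvgP[].
have K20 : 0 <= K2 by apply: le_trans (hK2 0%N); apply: Ex_ge0 => w; exact: sqr_ge0.
(* Because [n (s - min s n) <= s^2] for nonnegative [s] and [n]. *)
have ab N n : a N - b N n.+1 <= K2 / n.+1%:R.
  rewrite ler_pdivlMr// mulrC -ExS -ExB//; last by apply: bmin.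
  rewrite -ExZ; last by apply: brvB => //; exact: bmin.
  apply: le_trans (hK2 N); apply: Ex_le.
  - by apply: brvZ; apply: brvB => //; exact: bmin.
  - exact: brvX.
  - move=> w; have s0 := S_ge0 N w; have n0 : 0 <= n.+1%:R :> R by [].
    by case: (leP (S N w) n.+1%:R) => h; rewrite expr2; nra.
apply/cvgrPdist_le => e e0; have e30 : 0 < e / 3 by rewrite divr_gt0.
have e3K : 0 < e / 3 / (K2 + 1) by rewrite divr_gt0// ltr_wpDl.
have [N1 h1] := inv_nat_lt e3K.
move: (ci) => /cvgrPdist_le /(_ _ e30)[N2 _ h2].
pose n := (maxn N1 N2).+1.
have {h1}[_ h1] := h1 n (leq_trans (leq_maxl N1 N2) (leqnSn _)).
have {}h2 := h2 n (leq_trans (leq_maxr N1 N2) (leqnSn _)).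
move: (bc n) => /cvgrPdist_le /(_ _ e30)[N3 _ h3].
exists N3 => // N /= /h3 {}h3; have := ab N (maxn N1 N2); rewrite -/n => h4.
have h5 : K2 / n%:R <= e / 3.
  have n0 : 0 < n%:R^-1 :> R by rewrite invr_gt0.
  have := ltW h1; rewrite ler_pdivlMr ?ltr_wpDl//; nra.
have := ba N n; rewrite /= in h2 h3 *.
by move: h2 h3; rewrite !ler_norml => /andP[? ?] /andP[? ?] ?; apply/andP; split; lra.
Qed.

End rate.

End levy_jumps.

(** * The Levy measure as a jump rate *)

Section fatou.
Context d (Omega : measurableType d) (R : realType) (mu : {measure set Omega -> \bar R}).

Lemma ge0_integral_scale (r : R) (f : Omega -> R) : measurable_fun setT f -> 0 <= r ->
  (forall w, 0 <= f w) -> (\int[mu]_w (r * f w)%:E = r%:E * \int[mu]_w (f w)%:E)%E.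
Proof.
move=> mf r0 f0; under eq_integral do rewrite EFinM.
rewrite ge0_integralZl ?lee_fin//; first exact/measurable_EFinP.
by move=> w _; rewrite lee_fin.
Qed.

(** The limit [f] need not be measurable and the convergence holds on [G] only, so the integrals are
    restricted to [G] before Fatou's lemma is applied. *)
Lemma fatou_le (G : set Omega) (f_ : nat -> Omega -> R) (f : Omega -> R) (c : nat -> R) (l : R) :
  measurable G -> mu (~` G) = 0%E ->
  (forall n, measurable_fun setT (f_ n)) -> (forall n w, 0 <= f_ n w) ->
  (forall w, 0 <= f w) -> (forall w, G w -> f_ n w @[n --> \oo] --> f w) ->
  (forall n, (\int[mu]_w (f_ n w)%:E <= (c n)%:E)%E) -> c n @[n --> \oo] --> l ->
  (\int[mu]_w (f w)%:E <= l%:E)%E.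
Proof.
move=> mG G0 mf_ f_0 f0 cf fc cl.
rewrite (integral_conegligible mG G0); last by move=> w; rewrite lee_fin.
have -> : (\int[mu]_(w in G) (f w)%:E =
    \int[mu]_(w in G) limn_einf (fun n => (f_ n w)%:E))%E.
  apply: eq_integral => w /set_mem Gw.
  have h : (f_ n w)%:E @[n --> \oo] --> (f w)%:E.
    by apply: cvg_EFin; [exact: nearW|exact: cf].
  by have [-> _] := cvg_limn_einf_sup h.
have := @fatou _ _ _ mu G mG (fun n w => (f_ n w)%:E).
move=> /(_ _ _)/le_trans; apply.
- by move=> n; apply: measurable_funTS; exact/measurable_EFinP.
- by move=> n w _; rewrite lee_fin.
rewrite limn_einf_lim; apply: lime_le; first exact: is_cvg_einfs.
apply: nearW => n.
have cl' : (c m)%:E @[m --> \oo] --> l%:E by apply: cvg_EFin => //; exact: nearW.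
rewrite -(cvg_lim _ cl')//; apply: lime_ge; first by apply/cvg_ex; eexists; exact: cl'.
near=> m; apply: (@le_trans _ _ (\int[mu]_(w in G) (f_ m w)%:E)%E).
  by apply: ereal_inf_lbound; exists m => //=; near: m; exact: nbhs_infty_ge.
rewrite -(integral_conegligible mG G0)//.
by move=> w; rewrite lee_fin.
Unshelve. all: by end_near. Qed.

End fatou.

Section above.
Variables (R : realType) (psi : R -> R) (u : R).

(** A continuous function that tends to the indicator of [psi > u] as [k] grows; sums over the jumps
    in a level set are measurable as limits of those of [above]. *)
Definition above (k : R) y : R := Num.min 1 (k * Num.max 0 (psi y - u)).

Lemma above_eq0 k y : psi y <= u -> above k y = 0.
Proof. by move=> yu; rewrite /above max_l ?subr_le0// mulr0 min_r// ler01. Qed.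

Lemma continuous_above k : continuous psi -> continuous (above k).
Proof.
move=> cpsi y; rewrite /above.
apply: (@continuous_min R R (cst 1) (fun x => k * Num.max 0 (psi x - u))).
  exact: cvg_cst.
apply: cvgM; first exact: cvg_cst.
apply: (@continuous_max R R (cst 0) (fun x => psi x - u)); first exact: cvg_cst.
by apply: cvgB; [exact: cpsi|exact: cvg_cst].
Qed.

Lemma above_cvg y : above k%:R y @[k --> \oo] --> (\1_[set y | u < psi y] y : R).
Proof.
have [uy|yu] := ltP u (psi y); last first.
  rewrite indicE memNset/=; last by apply/negP; rewrite -leNgt.
  by apply: cvg_near_cst; apply: nearW => k; exact: above_eq0.
rewrite indicE mem_set//=; apply: cvg_near_cst.
have uy0 : 0 < psi y - u by rewrite subr_gt0.
have [N hN] := inv_nat_lt uy0; exists N => // k /= /hN[k0 kinv].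
rewrite /above min_l// max_r; last exact: ltW.
by rewrite -ler_pdivrMl ?ltr0n// mulr1 ltW.
Qed.

End above.

Section levy_measure_integrals.
Context (R : realType) d (Omega : measurableType d) (P : probability Omega R).
Variable X : R -> Omega -> R.
Hypothesis levyX : is_levy_process P X.
Variable G : set Omega.
Hypotheses (mG : measurable G) (PG : P (~` G) = 0%E).
Hypothesis goodG : forall w, G w -> X 0 w = 0 /\ cadlag0 (X^~ w).
Variable F : {measure set R -> \bar R}.
Hypothesis levyF : is_levy_measure P X F.
Local Notation D := (grid_inc X).
Local Notation Jx := (good_jump_sum X G).
Implicit Types phi : R -> R.

Lemma good_jump_sum_cvg e (phi_ : nat -> R -> R) phi t w :
  (forall k, vanishing e (phi_ k)) -> vanishing e phi ->
  (forall y, phi_ k y @[k --> \oo] --> phi y) ->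
  Jx (phi_ k) t w @[k --> \oo] --> Jx phi t w.
Proof.
move=> v_ v h; rewrite /good_jump_sum; case: ifPn => [/set_mem Gw|_]; last exact: cvg_cst.
by apply: (@jump_sum_cvg _ _ _ e) => //; exact: (goodG Gw).2.
Qed.

Lemma measurable_good_jump_sum_lim e (phi_ : nat -> R -> R) phi t : 0 <= t ->
  (forall k, continuous (phi_ k)) ->
  (forall k, vanishing e (phi_ k)) -> vanishing e phi ->
  (forall y, phi_ k y @[k --> \oo] --> phi y) ->
  measurable_fun setT (Jx phi t).
Proof.
move=> t0 c_ v_ v h; apply: (@measurable_fun_cvg _ _ _ _ (fun k => Jx (phi_ k) t)).
  by move=> k; exact: (measurable_good_jump_sum levyX mG goodG (c_ k) (v_ k)).
by move=> w _; exact: good_jump_sum_cvg.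
Qed.

Lemma good_jump_sum_ord_sum e (phi_ : nat -> R -> R) m t w : 0 < e ->
  (forall k, vanishing e (phi_ k)) ->
  Jx (fun y => \sum_(k < m) phi_ k y) t w = \sum_(k < m) Jx (phi_ k) t w.
Proof.
move=> e0 v_; rewrite /good_jump_sum; case: ifPn => [/set_mem Gw|_]; last by rewrite big1.
have [_ cw] := goodG Gw; elim: m => [|m IH].
  by rewrite big_ord0; apply: jump_sum_eq0 => s _; rewrite big_ord0.
rewrite big_ord_recr/= -IH -(@jump_sumD _ _ cw e)//.
  by congr jump_sum; apply/funext => y; rewrite big_ord_recr.
by split => // y ye; rewrite big1// => k _; have [_ ->] := v_ k.
Qed.

Lemma good_jump_sum_le e phi psi t w : vanishing e phi -> vanishing e psi ->
  (forall y, phi y <= psi y) -> Jx phi t w <= Jx psi t w.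
Proof.
move=> v1 v2 le; rewrite /good_jump_sum; case: ifPn => [/set_mem Gw|_]//.
by apply: (@jump_sum_le _ _ _ e) => //; exact: (goodG Gw).2.
Qed.

Lemma levy_measure_count e (A : set R) : measurable A -> 0 < e ->
  (forall y, `|y| <= e -> ~ A y) -> (F A = \int[P]_w (Jx \1_A 1 w)%:E)%E.
Proof.
move=> mA e0 eA; case: levyF => _ _ ->//; last by apply: eA; rewrite normr0 ltW.
rewrite (integral_conegligible mG PG)//.
rewrite [RHS](integral_conegligible mG PG); last first.
  by move=> w; rewrite lee_fin good_jump_sum_ge0.
apply: eq_integral => w /set_mem Gw.
by rewrite good_jump_sumE// (@jump_measure_count _ _ (goodG Gw).2 e).
Qed.

Lemma continuous_gt_measurable phi u : continuous phi -> measurable [set y | u < phi y].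
Proof.
move=> c; rewrite -[X in measurable X]setTI; apply: measurable_fun_ltr => //.
exact: continuous_measurable_fun.
Qed.

(* Both sides are compared with the layered sums [N^-1 * sum_k 1{phi > k/N}],
   for which the identity is the definition of the Levy measure. *)
Lemma levy_measure_integral phi : test_fun phi -> (forall y, 0 <= phi y) ->
  (\int[F]_y (phi y)%:E = \int[P]_w (Jx phi 1 w)%:E)%E.
Proof.
move=> tphi phi0; have [cphi [e [e0 ve]] [M hM]] := tphi.
have vphi : vanishing e phi by [].
pose A (u : R) := [set y | u < phi y].
have mA (u : R) : measurable (A u) by exact: continuous_gt_measurable.
have eA (u : R) : 0 <= u -> forall y, `|y| <= e -> ~ A u y.
  by move=> u0 y ye; rewrite /A /= ve//; apply/negP; rewrite -leNgt.
have vA (u : R) : 0 <= u -> vanishing e (\1_(A u) : R -> R).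
  by move=> u0; split => // y /(eA _ u0) h; rewrite indicE memNset.
have mJA (u : R) : 0 <= u -> measurable_fun setT (Jx \1_(A u) 1).
  move=> u0; apply: (@measurable_good_jump_sum_lim e (fun k => above phi u k%:R)) => //.
  - by move=> k; exact: continuous_above.
  - by move=> k; split => // y ye; rewrite above_eq0// ve.
  - exact: vA.
  - by move=> y; exact: above_cvg.
(* The level set stays away from 0, so its indicator is below a ramp, whose rate is finite by
   [rate_cvg]; the ramp rises from 0 at [e / 2] to 1 at [e]. *)
have f0fin : (F (A 0%R) < +oo)%E.
  pose r := ramp (e / 2) (2 / e).
  have e20 : 0 < e / 2 by rewrite divr_gt0.
  have tr : test_fun r.
    split; first exact: continuous_ramp.
      by exists (e / 2); split => // y; exact: ramp_eq0.
    by exists 1 => y; rewrite ger0_norm ?ramp_le1// ramp_ge0// divr_ge0// ltW.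
  have r0 y : 0 <= r y by rewrite ramp_ge0// divr_ge0// ltW.
  have [I [HI _]] := rate_cvg levyX mG PG goodG tr r0.
  rewrite (@levy_measure_count (e / 2))//; last first.
    by move=> y ye; apply: (eA 0%R) => //; lra.
  apply: (@le_lt_trans _ _ (\int[P]_w (Jx r 1 w)%:E)%E); last by rewrite HI ltry.
  apply: le_integral_nonmeasurable => w; rewrite lee_fin ?good_jump_sum_ge0//.
  apply: (@good_jump_sum_le (e / 2)).
  - by apply: vanishing_le (vA 0 (lexx 0)) => //; lra.
  - by split => // y; exact: ramp_eq0.
  - move=> y; rewrite indicE; case: (boolP (y \in A 0%R)) => [/set_mem Ay|_]; last exact: r0.
    rewrite /r ramp_eq1 ?divr_gt0// invf_div -splitr leNgt; apply/negP => ye.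
    by apply: (eA 0 (lexx 0) y) => //; exact: ltW.
have PJ0 : (\int[P]_w (Jx \1_(A 0%R) 1 w)%:E = F (A 0%R))%E.
  by rewrite (@levy_measure_count e)//; exact: eA.
pose K := (Num.truncn M).+1.
have hK y : phi y <= K%:R by apply: le_trans (le_trans (ler_norm _) (hM y)) _; exact: ltW (truncnS_gt _).
pose layer N y : R := \sum_(k < N * K) N%:R^-1 * \1_(A (k%:R / N%:R)) y.
(* The number of levels [k / N] below [phi y] is the ceiling of [N phi y], so the layered sum
   exceeds [phi] by at most [1 / N], and only where [phi > 0]. *)
have layerP N y : (0 < N)%N -> phi y <= layer N y <= phi y + N%:R^-1 * \1_(A 0%R) y.
  move=> N0; have N0' : 0 < N%:R :> R by rewrite ltr0n.
  pose c := nceil N (phi y).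
  have /andP[c1 c2] := nceilP N (phi0 y); rewrite -/c in c1 c2.
  have cN : (c <= N * K)%N.
    have : c%:R < (N * K)%:R + 1 :> R.
      by apply: lt_le_trans c2 _; rewrite natrM lerD2r ler_wpM2l.
    by rewrite natr1 ltr_nat ltnS.
  have -> : layer N y = N%:R^-1 * c%:R.
    rewrite /layer -mulr_sumr; congr (_ * _).
    transitivity ((\sum_(k < N * K) (k < c))%N%:R : R).
      rewrite natr_sum; apply: eq_bigr => k _; rewrite indicE; congr (_%:R).
      congr nat_of_bool; apply/idP/idP => [/set_mem|kc].
        by rewrite /A/= ltr_pdivrMr// mulrC -(ltr_nat R) => h; exact: lt_le_trans c1.
      apply/mem_set; rewrite /A/= ltr_pdivrMr// mulrC.
      have : k.+1%:R <= c%:R :> R by rewrite ler_nat.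
      by rewrite -natr1; lra.
    congr (_%:R); rewrite -(subnKC cN) big_split_ord/=.
    rewrite (eq_bigr (fun=> 1%N)); last by move=> i _; rewrite ltn_ord.
    rewrite sum1_card card_ord big1 ?addn0// => i _.
    by rewrite ltnNge leq_addr.
  rewrite -(ler_pM2l N0') mulrA mulfV ?gt_eqF// mul1r c1/=.
  rewrite -(ler_pM2l N0') mulrA mulfV ?gt_eqF// mul1r mulrDr mulrA mulfV ?gt_eqF// mul1r.
  rewrite indicE; case: (boolP (y \in A 0%R)) => [_|/negP yA]; first exact: ltW.
  have phiy : phi y = 0.
    apply/eqP; rewrite eq_le phi0 andbT leNgt; apply/negP => h; apply: yA.
    exact: mem_set.
  rewrite phiy mulr0 addr0 /c phiy /nceil mulr0.
  by rewrite (_ : Num.ceil 0 = 0)//; exact/eqP/ceil0.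
have vlayer N : vanishing e (layer N).
  split => // y ye; rewrite /layer big1// => k _.
  by rewrite (vA _ _).2 ?mulr0// divr_ge0.
have FL N : (\int[F]_y (layer N y)%:E = \int[P]_w (Jx (layer N) 1 w)%:E)%E.
  have vk k : vanishing e (fun y => N%:R^-1 * \1_(A (k%:R / N%:R)) y : R).
    by split => // y ye; rewrite (vA _ _).2 ?mulr0// divr_ge0.
  under eq_integral do rewrite /layer -sumEFin.
  rewrite ge0_integral_sum; [|exact: measurableT| |]; last 2 first.
  - by move=> k; apply/measurable_EFinP/measurable_funM; [exact: measurable_cst|exact: measurable_indic].
  - by move=> k y _; rewrite lee_fin mulr_ge0// ?invr_ge0// indicE.
  under [RHS]eq_integral do rewrite (good_jump_sum_ord_sum _ _ _ e0 vk) -sumEFin.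
  rewrite [RHS]ge0_integral_sum; [|exact: measurableT| |]; last 2 first.
  - move=> k; apply/measurable_EFinP.
    have -> : Jx (fun y => N%:R^-1 * \1_(A (k%:R / N%:R)) y) 1 =
        (fun w => N%:R^-1 * Jx \1_(A (k%:R / N%:R)) 1 w).
      apply/funext => w; rewrite /good_jump_sum; case: ifP => _; last by rewrite mulr0.
      by rewrite jump_sumZ.
    by apply: measurable_funM; [exact: measurable_cst|apply: mJA; rewrite divr_ge0].
  - by move=> k w _; rewrite lee_fin good_jump_sum_ge0// => y; rewrite mulr_ge0 ?invr_ge0.
  apply: eq_bigr => k _.
  have k0 : 0 <= k%:R / N%:R :> R by rewrite divr_ge0.
  rewrite ge0_integral_scale; [|exact: measurable_indic|by rewrite invr_ge0|by move=> y; rewrite indicE].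
  rewrite integral_indic// setIT (@levy_measure_count e)//; last exact: eA.
  rewrite -ge0_integral_scale; [|exact: mJA|by rewrite invr_ge0|by move=> w; exact: good_jump_sum_ge0].
  apply: eq_integral => w _; congr EFin.
  rewrite /good_jump_sum; case: ifP => _; last by rewrite mulr0.
  by rewrite jump_sumZ.
have mphi := continuous_measurable_fun cphi.
(* On either side the error of the layering is at most [F (A 0) / N]. *)
have small (eta : R) : 0 < eta -> exists2 N, (0 < N)%N & (N%:R^-1%:E * F (A 0%R) <= eta%:E)%E.
  move=> eta0; have Ff : F (A 0%R) \is a fin_num by rewrite ge0_fin_numE.
  have f0 : 0 <= fine (F (A 0%R)) by rewrite fine_ge0.
  have h : 0 < eta / (fine (F (A 0%R)) + 1) by rewrite divr_gt0// ltr_wpDl.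
  have [N hN] := inv_nat_lt h; have [_ N1] := hN N.+1 (leqnSn N).
  exists N.+1 => //; rewrite -(fineK Ff) -EFinM lee_fin.
  move: N1; rewrite ltr_pdivlMr ?ltr_wpDl// => N1.
  have n0 : 0 < N.+1%:R^-1 :> R by rewrite invr_gt0.
  by apply: le_trans (ltW N1); rewrite ler_pM2l// lerDl.
apply/eqP; rewrite eq_le; apply/andP; split.
- apply/lee_addgt0Pr => eta /small[N N0 hN].
  apply: (@le_trans _ _ (\int[F]_y (layer N y)%:E)%E).
    apply: le_integral_nonmeasurable => y; rewrite lee_fin ?phi0//.
    by have /andP[] := layerP N y N0.
  rewrite FL; apply: (@le_trans _ _ (\int[P]_w ((Jx phi 1 w)%:E + N%:R^-1%:E * (Jx \1_(A 0%R) 1 w)%:E))%E).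
    apply: le_integral_nonmeasurable => w; rewrite ?lee_fin.
      apply: good_jump_sum_ge0 => y; have /andP[h _] := layerP N y N0; exact: le_trans h.
    rewrite /good_jump_sum.
    case: ifPn => [/set_mem Gw|_]; last by rewrite mulr0 addr0.
    have [_ cw] := goodG Gw.
    have v1 : vanishing e (fun y => N%:R^-1 * \1_(A 0%R) y : R).
      by split => // y ye; rewrite (vA 0 _).2 ?mulr0.
    rewrite -jump_sumZ -(@jump_sumD _ _ cw e)//; apply: (@jump_sum_le _ _ cw e) => //.
      by split => // y ye; rewrite /= v1.2// ve// addr0.
    by move=> y /=; have /andP[] := layerP N y N0.
  rewrite ge0_integralD//; last 4 first.
  - by move=> w _; rewrite lee_fin good_jump_sum_ge0.
  - by apply/measurable_EFinP; exact: (measurable_good_jump_sum levyX mG goodG cphi vphi).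
  - by move=> w _; rewrite -EFinM lee_fin mulr_ge0 ?invr_ge0 ?good_jump_sum_ge0.
  - by apply: measurable_funeM; apply/measurable_EFinP; exact: mJA.
  rewrite leeD2l//; under eq_integral do rewrite -EFinM.
  rewrite ge0_integral_scale; [|exact: mJA|by rewrite invr_ge0|by move=> w; exact: good_jump_sum_ge0].
  by rewrite PJ0.
- apply/lee_addgt0Pr => eta /small[N N0 hN].
  apply: (@le_trans _ _ (\int[P]_w (Jx (layer N) 1 w)%:E)%E).
    apply: le_integral_nonmeasurable => w; rewrite lee_fin ?good_jump_sum_ge0//.
    by apply: (@good_jump_sum_le e) => // y; have /andP[] := layerP N y N0.
  rewrite -FL; apply: (@le_trans _ _ (\int[F]_y ((phi y)%:E + N%:R^-1%:E * (\1_(A 0%R) y)%:E))%E).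
    apply: le_integral_nonmeasurable => y; rewrite ?lee_fin.
      by have /andP[h _] := layerP N y N0; exact: le_trans h.
    by have /andP[] := layerP N y N0.
  rewrite ge0_integralD//.
  2: by move=> y _; rewrite lee_fin.
  2: exact/measurable_EFinP.
  2: by apply: measurable_funeM; apply/measurable_EFinP; exact: measurable_indic.
  rewrite leeD2l//; under eq_integral do rewrite -EFinM.
  rewrite ge0_integral_scale; [|exact: measurable_indic|by rewrite invr_ge0|by move=> y; rewrite indicE].
  by rewrite integral_indic// setIT.
Qed.

End levy_measure_integrals.

Lemma cvg_sqr (R : realType) (u : nat -> R) (l : R) :
  u n @[n --> \oo] --> l -> u n ^+ 2 @[n --> \oo] --> l ^+ 2.
Proof.
by move=> ul; apply: (@cvg_comp _ _ _ u (fun z : R => z ^+ 2) _ _ _ ul); exact: exprn_continuous.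
Qed.

Section levy_measure.
Context (R : realType) d (Omega : measurableType d) (P : probability Omega R).
Variable X : R -> Omega -> R.
Variable F : {measure set R -> \bar R}.
Hypothesis levyF : is_levy_measure P X F.
Implicit Types phi : R -> R.

Definition levy_int phi : R := \int[F]_y phi y.

Lemma levy_integrable phi C : measurable_fun setT phi ->
  (forall y, `|phi y| <= C * Num.min 1 (y ^+ 2)) -> F.-integrable setT (EFin \o phi).
Proof.
move=> mphi hC; case: levyF => _ F1 _.
have m0 (y : R) : 0 <= Num.min 1 (y ^+ 2) by rewrite le_min ler01 sqr_ge0.
have mm : measurable_fun setT (fun y : R => Num.min 1 (y ^+ 2)).
  by apply: measurable_minr; [exact: measurable_cst|exact: measurable_funX].
apply: (@le_integrable _ _ _ F setT measurableT _ (fun y : R => C%:E * (Num.min 1 (y ^+ 2))%:E)%E).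
- exact/measurable_EFinP.
- move=> y _; rewrite /= lee_fin; apply: le_trans (hC y) _.
  exact: ler_norm.
- apply: integrableZl => //; apply/integrableP; split; first exact/measurable_EFinP.
  apply: le_lt_trans F1; rewrite le_eqVlt; apply/orP; left; apply/eqP.
  by apply: eq_integral => y _; rewrite /= ger0_norm.
Qed.

Lemma levy_dominated (phi_ : nat -> R -> R) phi C :
  (forall k, measurable_fun setT (phi_ k)) -> measurable_fun setT phi ->
  (forall k y, `|phi_ k y| <= C * Num.min 1 (y ^+ 2)) ->
  (forall y, phi_ k y @[k --> \oo] --> phi y) ->
  levy_int (phi_ k) @[k --> \oo] --> levy_int phi.
Proof.
move=> m_ m b c; have bphi y : `|phi y| <= C * Num.min 1 (y ^+ 2).
  have cn : `|phi_ k y| @[k --> \oo] --> `|phi y| by apply: cvg_norm; exact: c.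
  rewrite -(cvg_lim _ cn)//; apply: limr_le; first by apply/cvg_ex; eexists; exact: cn.
  by apply: nearW => k; exact: b.
have m0 (y : R) : 0 <= Num.min 1 (y ^+ 2) by rewrite le_min ler01 sqr_ge0.
have C0 (y : R) : 0 <= C * Num.min 1 (y ^+ 2) by exact: le_trans (b 0%N y).
have mm : measurable_fun setT (fun y : R => C * Num.min 1 (y ^+ 2)).
  apply: measurable_funM; first exact: measurable_cst.
  by apply: measurable_minr; [exact: measurable_cst|exact: measurable_funX].
have := @dominated_convergence _ _ _ F setT measurableT (fun k => EFin \o phi_ k)
  (EFin \o phi) (EFin \o (fun y => C * Num.min 1 (y ^+ 2))).
case.
- by move=> k; exact/measurable_EFinP.
- exact/measurable_EFinP.
- by apply: aeW => y _; apply: cvg_EFin; [exact: nearW|exact: c].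
- by apply: (@levy_integrable _ C) => // y; rewrite ger0_norm.
- by apply: aeW => y k _; rewrite lee_fin.
move=> _ _ h; rewrite /levy_int /Rintegral; apply: fine_cvg; rewrite fineK//.
by apply: integrable_fin_num => //; exact: levy_integrable bphi.
Qed.

Lemma min_sqr_gt0 (e : R) : 0 < e -> 0 < Num.min 1 (e ^+ 2).
Proof. by move=> e0; rewrite lt_min ltr01 exprn_gt0. Qed.

Lemma vanishing_min_sqr phi M e : vanishing e phi -> (forall y, `|phi y| <= M) ->
  forall y, `|phi y| <= M / Num.min 1 (e ^+ 2) * Num.min 1 (y ^+ 2).
Proof.
move=> [e0 ve] hM y; have m0 := min_sqr_gt0 e0.
have M0 : 0 <= M by exact: le_trans (hM 0).
have m1 : 0 <= Num.min 1 (y ^+ 2) by rewrite le_min ler01 sqr_ge0.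
have [ye|ey] := leP `|y| e.
  by rewrite ve// normr0 mulr_ge0// divr_ge0// ltW.
rewrite mulrAC -mulrA; apply: (le_trans (hM y)); rewrite ler_peMr// ler_pdivlMr// mul1r.
rewrite le_min !ge_min lexx/= -(real_normK (num_real y)).
by rewrite lerXn2r ?orbT// ?nnegrE// ltW.
Qed.

Lemma test_fun_integrable phi : test_fun phi -> F.-integrable setT (EFin \o phi).
Proof.
move=> tphi; have [_ [e ve] [M hM]] := tphi.
apply: levy_integrable (vanishing_min_sqr ve hM); exact: test_fun_measurable.
Qed.

Lemma test_fun_norm phi : test_fun phi -> test_fun (fun y => `|phi y|).
Proof.
move=> [c [e [e0 v]] [M hM]]; split.
- by move=> y; apply: cvg_norm; exact: c.
- by exists e; split => // y ye; rewrite v// normr0.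
- by exists M => y; rewrite normr_id.
Qed.

Lemma test_funD phi psi : test_fun phi -> test_fun psi -> test_fun (fun y => phi y + psi y).
Proof.
move=> [c [e [e0 v]] [M hM]] [c' [e' [e0' v']] [M' hM']]; split.
- by move=> y; apply: cvgD; [exact: c|exact: c'].
- exists (Num.min e e'); split; first by rewrite lt_min e0.
  by move=> y; rewrite le_min => /andP[h1 h2]; rewrite v// v'// addr0.
- by exists (M + M') => y; rewrite (le_trans (ler_normD _ _))// lerD.
Qed.

End levy_measure.

Section levy_rates.
Context (R : realType) d (Omega : measurableType d) (P : probability Omega R).
Variable X : R -> Omega -> R.
Hypothesis levyX : is_levy_process P X.
Variable G : set Omega.
Hypotheses (mG : measurable G) (PG : P (~` G) = 0%E).
Hypothesis goodG : forall w, G w -> X 0 w = 0 /\ cadlag0 (X^~ w).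
Variable F : {measure set R -> \bar R}.
Hypothesis levyF : is_levy_measure P X F.
Local Notation D := (grid_inc X).
Local Notation Jx := (good_jump_sum X G).
Local Notation IF := (levy_int F).
Implicit Types phi : R -> R.

Let ge0_rate_integral phi : test_fun phi -> (forall y, 0 <= phi y) ->
  N%:R * Ex P (phi \o D N 0) @[N --> \oo] --> IF phi.
Proof.
move=> tphi phi0; have [I [IE aI]] := rate_cvg levyX mG PG goodG tphi phi0.
suff -> : IF phi = I by [].
by rewrite /levy_int /Rintegral (levy_measure_integral levyX mG PG goodG levyF)// IE.
Qed.

(** Linearity: [phi] is the difference of [phi + |phi|] and [|phi|], two nonnegative test
    functions. *)
Lemma rate_integral phi : test_fun phi ->
  N%:R * Ex P (phi \o D N 0) @[N --> \oo] --> IF phi.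
Proof.
move=> tphi; have tn := test_fun_norm tphi; have td := test_funD tphi tn.
have bD psi N : test_fun psi -> brv (psi \o D N 0).
  move=> tp; apply: brv_comp; [exact: test_fun_measurable|by case: tp|exact: (measurable_grid_inc levyX)].
have := cvgB (ge0_rate_integral td _) (ge0_rate_integral tn _).
move=> /(_ _ ltac:(by move=> y; have := ler_norm (- phi y); rewrite normrN; lra)).
move=> /(_ ltac:(by move=> y)).
have -> : IF (fun y => phi y + `|phi y|) - IF (fun y => `|phi y|) = IF phi.
  rewrite /levy_int RintegralD//; first by rewrite addrK.
    exact: (test_fun_integrable levyF).
  exact: (test_fun_integrable levyF).
apply: cvg_trans; apply: near_eq_cvg; apply: nearW => N.
rewrite -[LHS]/(_ - _) -mulrBr; congr (_ * _); rewrite -ExB; [|exact: bD|exact: bD].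
by congr Ex; apply/funext => w /=; rewrite addrK.
Qed.

Lemma rate_integral_sub phi n : test_fun phi -> (0 < n)%N ->
  m%:R * Ex P (phi \o D (n * m) 0) @[m --> \oo] --> n%:R^-1 * IF phi.
Proof.
move=> tphi n0; have nn0 : n%:R != 0 :> R by rewrite pnatr_eq0 -lt0n.
have := rate_integral tphi => /cvgrPdist_le h; apply/cvgrPdist_le => e e0.
have [N _ hN] := h _ e0; exists N => // m /= Nm.
have := hN (n * m)%N (leq_trans Nm (leq_pmull _ n0)).
rewrite /= natrM => h1.
have -> : m%:R * Ex P (phi \o D (n * m) 0) = n%:R^-1 * (n%:R * m%:R * Ex P (phi \o D (n * m) 0)).
  by rewrite !mulrA mulVf// mul1r.
rewrite -mulrBr normrM ger0_norm ?invr_ge0//; apply: le_trans h1.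
by rewrite ler_piMl// invf_le1 ?ltr0n// ler1n.
Qed.

Lemma mean_good_jump_sum_le phi n : test_fun phi -> (forall y, 0 <= phi y) -> (0 < n)%N ->
  (\int[P]_w (Jx phi n%:R^-1 w)%:E <= (n%:R^-1 * IF phi)%:E)%E.
Proof.
move=> tphi phi0 n0; have mphi := test_fun_measurable tphi.
have bD m j : brv (phi \o D (n * m) j).
  apply: brv_comp => //; [by case: tphi|exact: (measurable_grid_inc levyX)].
apply: (@fatou_le _ _ _ P G (fun m w => \sum_(j < m) phi (D (n * m) j w)) _
    (fun m => m%:R * Ex P (phi \o D (n * m) 0))) => //.
- by move=> m; case: (brv_sum m (bD m)).
- by move=> m w; exact: sumr_ge0.
- by move=> w; exact: good_jump_sum_ge0.
- by move=> w Gw; exact: (increments_cvg_good_jump_sum goodG).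
- move=> m; rewrite ExE; last exact: (brv_sum m (bD m)).
  rewrite lee_fin (Ex_sum P m (bD m)) -[m in m%:R]card_ord -sum1_card natr_sum mulr_suml ler_sum// => j _.
  by rewrite mul1r (Ex_grid_inc levyX (n * m) j mphi)//; case: tphi.
- exact: rate_integral_sub.
Qed.

(** Fatou's lemma applied to the variances of the sums of increments over the meshes [1 / (n m)]. It
    yields the inequality half of the L2 isometry of compensated sums without a Poisson structure of
    the jumps. *)
Lemma variance_good_jump_sum phi n : test_fun phi -> (0 < n)%N ->
  (\int[P]_w ((Jx phi n%:R^-1 w - n%:R^-1 * IF phi) ^+ 2)%:E <=
    (n%:R^-1 * IF (fun y => phi y ^+ 2))%:E)%E.
Proof.
move=> tphi n0; have mphi := test_fun_measurable tphi.
have ph2 := test_funX tphi.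
have bD m j : brv (phi \o D (n * m) j).
  apply: brv_comp => //; [by case: tphi|exact: (measurable_grid_inc levyX)].
apply: (@fatou_le _ _ _ P G (fun m w => (\sum_(j < m) phi (D (n * m) j w) -
    m%:R * Ex P (phi \o D (n * m) 0)) ^+ 2) _
    (fun m => m%:R * Ex P (fun w => phi (D (n * m) 0 w) ^+ 2))) => //.
- move=> m; case: (@brvX _ _ _ (fun w => (\sum_(j < m) phi (D (n * m) j w) -
    m%:R * Ex P (phi \o D (n * m) 0)))) => //.
  by apply: brvB; [exact: (brv_sum m (bD m))|exact: brv_cst].
- by move=> m w; exact: sqr_ge0.
- by move=> w; exact: sqr_ge0.
- move=> w Gw; apply: cvg_sqr.
  by apply: cvgB; [exact: (increments_cvg_good_jump_sum goodG tphi Gw n0)|exact: rate_integral_sub].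
- move=> m; rewrite ExE; last first.
    by apply: brvX; apply: brvB; [exact: (brv_sum m (bD m))|exact: brv_cst].
  by rewrite lee_fin; apply: (Ex_sqr_increments levyX m (n * m) mphi); case: tphi.
- exact: (rate_integral_sub ph2 n0).
Qed.

End levy_rates.

(** * The remainder after removing the Brownian part and the large jumps *)

Section small_part.
Context (R : realType).
Implicit Types (i : nat) (y : R).

Definition small_part i y : R := y * (1 - cut i y).

Lemma small_part_eq0 i y : 2 / i.+1%:R <= `|y| -> small_part i y = 0.
Proof. by move=> h; rewrite /small_part cut_eq1// subrr mulr0. Qed.

Lemma norm_small_part_le i y : `|small_part i y| <= `|y|.
Proof.
rewrite normrM ler_piMr// ger0_norm ?subr_ge0 ?cut_le1//.
by rewrite lerBlDr lerDl cut_ge0.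
Qed.

Lemma small_part_bound i y : `|small_part i y| <= 2 / i.+1%:R.
Proof.
have [h|h] := leP (2 / i.+1%:R) `|y|; first by rewrite small_part_eq0// normr0 divr_ge0.
exact: le_trans (norm_small_part_le i y) (ltW h).
Qed.

Lemma small_part_sqr_le i y : small_part i y ^+ 2 <= 4 * Num.min 1 (y ^+ 2).
Proof.
have h1 := norm_small_part_le i y.
have h2 : `|small_part i y| <= 2.
  apply: le_trans (small_part_bound i y) _.
  by rewrite ler_piMr// invf_le1 ?ltr0n// ler1n.
rewrite -(real_normK (num_real (small_part i y))) -(real_normK (num_real y)).
have := normr_ge0 (small_part i y).
by rewrite minEle; case: ifP => _ h0; nra.
Qed.

Lemma continuous_small_part i : continuous (@small_part i).
Proof.
move=> y; apply: cvgM; first exact: cvg_id.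
by apply: cvgB; [exact: cvg_cst|exact: continuous_cut].
Qed.

Lemma measurable_small_part i : measurable_fun setT (small_part i).
Proof. exact: continuous_measurable_fun (@continuous_small_part i). Qed.

Lemma small_part_cvg0 y : small_part i y @[i --> \oo] --> (0 : R).
Proof.
have [->|y0] := eqVneq y 0.
  by apply: cvg_near_cst; apply: nearW => i; rewrite /small_part mul0r.
apply: cvg_near_cst; have := cut_cvg y0; apply: filterS => i.
by rewrite /small_part => ->; rewrite subrr mulr0.
Qed.

End small_part.

Lemma le_integral_on d (T : measurableType d) (R : realType) (mu : {measure set T -> \bar R})
    (G : set T) (f g : T -> R) : measurable G -> mu (~` G) = 0%E ->
  (forall w, 0 <= f w) -> (forall w, 0 <= g w) -> (forall w, G w -> f w <= g w) ->
  (\int[mu]_w (f w)%:E <= \int[mu]_w (g w)%:E)%E.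
Proof.
move=> mG G0 f0 g0 fg.
rewrite (integral_conegligible mG G0); last by move=> w; rewrite lee_fin.
rewrite integral_mkcond; apply: le_integral_nonmeasurable => w; rewrite patchE.
  by case: ifPn => // _; rewrite lee_fin.
by case: ifPn => [/set_mem Gw|_]; rewrite lee_fin// fg.
Qed.

Section remainder.
Context (R : realType) d (Omega : measurableType d) (P : probability Omega R).
Variables (mu sigma : R) (X B M : R -> Omega -> R).
Hypothesis levyX : is_levy_process P X.
Hypothesis brownianB : is_brownian_motion P B.
Variable G : set Omega.
Hypotheses (mG : measurable G) (PG : P (~` G) = 0%E).
Hypothesis goodG : forall w, G w -> X 0 w = 0 /\ cadlag0 (X^~ w).
Variable F : {measure set R -> \bar R}.
Hypothesis levyF : is_levy_measure P X F.
Hypothesis smallM : is_small_jump_integral P X F M.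
Hypothesis decG : forall w, G w -> forall t, 0 <= t ->
  X t w = mu * t + sigma * B t w + M t w + large_jump_sum X t w.
Local Notation D := (grid_inc X).
Local Notation Jx := (good_jump_sum X G).
Local Notation IF := (levy_int F).
Implicit Types (phi : R -> R) (i n : nat) (e : R).

Definition small_var i : R := IF (fun y => small_part i y ^+ 2).

Lemma small_part_sqr_integrable i : F.-integrable setT (EFin \o (fun y => small_part i y ^+ 2)).
Proof.
apply: (levy_integrable levyF (C := 4)).
  by apply: measurable_funX; exact: measurable_small_part.
by move=> y; rewrite ger0_norm ?sqr_ge0// small_part_sqr_le.
Qed.

Lemma small_var_ge0 i : 0 <= small_var i.
Proof. by apply: Rintegral_ge0 => y _; exact: sqr_ge0. Qed.

Lemma small_var_cvg0 : small_var i @[i --> \oo] --> 0.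
Proof.
have -> : 0 = IF (fun=> 0) by rewrite /levy_int /Rintegral integral0.
apply: (levy_dominated levyF (C := 4)).
- by move=> k; apply: measurable_funX; exact: measurable_small_part.
- exact: measurable_cst.
- by move=> k y; rewrite ger0_norm ?sqr_ge0// small_part_sqr_le.
- by move=> y; have := cvg_sqr (small_part_cvg0 y); rewrite expr0n.
Qed.

Definition outer e : set R := [set y | e < `|y|].

Lemma measurable_outer e : measurable (outer e).
Proof.
have -> : outer e = [set y | e < Num.norm y] by [].
exact: (@continuous_gt_measurable R (fun y : R => `|y|) e (@norm_continuous _ _)).
Qed.

Lemma ramp_cvg e y : ramp e k%:R y @[k --> \oo] --> (\1_(outer e) y : R).
Proof. exact: (@above_cvg R (fun y => `|y|) e y). Qed.

Lemma vanishing_outer e phi : 0 < e -> vanishing e (phi \_ (outer e)).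
Proof.
move=> e0; split=> // y ye; rewrite patchE memNset//.
by rewrite /outer /=; apply/negP; rewrite -leNgt.
Qed.

Lemma patch_outerE e phi y : (phi \_ (outer e)) y = phi y * \1_(outer e) y.
Proof. by rewrite patchE indicE; case: ifP; rewrite ?mulr1 ?mulr0. Qed.

Lemma vanishing_mul_ramp e phi k : 0 < e -> vanishing e (fun y => phi y * ramp e k y).
Proof. by move=> e0; split=> // y ye; rewrite ramp_eq0// mulr0. Qed.

Lemma outer_cvg e phi y : phi y * ramp e k%:R y @[k --> \oo] --> (phi \_ (outer e)) y.
Proof. by rewrite patch_outerE; apply: cvgM; [exact: cvg_cst|exact: ramp_cvg]. Qed.

Lemma measurable_good_jump_sum_outer e phi t : 0 < e -> continuous phi -> 0 <= t ->
  measurable_fun setT (Jx (phi \_ (outer e)) t).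
Proof.
move=> e0 cphi t0.
apply: (@measurable_good_jump_sum_lim _ _ _ _ _ levyX G mG goodG e (fun k y => phi y * ramp e k%:R y)) => //.
- by move=> k y; apply: cvgM; [exact: cphi|exact: continuous_ramp].
- by move=> k; exact: vanishing_mul_ramp.
- exact: vanishing_outer.
- by move=> y; exact: outer_cvg.
Qed.

(** [M] is defined through the sharp truncation at [e], so the indicator of [|y| > e] is approached
    by ramps, to which the variance bound applies. The bound obtained does not depend on [e]. *)
Lemma variance_small_part i e n : 0 < e -> (0 < n)%N ->
  (\int[P]_w ((Jx (small_part i \_ (outer e)) n%:R^-1 w -
      n%:R^-1 * IF (small_part i \_ (outer e))) ^+ 2)%:E <= (n%:R^-1 * small_var i)%:E)%E.
Proof.
move=> e0 n0; pose psi k y := small_part i y * ramp e k%:R y.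
have rk k y : `|ramp e k%:R y| <= 1 :> R by rewrite ger0_norm ?ramp_le1 ?ramp_ge0.
have bpsi k y : `|psi k y| <= 2 / i.+1%:R.
  by rewrite normrM -[leRHS]mulr1; apply: ler_pM => //; exact: small_part_bound.
have vpsi k : vanishing e (psi k) by exact: vanishing_mul_ramp.
have tpsi k : test_fun (psi k).
  split; [|by exists e|by exists (2 / i.+1%:R)].
  by move=> y; apply: cvgM; [exact: continuous_small_part|exact: continuous_ramp].
have mpsi k := test_fun_measurable (tpsi k).
have mo : measurable_fun setT (small_part i \_ (outer e)).
  by apply: (@measurable_fun_cvg _ _ _ _ psi) => // y _; exact: outer_cvg.
apply: (@fatou_le _ _ _ P G (fun k w => (Jx (psi k) n%:R^-1 w - n%:R^-1 * IF (psi k)) ^+ 2) _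
   (fun=> n%:R^-1 * small_var i)) => //.
- move=> k; apply: measurable_funX; apply: measurable_funB => //.
  by case: (tpsi k) => c _ _; apply: (measurable_good_jump_sum levyX mG goodG c (vpsi k)); rewrite invr_ge0.
- by move=> k w; exact: sqr_ge0.
- by move=> w; exact: sqr_ge0.
- move=> w Gw; apply: cvg_sqr; apply: cvgB.
    by apply: (good_jump_sum_cvg goodG vpsi); [exact: vanishing_outer|move=> y; exact: outer_cvg].
  apply: cvgM; first exact: cvg_cst.
  apply: (levy_dominated levyF (C := 2 / i.+1%:R / Num.min 1 (e ^+ 2))) => //.
    by move=> k y; exact: (vanishing_min_sqr (vpsi k) (bpsi k)).
  by move=> y; exact: outer_cvg.
- move=> k; apply: (le_trans (variance_good_jump_sum levyX mG PG goodG levyF (tpsi k) n0)).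
  rewrite lee_fin ler_wpM2l ?invr_ge0//; apply: le_Rintegral => //.
  + exact: (test_fun_integrable levyF (test_funX (tpsi k))).
  + exact: small_part_sqr_integrable.
  + move=> y _; rewrite /psi exprMn ler_piMr ?sqr_ge0// expr_le1 ?ramp_ge0//.
    exact: ramp_le1.
- exact: cvg_cst.
Qed.

(** The large jumps are removed by the smooth [cut i] without compensation, whereas [M] compensates
    all jumps of size at most 1; the integral is the compensator of what is removed in that
    range. *)
Definition drift i : R := mu - IF ((fun y => y * cut i y) \_ [set y | `|y| <= 1]).

Definition big_part i n w : R := Jx (fun y => y * cut i y) n%:R^-1 w.

Definition remainder i n w : R := X n%:R^-1 w - sigma * B n%:R^-1 w - big_part i n w.

Lemma measurable_big_part i n : measurable_fun setT (big_part i n).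
Proof.
apply: (measurable_good_jump_sum levyX mG goodG _ (vanishing_mul_cut id i)); last by rewrite invr_ge0.
by move=> y; apply: cvgM; [exact: cvg_id|exact: continuous_cut].
Qed.

Lemma measurable_remainder i n : measurable_fun setT (remainder i n).
Proof.
apply: measurable_funB; last exact: measurable_big_part.
have n0 : 0 <= n%:R^-1 :> R by rewrite invr_ge0.
case: levyX => mX _ _ _ _; case: brownianB => mB _ _ _ _.
by apply: measurable_funB; [exact: mX|apply: measurable_funM => //; exact: mB].
Qed.

Let band e : set R := [set y | e < `|y| <= 1].

Let mband e : measurable (band e).
Proof.
have -> : band e = outer e `\` outer 1.
  apply/seteqP; split => y; rewrite /band /outer /=.
    by move=> /andP[-> h]; split => //; apply/negP; rewrite -leNgt.
  by move=> [-> /negP]; rewrite -leNgt => ->.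
by apply: measurableD; exact: measurable_outer.
Qed.

Let bandE e y : e <= 1 -> ((fun y => y) \_ (band e)) y =
  ((fun y => y) \_ (outer e)) y - ((fun y => y) \_ (outer 1)) y.
Proof.
move=> e1; rewrite !patchE /band /outer; case: ifPn => [/set_mem/= /andP[ey y1]|/negP h].
  by rewrite mem_set// memNset ?subr0//=; apply/negP; rewrite -leNgt.
case: ifPn => [/set_mem/= y1|/negP h1]; case: ifPn => [/set_mem/= y2|/negP h2]; rewrite ?subrr ?subr0 ?sub0r//.
  by exfalso; apply: h; apply: mem_set => /=; rewrite y1 leNgt; apply/negP => h3; apply: h2; exact: mem_set.
by exfalso; apply: h1; apply: mem_set => /=; exact: le_lt_trans e1 y2.
Qed.

(** A measurable version of [compensated_jumps], equal to it on [G]. *)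
Let comp_jumps e t w : R := Jx ((fun y => y) \_ (band e)) t w - t * \int[F]_(y in band e) y.

Let comp_jumpsE e t w : 0 < e -> G w -> compensated_jumps X F e t w = comp_jumps e t w.
Proof.
move=> e0 Gw; have [_ cw] := goodG Gw; rewrite /comp_jumps good_jump_sumE//.
rewrite -(@Rintegral_jump_measure _ _ cw e)//.
by move=> y ye; rewrite /band /= => /andP[]; rewrite ltNge ye.
Qed.

Let measurable_comp_jumps e t : 0 < e -> e <= 1 -> 0 <= t -> measurable_fun setT (comp_jumps e t).
Proof.
move=> e0 e1 t0; apply: measurable_funB => //.
have -> : Jx ((fun y => y) \_ (band e)) t =
    fun w => Jx ((fun y => y) \_ (outer e)) t w - Jx ((fun y => y) \_ (outer 1)) t w.
  apply/funext => w; rewrite /good_jump_sum; case: ifPn => [/set_mem Gw|_]; last by rewrite subr0.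
  have [_ cw] := goodG Gw; rewrite -(@jump_sumBf _ _ cw e).
  - by congr jump_sum; apply/funext => y; exact: bandE.
  - exact: vanishing_outer.
  - by apply: vanishing_le (@vanishing_outer 1 _ ltr01).
by apply: measurable_funB; apply: measurable_good_jump_sum_outer => // y; exact: cvg_id.
Qed.

(** Since [i > 0], [small_part i] vanishes beyond 1, and since [e <= 1 / (i + 1)], [cut i] vanishes
    up to [e]: the two integrands add up to [y] on the band and are 0 off it. *)
Let band_integral i e : (0 < i)%N -> 0 < e -> e <= i.+1%:R^-1 ->
  \int[F]_(y in band e) y = IF (small_part i \_ (outer e)) +
    IF ((fun y => y * cut i y) \_ [set y | `|y| <= 1]).
Proof.
move=> i0 e0 ei; have in0 : 0 < i.+1%:R^-1 :> R by rewrite invr_gt0.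
have i1 : 2 / i.+1%:R <= 1 :> R by rewrite ler_pdivrMr// mul1r ler_nat.
have E y : ((fun y => y) \_ (band e)) y = (small_part i \_ (outer e)) y +
    ((fun y => y * cut i y) \_ [set y | `|y| <= 1]) y.
  rewrite !patchE /band /outer /=; have [y1|y1] := leP `|y| 1; last first.
    rewrite (memNset (A := [set y | e < `|y| <= 1])) ?(memNset (A := [set y | `|y| <= 1])) ?addr0/=.
    - by case: ifP => // _; rewrite small_part_eq0// (le_trans i1)// ltW.
    - by apply/negP; rewrite -ltNge.
    - by apply/negP; rewrite negb_and -ltNge y1 orbT.
  rewrite (mem_set (A := [set y | `|y| <= 1]))//.
  have [ye|ey] := leP `|y| e.
    rewrite !memNset/=; last 2 first.
    - by apply/negP; rewrite -leNgt.
    - by apply/negP; rewrite negb_and -leNgt ye.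
    by rewrite (vanishing_cut R i).2 ?(le_trans ye)// mulr0 addr0.
  by rewrite !mem_set/= ?ey ?y1// /small_part; ring.
have v1 : vanishing e (small_part i \_ (outer e)) by exact: vanishing_outer.
have v2 : vanishing e ((fun y => y * cut i y) \_ [set y | `|y| <= 1]).
  split=> // y ye; rewrite patchE; case: ifP => // _.
  by rewrite (vanishing_cut R i).2 ?(le_trans ye)// mulr0.
have m1 : measurable_fun setT (small_part i \_ (outer e)).
  apply: (@measurable_fun_cvg _ _ _ _ (fun k y => small_part i y * ramp e k%:R y)).
    move=> k; apply: measurable_funM; first exact: measurable_small_part.
    exact: continuous_measurable_fun (@continuous_ramp R e k%:R).
  by move=> y _; exact: outer_cvg.
have mi : measurable_fun setT (fun y : R => y * cut i y).
  by apply: measurable_funM => //; exact: measurable_cut.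
have m2 : measurable_fun setT ((fun y : R => y * cut i y) \_ [set y | `|y| <= 1]).
  have -> : (fun y : R => y * cut i y) \_ [set y | `|y| <= 1] =
      fun y => y * cut i y - ((fun y => y * cut i y) \_ (outer 1)) y.
    apply/funext => y; rewrite !patchE /outer; have [y1|y1] := leP `|y| 1.
      rewrite mem_set// memNset ?subr0//=; apply/negP; by rewrite -leNgt.
    by rewrite memNset/= ?mem_set/= ?y1 ?subrr//; apply/negP; rewrite -ltNge.
  apply: measurable_funB => //.
  apply: (@measurable_fun_cvg _ _ _ _ (fun k (y : R) => y * cut i y * ramp 1 k%:R y)).
    move=> k; apply: measurable_funM => //.
    exact: continuous_measurable_fun (@continuous_ramp R 1 k%:R).
  by move=> y _; exact: outer_cvg.
rewrite Rintegral_mkcond /levy_int -RintegralD//; last 2 first.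
- apply: (levy_integrable levyF) m1 (vanishing_min_sqr v1 (M := 2 / i.+1%:R) _).
  by move=> y; rewrite patchE; case: ifP => _; [exact: small_part_bound|rewrite normr0].
- apply: (levy_integrable levyF) m2 (vanishing_min_sqr v2 (M := 1) _).
  move=> y; rewrite patchE; case: ifPn => [/set_mem/= y1|_]; last by rewrite normr0.
  by rewrite normrM mulr_ile1// ger0_norm ?cut_ge0 ?cut_le1.
by apply: eq_Rintegral => y _; exact: E.
Qed.

(** An exact identity for each small [e], obtained by adding and subtracting the jumps between [e]
    and 1. The first term is deterministic, the second is bounded in L2 by [variance_small_part],
    and the third is as small in L2 as desired, by the definition of [M]. *)
Let remainderE i e n w : (0 < i)%N -> 0 < e -> e <= i.+1%:R^-1 -> G w ->
  remainder i n w = n%:R^-1 * drift i +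
    (Jx (small_part i \_ (outer e)) n%:R^-1 w - n%:R^-1 * IF (small_part i \_ (outer e))) -
    (comp_jumps e n%:R^-1 w - M n%:R^-1 w).
Proof.
move=> i0 e0 ei Gw; have [_ cw] := goodG Gw.
have n0 : 0 <= n%:R^-1 :> R by rewrite invr_ge0.
have e1 : e <= 1 by rewrite (le_trans ei)// invf_le1// ler1n.
rewrite /remainder (decG Gw n0) /drift /comp_jumps (band_integral i0 e0 ei) /big_part.
rewrite !(good_jump_sumE _ _ _ Gw).
have -> : large_jump_sum X n%:R^-1 w = jump_sum (X^~ w) ((fun y => y) \_ (outer 1)) n%:R^-1.
  by rewrite -(@Rintegral_jump_measure _ _ cw 1)//;
    [exact: measurable_outer|move=> y y1; rewrite /outer /=; apply/negP; rewrite -leNgt].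
have -> : jump_sum (X^~ w) (fun y => y * cut i y) n%:R^-1 =
    jump_sum (X^~ w) ((fun y => y) \_ (outer e)) n%:R^-1 -
    jump_sum (X^~ w) (small_part i \_ (outer e)) n%:R^-1.
  rewrite -(@jump_sumBf _ _ cw e); [|exact: vanishing_outer|exact: vanishing_outer].
  congr jump_sum; apply/funext => y; rewrite !patch_outerE indicE.
  case: (boolP (y \in _)) => [_|/negP h]; first by rewrite !mulr1 /small_part; ring.
  rewrite !mulr0 subr0 (vanishing_cut R i).2 ?mulr0// (le_trans _ ei)// leNgt.
  by apply/negP => h2; apply: h; exact: mem_set.
have -> : jump_sum (X^~ w) ((fun y => y) \_ (band e)) n%:R^-1 =
    jump_sum (X^~ w) ((fun y => y) \_ (outer e)) n%:R^-1 -
    jump_sum (X^~ w) ((fun y => y) \_ (outer 1)) n%:R^-1.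
  rewrite -(@jump_sumBf _ _ cw e); [|exact: vanishing_outer|].
    by congr jump_sum; apply/funext => y; exact: bandE.
  by apply: vanishing_le (@vanishing_outer 1 _ ltr01).
ring.
Qed.

Lemma second_moment_remainder i n : (0 < i)%N -> (0 < n)%N ->
  (\int[P]_w (remainder i n w ^+ 2)%:E <=
    (3 * (n%:R^-1 ^+ 2 * drift i ^+ 2 + n%:R^-1 * small_var i))%:E)%E.
Proof.
move=> i0 n0; set t : R := n%:R^-1.
have t0 : 0 <= t by rewrite invr_ge0.
have [mM cM] := smallM t0.
apply/lee_addgt0Pr => eta eta0.
have [e [e0 ei ee]] : exists e, [/\ 0 < e, e <= i.+1%:R^-1 &
    ('E_P[(fun w => (compensated_jumps X F e t w - M t w) ^+ 2)%R] <= (eta / 3)%:E)%E].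
  have i0' : 0 < i.+1%:R^-1 :> R by rewrite invr_gt0.
  near (0 : R)^'+ => e; exists e; split=> //.
    by near: e; exact: nbhs_right_le.
  near: e; have e3 : 0 < eta / 3 by rewrite divr_gt0.
  have h : \forall e \near 0^'+,
      ('E_P[(fun w => (compensated_jumps X F e t w - M t w) ^+ 2)%R] < (eta / 3)%:E)%E.
    exact: (cM _ (@nbhs_open_ereal_lt R 0 (fun=> eta / 3) e3)).
  by apply: filterS h => e; exact: ltW.
have e1 : e <= 1 by rewrite (le_trans ei)// invf_le1// ler1n.
pose Z w := Jx (small_part i \_ (outer e)) t w - t * IF (small_part i \_ (outer e)).
pose C w := comp_jumps e t w - M t w.
have mZ : measurable_fun setT Z.
  apply: measurable_funB => //; apply: measurable_good_jump_sum_outer => //.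
  exact: continuous_small_part.
have mC : measurable_fun setT C by apply: measurable_funB => //; exact: measurable_comp_jumps.
have hC : (\int[P]_w (C w ^+ 2)%:E <= (eta / 3)%:E)%E.
  apply: le_trans ee; rewrite unlock; apply: (le_integral_on mG PG).
  - by move=> w; exact: sqr_ge0.
  - by move=> w; exact: sqr_ge0.
  - by move=> w Gw; rewrite comp_jumpsE.
have hZ : (\int[P]_w (Z w ^+ 2)%:E <= (t * small_var i)%:E)%E by exact: variance_small_part.
have m2 (f : Omega -> R) : measurable_fun setT f -> measurable_fun setT (fun w => (f w ^+ 2)%:E).
  by move=> mf; apply/measurable_EFinP; exact: measurable_funX.
(* The factor 3 is that of [(a + b + c)^2 <= 3 (a^2 + b^2 + c^2)]; the last term then contributes at
   most [eta]. *)
apply: (@le_trans _ _ (\int[P]_w (3 * (t ^+ 2 * drift i ^+ 2 + Z w ^+ 2 + C w ^+ 2))%:E)%E).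
  apply: (le_integral_on mG PG).
  - by move=> w; exact: sqr_ge0.
  - by move=> w; rewrite mulr_ge0// !addr_ge0 ?sqr_ge0// mulr_ge0 ?sqr_ge0.
  - move=> w Gw; rewrite (remainderE n i0 e0 ei Gw) -/t -/(Z w) -/(C w) -exprMn.
    have := sqr_ge0 (t * drift i - Z w); have := sqr_ge0 (t * drift i + C w).
    by have := sqr_ge0 (Z w + C w); nra.
rewrite ge0_integral_scale//; last 2 first.
- apply: measurable_funD; last exact: measurable_funX.
  by apply: measurable_funD => //; exact: measurable_funX.
- by move=> w; rewrite !addr_ge0 ?sqr_ge0// mulr_ge0 ?sqr_ge0.
have -> : (\int[P]_w (t ^+ 2 * drift i ^+ 2 + Z w ^+ 2 + C w ^+ 2)%:E =
   (t ^+ 2 * drift i ^+ 2)%:E + \int[P]_w (Z w ^+ 2)%:E + \int[P]_w (C w ^+ 2)%:E)%E.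
  under eq_integral do rewrite EFinD EFinD.
  rewrite ge0_integralD//; last 4 first.
  - by move=> w _; rewrite -EFinD lee_fin !addr_ge0 ?sqr_ge0// mulr_ge0 ?sqr_ge0.
  - by apply: emeasurable_funD => //; exact: m2.
  - by move=> w _; rewrite lee_fin sqr_ge0.
  - exact: m2.
  congr (_ + _)%E; rewrite ge0_integralD//; last 3 first.
  - by move=> w _; rewrite lee_fin mulr_ge0 ?sqr_ge0.
  - by move=> w _; rewrite lee_fin sqr_ge0.
  - exact: m2.
  congr (_ + _)%E; have := ExE P (@brv_cst _ Omega R (t ^+ 2 * drift i ^+ 2)).
  by rewrite Ex_cst.
apply: (@le_trans _ _ (3%:E * ((t ^+ 2 * drift i ^+ 2)%:E + (t * small_var i)%:E + (eta / 3)%:E))%E).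
  by apply: lee_wpmul2l; [rewrite lee_fin|apply: leeD => //; exact: leeD].
by rewrite -!EFinD -EFinM lee_fin; lra.
Unshelve. all: by end_near.
Qed.

(** Markov's inequality: [big_part i n] is nonzero only if some jump exceeds [1 / (i + 1)], and then
    the sum of [rho] over the jumps is at least 1. *)
Lemma big_part_prob i : exists K, 0 <= K /\ forall n, (0 < n)%N ->
  (P [set w | (big_part i n w != 0)%R] <= (K / n%:R)%:E)%E.
Proof.
(* [rho] must be 1 from [1 / (i + 1)] on and still vanish near 0, hence a ramp starting at half that
   size. *)
pose a : R := (2 * i.+1%:R)^-1; have a0 : 0 < a by rewrite invr_gt0 mulr_gt0.
pose rho y := ramp a (2 * i.+1%:R) y.
have rho0 y : 0 <= rho y by rewrite ramp_ge0// mulr_ge0.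
have vrho : vanishing a rho by split=> // y; exact: ramp_eq0.
have crho : continuous rho by exact: continuous_ramp.
have trho : test_fun rho.
  by split=> //; [exists a|exists 1 => y; rewrite ger0_norm// ramp_le1].
exists (IF rho); split; first by apply: Rintegral_ge0 => y _; exact: rho0.
move=> n n0; rewrite mulrC; apply: le_trans (mean_good_jump_sum_le levyX mG PG goodG levyF trho rho0 n0).
have mS : measurable [set w | big_part i n w != 0].
  rewrite (_ : [set w | _] = setT `&` big_part i n @^-1` [set~ 0]); last first.
    by rewrite setTI; apply/seteqP; split => w /= /eqP.
  by apply: (measurable_big_part i n) => //; exact: measurableC.
have t0 : 0 <= n%:R^-1 :> R by rewrite invr_ge0.
rewrite -[X in P X]setIT -(integral_indic P measurableT mS).
apply: (@le_integral_on _ _ _ _ G (\1_[set w | big_part i n w != 0]) _ mG PG).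
- by move=> w; rewrite indicE.
- by move=> w; exact: good_jump_sum_ge0.
- move=> w Gw; rewrite indicE; case: (boolP (w \in _)) => [/set_mem/=|_]; last exact: good_jump_sum_ge0.
  have [_ cw] := goodG Gw; rewrite /big_part !good_jump_sumE// => Jn0.
  have [s st js] : exists2 s, 0 < s <= n%:R^-1 & jump (X^~ w) s * cut i (jump (X^~ w) s) != 0.
    apply: contrapT => h; move/eqP: Jn0; apply; apply: jump_sum_eq0 => s st.
    by apply/eqP; apply/negPn/negP => h2; apply: h; exists s.
  have /andP[s0 s1] := st.
  apply: le_trans (jump_sum_ge_term cw vrho rho0 s0 s1).
  rewrite /rho ramp_eq1//.
  rewrite -/a leNgt; apply/negP => jl; move/eqP: js; apply.
  rewrite (vanishing_cut R i).2 ?mulr0//; apply: le_trans (ltW jl) _.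
  by have -> : a = i.+1%:R^-1 / 2; [rewrite /a invfM mulrC|rewrite -splitr].
Qed.

End remainder.

(** * The Brownian part *)

(** The bounds are the Taylor polynomials of order one and two at 0. In terms of [s = sqrt (1 + x)]
    the differences, multiplied by [s], are polynomials with a factor [(s - 1)^2] and
    [(s - 1)^3]. *)
Lemma inv_sqrt_bounds (R : realType) (x : R) : 0 <= x ->
  1 - x / 2 <= (Num.sqrt (1 + x))^-1 <= 1 - x / 2 + 3 / 8 * x ^+ 2.
Proof.
move=> x0; set s := Num.sqrt (1 + x).
have s2 : s ^+ 2 = 1 + x by rewrite sqr_sqrtr// addr_ge0.
have s1 : 1 <= s by rewrite -sqrtr1 ler_wsqrtr// lerDl.
have s0 : 0 < s by exact: lt_le_trans s1.
have xE : x = s ^+ 2 - 1 by rewrite s2; ring.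
have t0 : 0 <= s - 1 by rewrite subr_ge0.
apply/andP; split; rewrite -(ler_pM2r s0) mulVf ?gt_eqF// -subr_ge0 xE.
  rewrite (_ : _ - _ = (s - 1) ^+ 2 * (s + 2) / 2); last by field.
  by rewrite divr_ge0// mulr_ge0 ?sqr_ge0// addr_ge0// ltW.
rewrite (_ : _ - _ = (s - 1) ^+ 3 * (3 * s ^+ 2 + 9 * s + 8) / 8); last by field.
rewrite divr_ge0// mulr_ge0 ?exprn_ge0// !addr_ge0// ?mulr_ge0 ?exprn_ge0// ltW//.
Qed.

Section normal_laplace.
Context (R : realType) (s : R).
Hypothesis s0 : 0 < s.
Local Notation leb := (@lebesgue_measure R).

Lemma integral_normal_prob (f : measurableTypeR R -> \bar R) : measurable_fun setT f ->
  (\int[normal_prob 0 s]_x `|f x| < +oo)%E ->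
  (\int[normal_prob 0 s]_x f x = \int[leb]_x (f x * (normal_pdf 0 s x)%:E))%E.
Proof.
move=> mf finf; have dom := @normal_prob_dominates R 0 s.
have mpdf : measurable_fun [set: measurableTypeR R]
    (fun x : measurableTypeR R => (normal_pdf 0 s x)%:E).
  by apply/measurable_EFinP; exact: measurable_normal_pdf.
rewrite -(Radon_Nikodym_change_of_variables dom)//=; last first.
  by apply/integrableP; split.
apply: ae_eq_integral => //.
- by apply: emeasurable_funM.
- exact: emeasurable_funM.
- apply: ae_eqe_mul2l => /=.
  rewrite Radon_NikodymE//=.
  case: cid => /= h [h1 h2 h3].
  apply: integral_ae_eq => //=.
  + by move=> E E01 mE; rewrite -h3.
Qed.

(** The integrand times the normal density of deviation [s] is [1 / k] times the normal density of
    deviation [s / k]. *)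
Lemma normal_laplace (lam : R) : 0 <= lam ->
  (\int[normal_prob 0 s]_x (expR (- (lam * x ^+ 2)))%:E =
    ((Num.sqrt (1 + 2 * lam * s ^+ 2))^-1)%:E)%E.
Proof.
move=> lam0; set k := Num.sqrt _.
have k20 : 0 < 1 + 2 * lam * s ^+ 2.
  by rewrite ltr_pwDl// mulr_ge0 ?sqr_ge0// mulr_ge0.
have k0 : 0 < k by rewrite sqrtr_gt0.
have k2 : k ^+ 2 = 1 + 2 * lam * s ^+ 2 by rewrite sqr_sqrtr// ltW.
have me : measurable_fun setT (fun x : R => expR (- (lam * x ^+ 2))).
  apply: measurableT_comp => //; apply: measurableT_comp => //.
  by apply: measurable_funM => //; exact: measurable_funX.
have e1 (x : R) : expR (- (lam * x ^+ 2)) <= 1.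
  by rewrite expR_le1 oppr_le0 mulr_ge0// sqr_ge0.
rewrite integral_normal_prob; first last.
- apply: (@le_lt_trans _ _ (\int[normal_prob 0 s]_x (cst 1%E x)))%E.
    apply: ge0_le_integral => //=.
      by apply/measurable_EFinP; apply: measurableT_comp.
    by move=> x _; rewrite lee_fin ger0_norm ?expR_ge0.
  by rewrite integral_cst//= mul1e ltey_eq fin_num_measure.
- exact/measurable_EFinP.
pose s' := s / k; have s'0 : 0 < s' by rewrite divr_gt0.
transitivity (\int[leb]_x (k^-1%:E * (normal_pdf 0 s' x)%:E))%E.
  apply: eq_integral => x _; rewrite -!EFinM; congr EFin.
  rewrite !normal_pdfE ?gt_eqF// /normal_peak /normal_fun subr0.
  have -> : Num.sqrt (s' ^+ 2 * pi *+ 2) = Num.sqrt (s ^+ 2 * pi *+ 2) / k.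
    have -> : s' ^+ 2 * pi *+ 2 = s ^+ 2 * pi *+ 2 * k^-1 ^+ 2.
      by rewrite /s' exprMn; ring.
    rewrite sqrtrM; last by rewrite mulrn_wge0// mulr_ge0 ?sqr_ge0 ?pi_ge0.
    by rewrite sqrtr_sqr ger0_norm// invr_ge0 ltW.
  have -> : - x ^+ 2 / (s' ^+ 2 *+ 2) = - (lam * x ^+ 2) + - x ^+ 2 / (s ^+ 2 *+ 2).
    by rewrite /s' expr_div_n k2; field; rewrite !gt_eqF.
  by rewrite expRD invfM invrK; field; rewrite !gt_eqF// sqrtr_gt0 mulrn_wgt0// mulr_gt0 ?exprn_gt0 ?pi_gt0.
rewrite ge0_integralZl//; last 3 first.
- by apply/measurable_EFinP; exact: measurable_normal_pdf.
- by move=> x _; rewrite lee_fin normal_pdf_ge0.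
- by rewrite lee_fin invr_ge0 ltW.
by rewrite integral_normal_pdf mule1.
Qed.

End normal_laplace.

Section brownian_increment.
Context (R : realType) d (Omega : measurableType d) (P : probability Omega R).
Variables (sigma : R) (B : R -> Omega -> R).
Hypothesis brownianB : is_brownian_motion P B.

Let q := @gauss_test R.

Lemma measurable_brownian t : 0 <= t -> measurable_fun setT (B t).
Proof. by case: brownianB => mB _ _ _ _; exact: mB. Qed.

Lemma brownian_laplace (t lam : R) : 0 < t -> 0 <= lam ->
  Ex P (fun w => expR (- (lam * (sigma * B t w) ^+ 2))) =
    (Num.sqrt (1 + 2 * lam * sigma ^+ 2 * t))^-1.
Proof.
move=> t0 lam0; have [mB B0 _ lawB _] := brownianB.
have mexp (l : R) : measurable_fun setT (fun x : R => expR (- (l * x ^+ 2))).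
  apply: measurableT_comp => //; apply: measurableT_comp => //.
  by apply: measurable_funM => //; exact: measurable_funX.
have l0 : 0 <= lam * sigma ^+ 2 by rewrite mulr_ge0// sqr_ge0.
have e1 (l x : R) : 0 <= l -> `|expR (- (l * x ^+ 2))| <= 1.
  by move=> l00; rewrite ger0_norm ?expR_ge0// expR_le1 oppr_le0 mulr_ge0// sqr_ge0.
have mi : measurable_fun setT (increment B 0 t).
  by apply: measurable_funB; apply: mB => //; exact: ltW.
have mBt := mB t (ltW t0).
have -> : (fun w => expR (- (lam * (sigma * B t w) ^+ 2))) =
    (fun x => expR (- (lam * sigma ^+ 2 * x ^+ 2))) \o B t.
  by apply/funext => w /=; rewrite exprMn mulrA.
have b (f : Omega -> R) : measurable_fun setT f ->
    brv ((fun x => expR (- (lam * sigma ^+ 2 * x ^+ 2))) \o f).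
  by move=> mf; apply: brv_comp => //; exists 1 => x; exact: e1.
apply: EFin_inj; rewrite -ExE; last exact: b.
transitivity (\int[P]_w (expR (- (lam * sigma ^+ 2 * increment B 0 t w ^+ 2)))%:E)%E.
  apply: ae_eq_integral => //.
  - by apply/measurable_EFinP; case: (b (B t)).
  - by apply/measurable_EFinP; case: (b (increment B 0 t)).
  - by apply: filterS B0 => w w0 _ /=; rewrite /increment w0 subr0.
pose X1 : {RV P >-> measurableTypeR R} := @mfun_Sub _ _ Omega (measurableTypeR R) _ (mem_set mi).
have -> : 2 * lam * sigma ^+ 2 * t = 2 * (lam * sigma ^+ 2) * Num.sqrt t ^+ 2.
  by rewrite sqr_sqrtr ?ltW//; ring.
rewrite -normal_laplace ?sqrtr_gt0//.
transitivity (\int[distribution P X1]_y (expR (- (lam * sigma ^+ 2 * y ^+ 2)))%:E)%E.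
  have mF : measurable_fun [set: measurableTypeR R]
      (fun y : measurableTypeR R => (expR (- (lam * sigma ^+ 2 * y ^+ 2)))%:E).
    by apply/measurable_EFinP; exact: mexp.
  by rewrite ge0_integral_pushforward.
apply: eq_measure_integral => A mA _; rewrite -[t in Num.sqrt t]subr0.
exact: lawB.
Qed.

(** [q] and [q^2] are combinations of [expR (- x^2)] and [expR (- 2 x^2)], whose means are the
    inverse square roots of [1 + 2 a] and [1 + 4 a], with [a = sigma^2 / n]. The terms of order [a]
    cancel in the mean of [q^2], and [inv_sqrt_bounds] gives the constants. *)
Lemma brownian_gauss_test n : (0 < n)%N ->
  `|n%:R * Ex P (fun w => q (sigma * B n%:R^-1 w)) - sigma ^+ 2| <= 2 * sigma ^+ 4 / n%:R /\
  n%:R * Ex P (fun w => q (sigma * B n%:R^-1 w) ^+ 2) <= 6 * sigma ^+ 4 / n%:R.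
Proof.
move=> n0; have t0 : 0 < n%:R^-1 :> R by rewrite invr_gt0 ltr0n.
have mB := measurable_brownian (ltW t0).
have nn0 : n%:R != 0 :> R by rewrite pnatr_eq0 -lt0n.
have b lam : 0 <= lam -> brv (fun w => expR (- (lam * (sigma * B n%:R^-1 w) ^+ 2))).
  move=> l0; split; last first.
    by exists 1 => w; rewrite ger0_norm ?expR_ge0// expR_le1 oppr_le0 mulr_ge0// sqr_ge0.
  apply: measurableT_comp => //; apply: measurableT_comp => //.
  apply: measurable_funM => //; apply: measurable_funX.
  exact: measurable_funM.
set a := sigma ^+ 2 * n%:R^-1; have a0 : 0 <= a by rewrite mulr_ge0 ?sqr_ge0 ?ltW.
have b1 := b 1 ler01; have b2 := b 2 ltac:(by []).
set E1 := (fun w => _) in b1; set E2 := (fun w => _) in b2.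
have L1 : Ex P E1 = (Num.sqrt (1 + 2 * a))^-1.
  by rewrite brownian_laplace// mulr1 -mulrA.
have L2 : Ex P E2 = (Num.sqrt (1 + 4 * a))^-1.
  rewrite brownian_laplace//; congr ((Num.sqrt _)^-1); rewrite /a; ring.
have bc := @brv_cst _ Omega R 1.
have Eq1 : Ex P (fun w => q (sigma * B n%:R^-1 w)) = 1 - Ex P E1.
  have := ExB P bc b1; rewrite Ex_cst => <-; congr Ex; apply/funext => w.
  by rewrite /q /gauss_test /E1 mul1r.
have Eq2 : Ex P (fun w => q (sigma * B n%:R^-1 w) ^+ 2) = 1 - 2 * Ex P E1 + Ex P E2.
  have b3 := brvZ 2 b1; have := ExD P (brvB bc b3) b2; rewrite (ExB P bc b3) Ex_cst (ExZ P 2 b1) => <-.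
  congr Ex; apply/funext => w; rewrite /q /gauss_test /E1 /E2 mul1r /cst.
  by rewrite [2 * _ ^+ 2]mulr_natl mulr2n opprD expRD; ring.
have /andP[h1 h2] := @inv_sqrt_bounds R (2 * a) ltac:(by rewrite mulr_ge0).
have /andP[h3 h4] := @inv_sqrt_bounds R (4 * a) ltac:(by rewrite mulr_ge0).
have na : n%:R * a = sigma ^+ 2 by rewrite /a mulrCA mulfV// mulr1.
have na2 : n%:R * a ^+ 2 = sigma ^+ 4 / n%:R.
  by rewrite expr2 mulrA na /a mulrA -exprD.
have n00 : 0 <= n%:R :> R by [].
rewrite Eq1 Eq2 L1 L2; set g1 := (Num.sqrt (1 + 2 * a))^-1 in h1 h2 *.
set g2 := (Num.sqrt (1 + 4 * a))^-1 in h3 h4 *.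
have a20 : 0 <= n%:R * a ^+ 2 by rewrite mulr_ge0// sqr_ge0.
have c2 (c : R) : c * sigma ^+ 4 / n%:R = c * (n%:R * a ^+ 2) by rewrite na2 mulrA.
rewrite !c2 -na; split.
  rewrite -mulrBr ler_norml; apply/andP; split.
    by rewrite mulrCA -mulrN ler_wpM2l//; lra.
  by rewrite mulrCA ler_wpM2l//; have := sqr_ge0 a; lra.
by rewrite mulrCA ler_wpM2l//; lra.
Qed.

End brownian_increment.

(** * Rates of the small increments *)

Section gauss_test_small.
Context (R : realType).
Local Notation q := (@gauss_test R).
Implicit Types (x y u v r s : R) (i : nat).

Definition small_test (g : R -> R) i y : R := g y * (1 - cut i y).

Lemma one_cut_itv i y : 0 <= 1 - cut i y <= 1.
Proof. by rewrite subr_ge0 cut_le1 lerBlDr lerDl cut_ge0. Qed.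

Lemma small_gauss_test_bound i y : 0 <= small_test q i y <= (2 / i.+1%:R) ^+ 2.
Proof.
have /andP[c0 c1] := one_cut_itv i y; apply/andP; split.
  by rewrite mulr_ge0// gauss_test_ge0.
have [h|h] := leP (2 / i.+1%:R) `|y|.
  by rewrite /small_test cut_eq1// subrr mulr0 sqr_ge0.
apply: (@le_trans _ _ (q y)); first by rewrite ler_piMr// gauss_test_ge0.
apply: le_trans (gauss_test_le_sqr y) _; rewrite -(real_normK (num_real y)).
by rewrite lerXn2r ?nnegrE ?divr_ge0// ltW.
Qed.

(** Every term on the right involves [u], [v] or [b] alone. If a large jump occurs, which is [b],
    both tests are bounded separately, [q u] by [s^-1 q^2 + s]. Otherwise [gauss_test_increment]
    applies, and the cutoff costs [q u] at most, only if [|x| > a]: then either [|u| >= a / 2] and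
    [q u <= q^2 / q (a / 2)], or [|v| > a / 2] and [(2 / a)^2 v^2 >= 1]. *)
Lemma small_gauss_test_close i (a := i.+1%:R^-1 : R) x u v r s (b : bool) : 0 < r -> 0 < s ->
  (~~ b -> x = u + v) ->
  `|small_test q i x - q u| <=
    (r * q u + ((q (a / 2))^-1 + s^-1) * q u ^+ 2) + (3 + r^-1 + s * (2 / a) ^+ 2) * v ^+ 2 +
    ((2 * a) ^+ 2 + s) * b%:R.
Proof.
move=> r0 s0 xuv; have a0 : 0 < a by rewrite invr_gt0.
have a2 : 0 < a / 2 by rewrite divr_gt0.
have qa : 0 < q (a / 2) by rewrite gauss_test_gt0// gt_eqF.
have qu := gauss_test_ge0 u; have qu1 := gauss_test_le1 u.
have v0 := sqr_ge0 v.
have A1 : 0 <= (q (a / 2))^-1 * q u ^+ 2 by rewrite mulr_ge0 ?invr_ge0 ?sqr_ge0// ltW.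
have A2 : 0 <= s^-1 * q u ^+ 2 by rewrite mulr_ge0 ?invr_ge0 ?sqr_ge0// ltW.
have A3 : 0 <= s * (2 / a) ^+ 2 * v ^+ 2 by rewrite mulr_ge0// mulr_ge0 ?sqr_ge0// ltW.
have A4 : 0 <= (3 + r^-1) * v ^+ 2 by rewrite mulr_ge0// addr_ge0// invr_ge0 ltW.
have A5 : 0 <= r * q u by rewrite mulr_ge0// ltW.
have amgm : q u <= s^-1 * q u ^+ 2 + s.
  rewrite -subr_ge0 (_ : _ - _ = s^-1 * ((q u - s / 2) ^+ 2 + 3 / 4 * s ^+ 2)).
    by apply: mulr_ge0; [rewrite invr_ge0 ltW|apply: addr_ge0; [|apply: mulr_ge0]; rewrite ?sqr_ge0].
  by field; rewrite gt_eqF.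
rewrite !mulrDl; case: b xuv => [_|/(_ isT) xuv]; rewrite ?mulr1 ?mulr0 ?addr0.
  have /andP[h0 h1] := small_gauss_test_bound i x; rewrite -/a in h1.
  by rewrite ler_norml; apply/andP; split; lra.
have /andP[c0 c1] := one_cut_itv i x.
have h1 := gauss_test_increment u v r0; rewrite -xuv in h1.
have h2 : q u * cut i x <= (q (a / 2))^-1 * q u ^+ 2 + s^-1 * q u ^+ 2 + s * (2 / a) ^+ 2 * v ^+ 2.
  have [xa|xa] := leP `|x| a.
    by rewrite (vanishing_cut R i).2// mulr0 !addr_ge0.
  apply: (@le_trans _ _ (q u)); first by rewrite ler_piMr// cut_le1.
  have [ua|ua] := leP (a / 2) `|u|.
    have h : q (a / 2) <= q u by apply: gauss_test_mono; rewrite (ger0_norm (ltW a2)).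
    have : q u <= (q (a / 2))^-1 * q u ^+ 2.
      by rewrite expr2 mulrA ler_peMl// ler_pdivlMl// mulr1.
    lra.
  have va : a / 2 <= `|v|.
    by have := ler_normD u v; rewrite -xuv; lra.
  have h4 : 1 <= (2 / a) ^+ 2 * v ^+ 2.
    rewrite -exprMn -(real_normK (num_real (2 / a * v))) normrM (ger0_norm (x := 2 / a)); last by rewrite divr_ge0// ltW.
    have : 1 <= 2 / a * `|v| by rewrite mulrAC ler_pdivlMr// mul1r; lra.
    by move=> h; rewrite expr_ge1// (le_trans ler01 h).
  have : s <= s * (2 / a) ^+ 2 * v ^+ 2 by rewrite -mulrA ler_peMr// ltW.
  lra.
have -> : small_test q i x - q u = (q x - q u) * (1 - cut i x) - q u * cut i x.
  by rewrite /small_test; ring.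
apply: le_trans (ler_normB _ _) _; rewrite normrM (ger0_norm c0).
rewrite (ger0_norm (x := q u * _)); last by rewrite mulr_ge0// cut_ge0.
have : `|q x - q u| * (1 - cut i x) <= `|q x - q u| by rewrite ler_piMr.
lra.
Qed.

(** Only [|y| < 2 / (i + 1) <= 1 / 4] matters, where the Taylor bound applies. With [z = |y|], its
    cubic error is at most [16 z q] and replacing [z^2] by [q] costs at most [z q]; the sum is below
    [18 z q], hence the 36. *)
Lemma small_log_excess_close f i y : 0 <= f -> f <= 1 -> (8 <= i)%N ->
  `|small_test (log_excess f) i y - f * (1 - f) / 2 * small_test q i y| <=
    36 / i.+1%:R * small_test q i y.
Proof.
move=> f0 f1 i8; have /andP[c0 c1] := one_cut_itv i y.
rewrite /small_test !mulrA -mulrBl normrM (ger0_norm c0).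
have [h|h] := leP (2 / i.+1%:R) `|y|; first by rewrite cut_eq1// subrr !mulr0.
rewrite ler_wpM2r//.
have i0 : 0 < i.+1%:R :> R by [].
have i4 : 2 / i.+1%:R <= 4^-1 :> R.
  rewrite ler_pdivrMr// ler_pdivlMl// -natrM ler_nat; exact: leqW.
have y4 : `|y| <= 1 / 4 by rewrite mul1r (le_trans (ltW h)).
have T := log_excess_taylor f0 f1 y4.
have q0 := gauss_test_ge0 y; have q1 := gauss_test_le_sqr y.
have q2 := sqr_le_gauss_test y.
have y0 := normr_ge0 y.
have cf : 0 <= f * (1 - f) / 2 <= 1 by apply/andP; split; nra.
move: cf T; set c := f * (1 - f) / 2 => /andP[cf0 cf1] T.
have E : 36 / i.+1%:R = 18 * (2 / i.+1%:R) :> R by rewrite mulrA -natrM.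
rewrite E; set e := 2 / i.+1%:R in h i4 E *.
rewrite -(real_normK (num_real y)) in T q1 q2.
set z := `|y| in T q1 q2 y0 y4 h *.
have h1 : `|log_excess f y - c * q y| <= 8 * z ^+ 3 + c * (z ^+ 2 - q y).
  rewrite (_ : log_excess f y - c * q y = (log_excess f y - c * z ^+ 2) + c * (z ^+ 2 - q y)); last by ring.
  apply: le_trans (ler_normD _ _) _; rewrite lerD//.
  by rewrite ger0_norm// mulr_ge0// subr_ge0.
apply: (le_trans h1).
have z2 : z ^+ 2 <= z by rewrite expr2 ler_piMl// (le_trans y4)// ler_pdivrMr// mul1r ler1n.
have zq : z ^+ 2 * q y <= z * q y by rewrite ler_wpM2r.
have zq1 : z * q y <= q y by rewrite ler_piMl// (le_trans y4)// ler_pdivrMr// mul1r ler1n.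
have h2 : z ^+ 2 <= 2 * q y by lra.
have h3 : z ^+ 2 - q y <= z * q y by lra.
have h4 : c * (z ^+ 2 - q y) <= z * q y.
  by apply: le_trans h3; rewrite ler_piMl// subr_ge0.
have h5 : 8 * z ^+ 3 <= 16 * z * q y 
  by have := ler_wpM2l y0 h2; rewrite exprS; lra.
have h6 : z * q y <= e * q y by rewrite ler_wpM2r// ltW.
lra.
Qed.

End gauss_test_small.

Section small_increment_rates.
Context (R : realType) d (Omega : measurableType d) (P : probability Omega R).
Variables (mu sigma : R) (X B M : R -> Omega -> R).
Hypothesis levyX : is_levy_process P X.
Hypothesis brownianB : is_brownian_motion P B.
Variable G : set Omega.
Hypotheses (mG : measurable G) (PG : P (~` G) = 0%E).
Hypothesis goodG : forall w, G w -> X 0 w = 0 /\ cadlag0 (X^~ w).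
Variable F : {measure set R -> \bar R}.
Hypothesis levyF : is_levy_measure P X F.
Hypothesis smallM : is_small_jump_integral P X F M.
Hypothesis decG : forall w, G w -> forall t, 0 <= t ->
  X t w = mu * t + sigma * B t w + M t w + large_jump_sum X t w.
Local Notation D := (grid_inc X).
Local Notation q := (@gauss_test R).

Lemma measurable_small_test g i : continuous g -> measurable_fun setT (@small_test R g i).
Proof.
move=> cg; apply: measurable_funM; first exact: continuous_measurable_fun.
by apply: measurable_funB => //; exact: measurable_cut.
Qed.

Lemma bdd_small_gauss_test i : bdd (@small_test R q i).
Proof.
exists ((2 / i.+1%:R) ^+ 2) => y.
by have /andP[h0 h1] := small_gauss_test_bound i y; rewrite ger0_norm.
Qed.

Lemma brv_small_gauss_test i n : brv (small_test q i \o D n 0).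
Proof.
apply: brv_comp; [|exact: bdd_small_gauss_test|exact: (measurable_grid_inc levyX)].
by apply: measurable_small_test; exact: continuous_gauss_test.
Qed.

Let brv_gauss n : brv (fun w => q (sigma * B n%:R^-1 w)).
Proof.
have n0 : 0 <= n%:R^-1 :> R by rewrite invr_ge0.
apply: (brv_comp (u := q)); first exact: continuous_measurable_fun (@continuous_gauss_test R).
  by exists 1 => y; rewrite ger0_norm ?gauss_test_le1 ?gauss_test_ge0.
by apply: measurable_funM => //; exact: (measurable_brownian brownianB).
Qed.

(** [small_gauss_test_close] in mean and multiplied by [n], with [u] the Brownian increment, [v] the
    remainder and [b] the occurrence of a large jump. The index [i] of the decomposition and the
    index [j] of the test function are not linked. *)
Let gauss_rate_bound i j n r s K (a := j.+1%:R^-1 : R) :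
  (0 < i)%N -> (0 < n)%N -> 0 < r -> 0 < s ->
  (P [set w | (big_part X G i n w != 0)%R] <= (K / n%:R)%:E)%E ->
  `|n%:R * Ex P (small_test q j \o D n 0) - n%:R * Ex P (fun w => q (sigma * B n%:R^-1 w))| <=
  n%:R * (r * Ex P (fun w => q (sigma * B n%:R^-1 w)) +
    ((q (a / 2))^-1 + s^-1) * Ex P (fun w => q (sigma * B n%:R^-1 w) ^+ 2)) +
  (3 + r^-1 + s * (2 / a) ^+ 2) * (3 * (n%:R^-1 * drift mu F i ^+ 2 + small_var F i)) +
  ((2 * a) ^+ 2 + s) * K.
Proof.
move=> i0 n0 r0 s0 hK; set Q := (fun w => _) : Omega -> R.
have nn0 : 0 < n%:R :> R by rewrite ltr0n.
have bQ : brv Q by exact: brv_gauss.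
have bS := brv_small_gauss_test j n.
set S := _ \o _ in bS *.
have a0 : 0 < a by rewrite invr_gt0.
have qa : 0 <= (q (a / 2))^-1 by rewrite invr_ge0 gauss_test_ge0.
have s0' : 0 <= s^-1 by rewrite invr_ge0 ltW.
have r0' : 0 <= r^-1 by rewrite invr_ge0 ltW.
have sa : 0 <= s * (2 / a) ^+ 2 by rewrite mulr_ge0 ?sqr_ge0// ltW.
set c1 := (q (a / 2))^-1 + s^-1; set c2 := 3 + r^-1 + s * (2 / a) ^+ 2.
set c3 := (2 * a) ^+ 2 + s.
have c10 : 0 <= c1 by rewrite addr_ge0.
have c20 : 0 <= c2 by rewrite !addr_ge0.
have c30 : 0 <= c3 by rewrite addr_ge0 ?sqr_ge0// ltW.
have Q0 w : 0 <= Q w by exact: gauss_test_ge0.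
have bQ1 := brvZ r bQ; have bQ2 := brvZ c1 (brvX bQ).
have bf1 : brv (fun w => r * Q w + c1 * Q w ^+ 2) by exact: brvD.
set f1 := (fun w => _) in bf1.
have f10 w : 0 <= f1 w by rewrite addr_ge0// mulr_ge0// ?sqr_ge0// ltW.
set V := remainder sigma X B G i n; set J := [set w | (big_part X G i n w != 0)%R].
have mV : measurable_fun setT V by exact: (measurable_remainder sigma levyX brownianB mG goodG).
have mJ : measurable J.
  rewrite (_ : J = setT `&` big_part X G i n @^-1` [set~ 0]); last first.
    by rewrite setTI; apply/seteqP; split => w /= /eqP.
  by apply: (measurable_big_part levyX mG goodG i n) => //; exact: measurableC.
have mV2 : measurable_fun setT (fun w => V w ^+ 2) by exact: measurable_funX.
have mIJ : measurable_fun setT (\1_J : Omega -> R) by exact: measurable_indic.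
have hA : (\int[P]_w (`|S w - Q w|)%:E <=
    \int[P]_w (f1 w + c2 * V w ^+ 2 + c3 * \1_J w)%:E)%E.
  apply: (le_integral_on mG PG) => //.
    move=> w; apply: addr_ge0; last by apply: mulr_ge0 => //; rewrite indicE.
    by apply: addr_ge0 => //; apply: mulr_ge0 => //; exact: sqr_ge0.
  move=> w Gw; have [X0 _] := goodG Gw.
  have := @small_gauss_test_close R j (D n 0 w) (sigma * B n%:R^-1 w) (V w) r s (w \in J) r0 s0.
  rewrite indicE; apply => wJ; rewrite /V /remainder /grid_inc mul0r X0 mul1r subr0.
  have -> : big_part X G i n w = 0.
    by apply/eqP/negPn/negP => h; move/negP: wJ; apply; exact: mem_set.
  by rewrite subr0; ring.
have bA : brv (fun w => `|S w - Q w|).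
  have [mSQ [N hN]] := brvB bS bQ; split; first exact: measurableT_comp.
  by exists N => w; rewrite normr_id.
have hE : (\int[P]_w (f1 w + c2 * V w ^+ 2 + c3 * \1_J w)%:E <=
    (Ex P f1 + c2 * (3 * (n%:R^-1 ^+ 2 * drift mu F i ^+ 2 + n%:R^-1 * small_var F i)) +
     c3 * (K / n%:R))%:E)%E.
  under eq_integral do rewrite EFinD EFinD.
  have m1 : measurable_fun setT (fun w => (f1 w)%:E) by apply/measurable_EFinP; case: bf1.
  have m2 : measurable_fun setT (fun w => (c2 * V w ^+ 2)%:E).
    by apply/measurable_EFinP; exact: measurable_funM.
  have m3 : measurable_fun setT (fun w => (c3 * \1_J w)%:E).
    by apply/measurable_EFinP; exact: measurable_funM.
  rewrite ge0_integralD//; last 3 first.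
  - by move=> w _; rewrite -EFinD lee_fin addr_ge0// mulr_ge0// sqr_ge0.
  - exact: emeasurable_funD.
  - by move=> w _; rewrite lee_fin mulr_ge0// indicE.
  rewrite ge0_integralD//; last 2 first.
  - by move=> w _; exact: f10.
  - by move=> w _; rewrite lee_fin mulr_ge0// sqr_ge0.
  rewrite ExE// ge0_integral_scale//; last by move=> w; exact: sqr_ge0.
  rewrite ge0_integral_scale//.
  rewrite integral_indic// setIT; set W := 3 * _.
  have -> : (Ex P f1 + c2 * W + c3 * (K / n%:R))%:E =
      ((Ex P f1)%:E + c2%:E * W%:E + c3%:E * (K / n%:R)%:E)%E by [].
  apply: leeD; last exact: lee_wpmul2l.
  apply: leeD => //; apply: lee_wpmul2l => //.
  exact: (second_moment_remainder levyX mG PG goodG levyF smallM decG).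
have := le_trans hA hE; rewrite ExE// lee_fin => h1.
rewrite -mulrBr -ExB// normrM (ger0_norm (ltW nn0)).
have h2 : `|Ex P (fun w => S w - Q w)| <= Ex P (fun w => `|S w - Q w|).
  by apply: Ex_le_norm => //; exact: brvB.
have h3 := le_trans h2 h1.
apply: (@le_trans _ _ (n%:R * (Ex P f1 + c2 * (3 * (n%:R^-1 ^+ 2 * drift mu F i ^+ 2 + n%:R^-1 * small_var F i)) + c3 * (K / n%:R)))).
  by rewrite ler_pM2l.
rewrite /f1 (ExD P bQ1 bQ2) (ExZ P r bQ) (ExZ P c1 (brvX bQ)) le_eqVlt; apply/orP; left; apply/eqP.
by field; rewrite gt_eqF.
Qed.

(* The index [i] of the decomposition is fixed first, to make the remainder
   small, and the cutoff index [j] of the test function afterwards: the event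
   that a large jump occurs has a rate depending on [i] only, and on it the test
   function is at most [(2 / (j + 1))^2]. *)
Lemma gauss_rate eta : 0 < eta -> exists i0, forall i, (i0 <= i)%N ->
  exists n0, forall n, (n0 <= n)%N -> (0 < n)%N /\
    `|n%:R * Ex P (small_test q i \o D n 0) - sigma ^+ 2| <= eta.
Proof.
(* The errors use six shares of [eta / 8]: one each for [r], [i], [j] and [s], and two for the terms
   of order [1 / n]. *)
move=> eta0; set e8 := eta / 8; have e80 : 0 < e8 by rewrite divr_gt0.
pose r := e8 / (sigma ^+ 2 + 1).
have s20 := sqr_ge0 sigma.
have r0 : 0 < r by rewrite divr_gt0// ltr_wpDl.
have rs : r * sigma ^+ 2 <= e8.
  by rewrite /r mulrAC ler_pdivrMr ?ltr_wpDl// ler_pM2l// lerDl.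
have r30 : 0 < 3 * (3 + r^-1) by rewrite mulr_gt0// addr_gt0// invr_gt0.
have [i [i0 vi]] : exists i, (0 < i)%N /\ 3 * (3 + r^-1) * small_var F i <= e8.
  have := small_var_cvg0 levyF => /cvgrPdist_le /(_ (e8 / (3 * (3 + r^-1)))).
  rewrite divr_gt0// => /(_ isT)[N _ hN]; exists N.+1; split => //.
  have := hN N.+1 (leqnSn N); rewrite /= sub0r normrN ger0_norm ?small_var_ge0//.
  by rewrite ler_pdivlMr// mulrC.
have v0 := small_var_ge0 F i; set v := small_var F i in vi v0.
have [K [K0 hK]] := big_part_prob levyX mG PG goodG levyF i.
have [i1 hi1] : exists i1, forall j, (i1 <= j)%N -> (2 * j.+1%:R^-1) ^+ 2 * K <= e8.
  have : 0 < e8 / (4 * (K + 1)) by rewrite divr_gt0// mulr_gt0// ltr_wpDl.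
  move=> /inv_nat_lt[N hN]; exists N => j Nj.
  have [_ h] := hN j.+1 (leqW Nj).
  have j0 : 0 < j.+1%:R^-1 :> R by rewrite invr_gt0.
  have j1 : j.+1%:R^-1 <= 1 :> R by rewrite invf_le1// ler1n.
  have K1 : 0 < K + 1 by rewrite ltr_wpDl.
  apply: (@le_trans _ _ (4 * j.+1%:R^-1 * (K + 1))).
    rewrite exprMn; apply: ler_pM => //; rewrite ?mulr_ge0 ?sqr_ge0//; last by rewrite lerDl.
    by rewrite expr2 -natrM ler_wpM2l// expr2 ler_piMl// ltW.
  by move: h; rewrite ltr_pdivlMr ?mulr_gt0// => /ltW; rewrite mulrA (mulrC _ 4).
exists i1 => j /hi1 hj; set a := j.+1%:R^-1 in hj.
(* [s] is chosen after [a], to offset the large factor [(2 / a)^2]; the constant [1 / s] thus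
   created multiplies only the mean of [q^2], which is of order [1 / n^2]. *)
pose s := e8 / ((2 / a) ^+ 2 * (3 * v) + K + 1).
have den : 0 < (2 / a) ^+ 2 * (3 * v) + K + 1.
  by rewrite ltr_wpDl// addr_ge0// mulr_ge0 ?sqr_ge0// mulr_ge0.
have s0 : 0 < s by rewrite divr_gt0.
have hs : s * ((2 / a) ^+ 2 * (3 * v)) + s * K <= e8.
  by rewrite -mulrDr /s mulrAC ler_pdivrMr// ler_pM2l// lerDl.
set c1 := (q (a / 2))^-1 + s^-1; set c2 := 3 + r^-1 + s * (2 / a) ^+ 2.
have c10 : 0 <= c1 by rewrite addr_ge0 ?invr_ge0 ?gauss_test_ge0// ltW.
pose C := 2 * r * sigma ^+ 4 + c1 * (6 * sigma ^+ 4) + c2 * (3 * drift mu F i ^+ 2) + 2 * sigma ^+ 4.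
have [N hN] : exists N, forall n, (N <= n)%N -> (0 < n)%N /\ C / n%:R <= 2 * e8.
  have C1 : 0 < 2 * e8 / (`|C| + 1) by rewrite divr_gt0 ?mulr_gt0// ltr_wpDl.
  have [N hN] := inv_nat_lt C1; exists N => n /hN[n0 h]; split=> //.
  have n00 : 0 < n%:R^-1 :> R by rewrite invr_gt0 ltr0n.
  move: h; rewrite ltr_pdivlMr ?ltr_wpDl// => /ltW; apply: le_trans.
  rewrite mulrC ler_pM2l//; apply: le_trans (ler_norm C) _; by rewrite lerDl.
exists N => n /hN[n0 hC]; split=> //.
have [g1 g2] := brownian_gauss_test sigma brownianB n0.
have H := gauss_rate_bound j i0 n0 r0 s0 (hK n n0).
rewrite -/a -/c1 -/c2 -/v in H.
have nn0 : 0 < n%:R^-1 :> R by rewrite invr_gt0 ltr0n.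
set EQ := n%:R * Ex P (fun w => q (sigma * B n%:R^-1 w)) in g1 H.
set EQ2 := Ex P (fun w => q (sigma * B n%:R^-1 w) ^+ 2) in g2 H.
set ES := n%:R * _ in H *.
have EQ' : EQ <= sigma ^+ 2 + 2 * sigma ^+ 4 / n%:R.
  by move: g1; rewrite ler_norml => /andP[_]; lra.
have t1 : n%:R * (r * Ex P (fun w => q (sigma * B n%:R^-1 w)) + c1 * EQ2) <=
    r * sigma ^+ 2 + (2 * r * sigma ^+ 4 + c1 * (6 * sigma ^+ 4)) / n%:R.
  have u1 := ler_wpM2l (ltW r0) EQ'; have u2 := ler_wpM2l c10 g2.
  rewrite mulrDr (mulrCA _ r) -/EQ (mulrCA _ c1).
  have -> : r * sigma ^+ 2 + (2 * r * sigma ^+ 4 + c1 * (6 * sigma ^+ 4)) / n%:R =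
    r * (sigma ^+ 2 + 2 * sigma ^+ 4 / n%:R) + c1 * (6 * sigma ^+ 4 / n%:R) by ring.
  exact: lerD.
have t2 : c2 * (3 * (n%:R^-1 * drift mu F i ^+ 2 + v)) <=
    c2 * (3 * drift mu F i ^+ 2) / n%:R + e8 + s * ((2 / a) ^+ 2 * (3 * v)).
  have -> : c2 * (3 * (n%:R^-1 * drift mu F i ^+ 2 + v)) =
     c2 * (3 * drift mu F i ^+ 2) / n%:R + 3 * (3 + r^-1) * v + s * ((2 / a) ^+ 2 * (3 * v)).
    by rewrite /c2; ring.
  lra.
have t3 : ((2 * a) ^+ 2 + s) * K <= e8 + s * K by rewrite mulrDl; lra.
have t4 : (2 * r * sigma ^+ 4 + c1 * (6 * sigma ^+ 4)) / n%:R + c2 * (3 * drift mu F i ^+ 2) / n%:R +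
   2 * sigma ^+ 4 / n%:R <= 2 * e8 by rewrite -!mulrDl.
have t5 : `|ES - sigma ^+ 2| <= `|ES - EQ| + `|EQ - sigma ^+ 2| by exact: ler_distD.
have e8E : eta = 8 * e8 by rewrite /e8; field.
rewrite e8E; lra.
Qed.

(** By [small_log_excess_close] the rate for [h] differs from [f (1 - f) / 2] times that for [q] by
    a fraction [36 / (i + 1)] of the latter, itself at most [sigma^2 + 1]. *)
Lemma log_excess_rate f eta : 0 <= f -> f <= 1 -> 0 < eta ->
  exists i0, forall i, (i0 <= i)%N -> exists n0, forall n, (n0 <= n)%N ->
    `|n%:R * Ex P (small_test (log_excess f) i \o D n 0) - f * (1 - f) / 2 * sigma ^+ 2| <= eta.
Proof.
move=> f0 f1 eta0; pose e1 := Num.min 1 (eta / 2).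
have e10 : 0 < e1 by rewrite lt_min ltr01 divr_gt0.
have [i1 h1] := gauss_rate e10.
have s0 := sqr_ge0 sigma.
have : 0 < eta / 2 / (36 * (sigma ^+ 2 + 1)).
  by rewrite !divr_gt0// mulr_gt0// ltr_wpDl.
move=> /inv_nat_lt[i2 h2].
exists (maxn (maxn i1 i2) 8) => i; rewrite !geq_max -andbA => /and3P[/h1[n0 hn0] i2i i8].
have [_ {}h2] := h2 i.+1 (leqW i2i).
exists n0 => n /hn0[nn0 hn].
have nR : 0 < n%:R :> R by rewrite ltr0n.
set c := f * (1 - f) / 2.
have /andP[c0 c1] : 0 <= c <= 1 by apply/andP; rewrite /c; split; nra.
have bq := brv_small_gauss_test i n.
have bh : brv (small_test (log_excess f) i \o D n 0).
  apply: brv_comp; [| |exact: (measurable_grid_inc levyX)].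
    by apply: measurable_small_test; exact: continuous_log_excess.
  exists ((c + 36 / i.+1%:R) * (2 / i.+1%:R) ^+ 2) => y.
  have := small_log_excess_close y f0 f1 i8; rewrite -/c.
  have /andP[g0 g1] := small_gauss_test_bound i y => h.
  have k0 : 0 <= c + 36 / i.+1%:R by rewrite addr_ge0// divr_ge0.
  apply: le_trans (ler_wpM2l k0 g1).
  have c2 : 0 <= c * small_test q i y by rewrite mulr_ge0.
  have := ler_normD (small_test (log_excess f) i y - c * small_test q i y) (c * small_test q i y).
  rewrite subrK (ger0_norm c2) mulrDl addrC => h3; apply: le_trans h3 _.
  by rewrite lerD2l.
set Eh := Ex P (small_test (log_excess f) i \o D n 0).
set Eq := Ex P (small_test q i \o D n 0) in hn.
have d1 : `|Eh - c * Eq| <= 36 / i.+1%:R * Eq.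
  rewrite /Eh /Eq -!ExZ// -ExB//; last exact: brvZ.
  apply: Ex_le_norm => [||w]; [by apply: brvB => //; exact: brvZ|exact: brvZ|].
  exact: small_log_excess_close.
have d2 : `|n%:R * Eh - c * (n%:R * Eq)| <= 36 / i.+1%:R * (n%:R * Eq).
  rewrite (mulrCA c) -mulrBr normrM (ger0_norm (ltW nR)) (mulrCA (36 / _)).
  by rewrite ler_pM2l.
have e11 : e1 <= 1 by rewrite ge_min lexx.
have e12 : e1 <= eta / 2 by rewrite ge_min lexx orbT.
have d3 : n%:R * Eq <= sigma ^+ 2 + 1 by move: hn; rewrite ler_norml => /andP[_]; lra.
have d4 : 36 / i.+1%:R * (n%:R * Eq) <= eta / 2.
  have i0 : 0 <= 36 / i.+1%:R :> R by rewrite divr_ge0.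
  apply: le_trans (ler_wpM2l i0 d3) _.
  move: h2; rewrite ltr_pdivlMr; last by rewrite mulr_gt0// ltr_wpDl.
  by move=> /ltW; rewrite mulrA (mulrC _ 36).
have d5 : `|c * (n%:R * Eq) - c * sigma ^+ 2| <= eta / 2.
  rewrite -mulrBr normrM (ger0_norm c0).
  by apply: le_trans (le_trans hn e12); rewrite ler_piMl.
apply: le_trans (ler_distD (c * (n%:R * Eq)) _ _) _.
by rewrite (splitr eta) lerD// (le_trans d2).
Qed.

End small_increment_rates.

(** * Convergence of the sums of log-excesses *)

(** Continuity from above: the events that some [Q n] with [n >= N] fails decrease to a null set. *)
Lemma prob_eventually d (Omega : measurableType d) (R : realType) (P : probability Omega R)
    (G : set Omega) (Q : nat -> set Omega) : measurable G -> P (~` G) = 0%E ->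
  (forall n, measurable (Q n)) ->
  (forall w, G w -> exists N, forall n, (N <= n)%N -> Q n w) ->
  forall eta : R, 0 < eta -> exists N, forall n, (N <= n)%N -> (P (~` Q n) <= eta%:E)%E.
Proof.
move=> mG PG mQ hQ eta eta0.
pose B N := \bigcup_(n in [set n | (N <= n)%N]) ~` Q n.
have mB N : measurable (B N) by apply: bigcup_measurable => n _; exact: measurableC.
have B0 : P (\bigcap_N B N) = 0%E.
  apply/eqP; rewrite -measure_le0 -PG le_measure ?inE//.
  - exact: bigcapT_measurable.
  - exact: measurableC.
  - by move=> w Bw /hQ[N hN]; have [n /= Nn] := Bw N I; apply; exact: hN.
have : (P \o B) N @[N --> \oo] --> P (\bigcap_N B N).
  apply: nonincreasing_cvg_mu => //.
  - by rewrite ltey_eq fin_num_measure.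
  - exact: bigcapT_measurable.
  - by move=> n m nm; apply/subsetPset => w [k /= mk Qk]; exists k => //=; exact: leq_trans mk.
rewrite B0 => h; have := h _ (@nbhs_open_ereal_lt R 0 (fun=> eta) eta0).
move=> [N _ hN]; exists N => n Nn; apply: le_trans (ltW (hN N (leqnn N))).
by rewrite le_measure ?inE//; [exact: measurableC|move=> w Qw; exists n].
Qed.

Section jump_means.
Context (R : realType) d (Omega : measurableType d) (P : probability Omega R).
Variable X : R -> Omega -> R.
Hypothesis levyX : is_levy_process P X.
Variable G : set Omega.
Hypotheses (mG : measurable G) (PG : P (~` G) = 0%E).
Hypothesis goodG : forall w, G w -> X 0 w = 0 /\ cadlag0 (X^~ w).
Variable F : {measure set R -> \bar R}.
Hypothesis levyF : is_levy_measure P X F.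
Local Notation D := (grid_inc X).
Local Notation Jx := (good_jump_sum X G).
Local Notation IF := (levy_int F).
Implicit Types phi : R -> R.

Lemma increments_cvg_good_jump_sum_nat phi m w : test_fun phi -> G w ->
  \sum_(j < N * m) phi (D N j w) @[N --> \oo] --> Jx phi m%:R w.
Proof.
move=> [cphi [e [e0 ve]] _] Gw; have [_ cw] := goodG Gw.
rewrite good_jump_sumE//; apply/cvgrPdist_le => r r0.
have [N hN] := @riemann_jump_sum _ _ cw phi e e0 ve cphi m%:R r (ler0n _ _) r0.
exists N.+1 => // n /= Nn; rewrite distrC.
have n0 : n%:R != 0 :> R by rewrite pnatr_eq0 -lt0n (leq_trans _ Nn).
have := hN n (ltnW Nn) (n * m)%N; rewrite natrM => /(_ (lexx _)).
by rewrite mulrAC mulfV// mul1r.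
Qed.

Lemma mean_good_jump_sum_nat_le phi m : test_fun phi -> (forall y, 0 <= phi y) ->
  (\int[P]_w (Jx phi m%:R w)%:E <= (m%:R * IF phi)%:E)%E.
Proof.
move=> tphi phi0; have mphi := test_fun_measurable tphi.
have bD N j : brv (phi \o D N j).
  apply: brv_comp => //; [by case: tphi|exact: (measurable_grid_inc levyX)].
apply: (@fatou_le _ _ _ P G (fun N w => \sum_(j < N * m) phi (D N j w)) _
    (fun N => m%:R * (N%:R * Ex P (phi \o D N 0)))) => //.
- by move=> N; case: (brv_sum (N * m) (bD N)).
- by move=> N w; exact: sumr_ge0.
- by move=> w; exact: good_jump_sum_ge0.
- by move=> w Gw; exact: increments_cvg_good_jump_sum_nat.
- move=> N; rewrite ExE; last exact: (brv_sum _ (bD N)).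
  rewrite lee_fin (Ex_sum P _ (bD N)) mulrA -natrM mulnC -[X in X%:R]card_ord -sum1_card natr_sum mulr_suml.
  rewrite ler_sum// => j _.
  by rewrite mul1r (Ex_grid_inc levyX N j mphi)//; case: tphi.
- by apply: cvgM; [exact: cvg_cst|exact: (rate_integral levyX mG PG goodG levyF tphi)].
Qed.

Section jump_sums_bounded.
Variables (f : R) (f0 : 0 <= f) (f1 : f <= 1).
Local Notation h := (log_excess f).
(** The factor [1 - cut 8] removes the large jumps, where [h] is not bounded in general; [cut i]
    makes the function vanish near 0. *)
Let phi i y := small_test h 8 y * cut i y.

Lemma small_log_excess_bound i y : (8 <= i)%N ->
  0 <= small_test h i y <= 37 * small_test (@gauss_test R) i y.
Proof.
move=> i8; have /andP[c0 c1] := one_cut_itv i y.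
have hs0 : 0 <= small_test h i y by rewrite mulr_ge0// log_excess_ge0.
rewrite hs0/=; have /andP[q0 _] := small_gauss_test_bound i y.
have := small_log_excess_close y f0 f1 i8; set c := f * (1 - f) / 2.
have cf : c <= 1 by rewrite /c; nra.
have k1 : 36 / i.+1%:R <= 36 :> R by rewrite ler_piMr// invf_le1// ler1n.
rewrite ler_norml => /andP[_ h1].
move: h1; rewrite lerBlDr -mulrDl => h1; apply: le_trans h1 _; rewrite ler_wpM2r//.
by apply: le_trans (lerD k1 cf) _; rewrite natr1.
Qed.

Let phi0 i y : 0 <= phi i y.
Proof.
by rewrite mulr_ge0 ?cut_ge0//; have /andP[] := small_log_excess_bound y (leqnn 8).
Qed.

Let phi_le i y : phi i y <= 37 * Num.min 1 (y ^+ 2).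
Proof.
have /andP[s0 s1] := small_log_excess_bound y (leqnn 8).
apply: le_trans (_ : small_test h 8 y <= _); first by rewrite ler_piMr// cut_le1.
apply: le_trans s1 _; rewrite ler_pM2l//.
have /andP[c0 c1] := one_cut_itv 8 y.
apply: (@le_trans _ _ (gauss_test y)); first by rewrite ler_piMr// gauss_test_ge0.
by rewrite le_min gauss_test_le1 gauss_test_le_sqr.
Qed.

Let tphi i : test_fun (phi i).
Proof.
split.
- move=> y; apply: cvgM; last exact: continuous_cut.
  apply: cvgM; first exact: continuous_log_excess.
  by apply: cvgB; [exact: cvg_cst|exact: continuous_cut].
- by exists i.+1%:R^-1; exact: vanishing_mul_cut.
- exists 37 => y; rewrite ger0_norm//; apply: le_trans (phi_le i y) _.
  by rewrite ler_piMr// ge_min lexx.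
Qed.

(** A path has finitely many jumps seen by [cut 8]. For the others the sums increase with [i], and
    their means are bounded by a multiple of the integral of [min 1 y^2] against [F], so the limit
    is integrable and hence finite almost surely. *)
Lemma jump_sums_bounded T : 0 <= T ->
  {ae P, forall w, exists K, forall i, jump_sum (X^~ w) (fun y => h y * cut i y) T <= K}.
Proof.
move=> T0; pose m := (Num.truncn T).+1.
have Tm : T <= m%:R by rewrite ltW// truncnS_gt.
pose J i w := (Jx (phi i) m%:R w)%:E.
have J0 i w : (0 <= J i w)%E by rewrite lee_fin good_jump_sum_ge0.
have mJ i : measurable_fun setT (J i).
  apply/measurable_EFinP; case: (tphi i) => c _ _.
  by apply: (measurable_good_jump_sum levyX mG goodG c (vanishing_mul_cut _ i)).
have Jmono w : {homo J^~ w : i j / (i <= j)%N >-> (i <= j)%E}.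
  move=> i j ij; rewrite lee_fin.
  have vi := vanishing_mul_cut (small_test h 8) i; have vj := vanishing_mul_cut (small_test h 8) j.
  apply: (good_jump_sum_le goodG (e := j.+1%:R^-1)) => //.
    by apply: vanishing_le vi; rewrite ?invr_gt0// lef_pV2 ?posrE// ler_nat.
  move=> y; rewrite ler_wpM2l ?cut_mono//.
  by have /andP[] := small_log_excess_bound y (leqnn 8).
pose L w := limn (J^~ w).
have cJ w : J i w @[i --> \oo] --> L w.
  by apply: ereal_nondecreasing_is_cvgn; exact: Jmono.
have mL : measurable_fun setT L.
  apply: (emeasurable_fun_cvg J) => // w _; exact: cJ.
pose C := m%:R * IF (fun y => 37 * Num.min 1 (y ^+ 2)).
have m1 : measurable_fun setT (fun y : R => 37 * Num.min 1 (y ^+ 2)).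
  apply: measurable_funM => //; apply: measurable_minr => //; exact: measurable_funX.
have IL : (\int[P]_w L w <= C%:E)%E.
  have := @cvg_monotone_convergence _ _ _ P setT measurableT J mJ (fun i w _ => J0 i w)
    (fun w _ => Jmono w).
  move=> cv; rewrite -(cvg_lim _ cv)//; apply: lime_le.
    by apply/cvg_ex; eexists; exact: cv.
  apply: nearW => i; apply: le_trans (mean_good_jump_sum_nat_le m (tphi i) (phi0 i)) _.
  rewrite lee_fin ler_wpM2l//; apply: le_Rintegral => //.
  - exact: (test_fun_integrable levyF (tphi i)).
  - apply: (levy_integrable levyF (C := 37)) => // y.
    by rewrite ger0_norm// mulr_ge0// le_min ler01 sqr_ge0.
have L0 w : (0 <= L w)%E.
  by apply: lime_ge; [apply/cvg_ex; eexists; exact: cJ|exact: nearW].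
have iL : P.-integrable setT L.
  apply/integrableP; split=> //; apply: le_lt_trans (ltry C); apply: le_trans IL.
  by rewrite le_eqVlt; apply/orP; left; apply/eqP/eq_integral => w _; rewrite gee0_abs.
have aeL := integrable_ae measurableT iL.
have aG : {ae P, forall w, G w} by exact: (aeG mG PG).
apply: filterS2 aG aeL => w Gw /(_ I) Lfin.
have [_ cw] := goodG Gw.
exists (jump_sum (X^~ w) (fun y => h y * cut 8 y) T + fine (L w)) => i.
have v1 : vanishing (i + 8).+1%:R^-1 (fun y => h y * cut 8 y).
  by apply: vanishing_le (vanishing_mul_cut h 8); rewrite ?invr_gt0// lef_pV2 ?posrE// ler_nat ltnS leq_addl.
have v2 : vanishing (i + 8).+1%:R^-1 (phi i).
  apply: vanishing_le (vanishing_mul_cut (small_test h 8) i); rewrite ?invr_gt0//.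
  by rewrite lef_pV2 ?posrE// ler_nat ltnS leq_addr.
have v3 : vanishing (i + 8).+1%:R^-1 (fun y => h y * cut i y).
  by apply: vanishing_le (vanishing_mul_cut h i); rewrite ?invr_gt0// lef_pV2 ?posrE// ler_nat ltnS leq_addr.
(* The right integrand exceeds the left one by [h] times [cut 8] times [1 - cut i]. *)
apply: (@le_trans _ _ (jump_sum (X^~ w) ((fun y => h y * cut 8 y) \+ phi i) T)).
  apply: (@jump_sum_le _ _ cw _ _ _ _ v3).
    by split=> [|y yd]; [case: v1|rewrite /= v1.2// v2.2// addr0].
  move=> y /=; rewrite /phi /small_test.
  have := log_excess_ge0 f0 f1 y; have := cut_le1 i y; have := cut_ge0 i y; have := cut_ge0 8 y.
  move=> c8 ci0 ci1 h0; rewrite -subr_ge0.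
  rewrite (_ : _ - _ = h y * cut 8 y * (1 - cut i y)); last by ring.
  by rewrite !mulr_ge0// subr_ge0.
rewrite (@jump_sumD _ _ cw (i + 8).+1%:R^-1)// lerD2l.
apply: (@le_trans _ _ (Jx (phi i) m%:R w)).
  rewrite good_jump_sumE//; exact: (@jump_sum_nondecreasing _ _ cw _ _ _ _ v2).
rewrite -lee_fin fineK//; apply: lime_ge; first by apply/cvg_ex; eexists; exact: cJ.
by exists i => // k /= ik; exact: Jmono.
Qed.

End jump_sums_bounded.
End jump_means.

Section log_excess_sums.
Context (R : realType) d (Omega : measurableType d) (P : probability Omega R).
Variables (mu sigma : R) (X B M : R -> Omega -> R).
Hypothesis levyX : is_levy_process P X.
Hypothesis brownianB : is_brownian_motion P B.
Variable G : set Omega.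
Hypotheses (mG : measurable G) (PG : P (~` G) = 0%E).
Hypothesis goodG : forall w, G w -> X 0 w = 0 /\ cadlag0 (X^~ w).
Variable F : {measure set R -> \bar R}.
Hypothesis levyF : is_levy_measure P X F.
Hypothesis smallM : is_small_jump_integral P X F M.
Hypothesis decG : forall w, G w -> forall t, 0 <= t ->
  X t w = mu * t + sigma * B t w + M t w + large_jump_sum X t w.
Variables (f T : R).
Hypotheses (f0 : 0 <= f) (f1 : f <= 1) (T0 : 0 <= T).
Local Notation h := (log_excess f).
Hypothesis finG : forall w, G w ->
  exists K, forall i, jump_sum (X^~ w) (fun y => h y * cut i y) T <= K.
Local Notation D := (grid_inc X).
Local Notation Jx := (good_jump_sum X G).

Let h0 y : 0 <= h y. Proof. exact: log_excess_ge0. Qed.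

Let mh : measurable_fun setT h.
Proof. exact: continuous_measurable_fun (continuous_log_excess f0 f1). Qed.

Let chc i : continuous (fun y => h y * cut i y).
Proof. by move=> y; apply: cvgM; [exact: continuous_log_excess|exact: continuous_cut]. Qed.

(** A form of convergence in probability with measurable exceptional sets, since the events [Q n]
    are not known to be measurable themselves. *)
Definition holds_whp (Q : nat -> Omega -> Prop) := forall eta : R, 0 < eta ->
  exists N, forall n, (N <= n)%N -> exists bad : set Omega,
    [/\ measurable bad, (P bad <= eta%:E)%E & forall w, G w -> ~ bad w -> Q n w].

Lemma large_increments_whp i e : 0 < e -> holds_whp (fun n w => forall k, k%:R <= n%:R * T ->
  `|\sum_(j < k) h (D n j w) * cut i (D n j w) -
    jump_sum (X^~ w) (fun y => h y * cut i y) (k%:R / n%:R)| <= e).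
Proof.
move=> e0 eta eta0; pose hc y := h y * cut i y.
pose Q n := \bigcap_(k in [set k : nat | k%:R <= n%:R * T])
  [set w | `|\sum_(j < k) hc (D n j w) - Jx hc (k%:R / n%:R) w| <= e].
have mhc : measurable_fun setT hc by exact: continuous_measurable_fun (@chc i).
have mQ n : measurable (Q n).
  apply: bigcap_measurableType => k _; rewrite -[X in measurable X]setTI.
  apply: measurable_fun_ler => //; apply: measurableT_comp; first exact: normr_measurable.
  apply: measurable_funB.
    apply: (measurable_ord_sum (Z := fun j w => hc (D n j w))) => j.
    by apply: measurableT_comp => //; exact: (measurable_grid_inc levyX).
  by apply: (measurable_good_jump_sum levyX mG goodG (@chc i) (vanishing_mul_cut h i)); rewrite divr_ge0.
have [|N hN] := prob_eventually mG PG mQ _ eta0.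
  move=> w Gw; have [_ cw] := goodG Gw.
  have [d0 vd] := vanishing_mul_cut h i.
  have [N hN] := @riemann_jump_sum _ _ cw hc _ d0 vd (@chc i) T e T0 e0.
  by exists N => n Nn k kT /=; rewrite good_jump_sumE//; exact: hN.
exists N => n Nn; exists (~` Q n); split; [exact: measurableC|exact: hN|].
by move=> w Gw /contrapT Qw k kT; have := Qw k kT; rewrite /= good_jump_sumE.
Qed.

(** Comparing the truncated sum with all later ones gives measurable events; the integral is reached
    by letting [m] tend to infinity. *)
Lemma small_jumps_whp e : 0 < e -> holds_whp (fun i w =>
  jump_integral (X^~ w) h T - jump_sum (X^~ w) (fun y => h y * cut i y) T <= e).
Proof.
move=> e0 eta eta0; pose J i := Jx (fun y => h y * cut i y) T.
have mJ i : measurable_fun setT (J i).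
  exact: (measurable_good_jump_sum levyX mG goodG (@chc i) (vanishing_mul_cut h i)).
pose Q i := \bigcap_(m in [set m | (i <= m)%N]) [set w | J m w - J i w <= e].
have mQ i : measurable (Q i).
  apply: bigcap_measurableType => m _; rewrite -[X in measurable X]setTI.
  by apply: measurable_fun_ler => //; exact: measurable_funB.
have cJ w : G w -> J i w @[i --> \oo] --> jump_integral (X^~ w) h T.
  move=> Gw; have [_ cw] := goodG Gw; have [K hK] := finG Gw.
  have := jump_integral_cvg cw h0 mh hK T0 (lexx T).
  by rewrite /J; under eq_fun do rewrite -(good_jump_sumE _ _ _ Gw).
have [|N hN] := prob_eventually mG PG mQ _ eta0.
  move=> w Gw; have [_ cw] := goodG Gw; have [K hK] := finG Gw.
  have := cJ w Gw => /cvgrPdist_le /(_ _ e0)[N _ hN].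
  exists N => n Nn m /= nm; have := hN n Nn; rewrite /= ler_norml => /andP[_].
  apply: le_trans; rewrite lerD2r.
  have /andP[+ _] := jump_integral_tail cw h0 mh T0 hK m T0 (lexx T).
  by rewrite subr_ge0 /J good_jump_sumE.
exists N => n Nn; exists (~` Q n); split; [exact: measurableC|exact: hN|].
move=> w Gw /contrapT Qw.
have h2 : J m w - J n w @[m --> \oo] --> jump_integral (X^~ w) h T - J n w.
  by apply: cvgB; [exact: cJ|exact: cvg_cst].
rewrite -(good_jump_sumE X _ _ Gw) -/(J n) -(cvg_lim _ h2)//; apply: limr_le.
  by apply/cvg_ex; eexists; exact: h2.
by exists n => // m /= nm; exact: Qw.
Qed.

Let v := f * (1 - f) / 2 * sigma ^+ 2.

Let v0 : 0 <= v.
Proof. by rewrite mulr_ge0 ?sqr_ge0// divr_ge0// mulr_ge0// subr_ge0. Qed.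

Let small_bound i y : (8 <= i)%N -> 0 <= small_test h i y <= 37 * (2 / i.+1%:R) ^+ 2.
Proof.
move=> i8; have /andP[-> h2] := small_log_excess_bound f0 f1 y i8.
apply: le_trans h2 _; rewrite ler_pM2l//.
by have /andP[] := small_gauss_test_bound i y.
Qed.

(** Chebyshev's inequality is applied at the multiples of a block length [b], between which the sums
    are monotone since [h >= 0]. The second moment of a term is at most [m] times the supremum of
    the test function, of order [1 / (i + 1)^2], and [n m] is bounded: the variance is made small by
    [i], not by [n]. *)
Lemma small_increments_whp e eta : 0 < e -> 0 < eta ->
  exists i0, forall i, (i0 <= i)%N -> exists N, forall n, (N <= n)%N ->
  exists bad : set Omega, [/\ measurable bad, (P bad <= eta%:E)%E &
    forall w, ~ bad w -> forall k, k%:R <= n%:R * T ->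
    `|\sum_(j < k) small_test h i (D n j w) - v * (k%:R / n%:R)| <= e].
Proof.
move=> e0 eta0; pose a := e / 4; have a0 : 0 < a by rewrite divr_gt0.
have v1 : 0 < v + 1 by rewrite ltr_wpDl.
have T1 : 0 < T + 1 by rewrite ltr_wpDl.
pose e' := Num.min 1 (a / (T + 1)).
have e'0 : 0 < e' by rewrite lt_min ltr01 divr_gt0.
have e'1 : e' <= 1 by rewrite ge_min lexx.
have e'T : T * e' <= a.
  apply: (@le_trans _ _ ((T + 1) * (a / (T + 1)))).
    have e'a : e' <= a / (T + 1) by rewrite ge_min lexx orbT.
    by apply: ler_pM => //; [exact: ltW|rewrite lerDl].
  by rewrite mulrC divfK// gt_eqF.
(* The time length of a block: as [n m <= v + 1], the mean over a block is at most [a]. *)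
pose tau := Num.min 1 (a / (v + 1)).
have tau0 : 0 < tau by rewrite lt_min ltr01 divr_gt0.
have tau1 : tau <= 1 by rewrite ge_min lexx.
have tauv : tau * (v + 1) <= a.
  by rewrite -ler_pdivlMr// ge_min lexx orbT.
(* A bound on the number of complete blocks before [T]; the 2 comes from [b >= n tau / 2], after
   rounding. *)
pose L := (Num.truncn (2 * T / tau)).+1.
pose C : R := (L.+2%:R * L.+1%:R) * (v + 1) / a ^+ 2.
have C0 : 0 <= C by rewrite divr_ge0 ?sqr_ge0// mulr_ge0// ltW.
have [i1 hi1] := log_excess_rate levyX brownianB mG PG goodG levyF smallM decG f0 f1 e'0.
(* 148 is 37 times 4, from the bound [37 (2 / (i + 1))^2] on the test function, of which one power
   of [1 / (i + 1)] is kept. [C] includes the union bound over [L + 2] block ends. *)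
have : 0 < eta / (148 * (C + 1)) by rewrite divr_gt0// mulr_gt0// ltr_wpDl.
move=> /inv_nat_lt[i2 hi2].
exists (maxn (maxn i1 i2) 8) => i; rewrite !geq_max -andbA => /and3P[/hi1[N1 hN1] i2i i8].
have [_ {}hi2] := hi2 i.+1 (leqW i2i).
have : 0 < tau / 2 by rewrite divr_gt0.
move=> /inv_nat_lt[N2 hN2].
exists (maxn N1 N2) => n; rewrite geq_max => /andP[/hN1 hm /hN2[n0 n2]].
have nR : 0 < n%:R :> R by rewrite ltr0n.
rewrite -/v in hm; set m := Ex P _ in hm.
pose Z j w := small_test h i (D n j w).
have Zb y := small_bound y i8.
have mst : measurable_fun setT (small_test h i).
  by apply: measurable_small_test; exact: continuous_log_excess.
have bst : bdd (small_test h i).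
  by exists (37 * (2 / i.+1%:R) ^+ 2) => y; have /andP[y0 y1] := Zb y; rewrite ger0_norm.
have bZ j : brv (Z j) by apply: brv_comp => //; exact: (measurable_grid_inc levyX).
have m0 : 0 <= m by apply: Ex_ge0 => w; have /andP[] := Zb (D n 0 w).
have mv : n%:R * m <= v + 1 by move: hm; rewrite ler_norml => /andP[_]; lra.
pose b := Num.truncn (n%:R * tau).
have nt : 0 <= n%:R * tau by rewrite mulr_ge0// ltW.
have bt : b%:R <= n%:R * tau by rewrite truncn_le.
have tb : n%:R * tau / 2 <= b%:R.
  have h1 : n%:R * tau < b%:R + 1 by rewrite natr1 truncnS_gt.
  have : 1 <= n%:R * (tau / 2) by rewrite mulrC -ler_pdivrMr// mul1r ltW.
  by rewrite mulrA; lra.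
have b0 : (0 < b)%N.
  by rewrite -(ltr0n R); apply: lt_le_trans tb; rewrite divr_gt0// mulr_gt0.
pose S k w := \sum_(j < k) Z j w.
have bS k : brv (S k) by exact: brv_sum.
pose A l := [set w | a <= `|S (l * b)%N w - (l * b)%:R * m| ].
have bSm k : brv (fun w => S k w - k%:R * m) by apply: brvB => //; exact: brv_cst.
have mA l : measurable (A l).
  rewrite -[X in measurable X]setTI; apply: measurable_fun_ler => //.
  apply: measurableT_comp; first exact: normr_measurable.
  by case: (bSm (l * b)%N).
have EZ2 : n%:R * Ex P (fun w => Z 0 w ^+ 2) <= 148 / i.+1%:R * (v + 1).
  have q : Ex P (fun w => Z 0 w ^+ 2) <= 37 * (2 / i.+1%:R) ^+ 2 * m.
    rewrite /m -ExZ; last exact: (bZ 0%N).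
    apply: Ex_le; [exact: brvX|exact: brvZ (bZ 0%N)|move=> w].
    by have /andP[y0 y1] := Zb (D n 0 w); rewrite expr2 ler_wpM2r.
  apply: (@le_trans _ _ (37 * (2 / i.+1%:R) ^+ 2 * (n%:R * m))).
    by rewrite mulrCA ler_pM2l.
  apply: ler_pM => //; rewrite ?mulr_ge0 ?sqr_ge0//.
  rewrite expr_div_n mulrA -natrX -natrM ler_pM2l//.
  by rewrite lef_pV2 ?posrE ?exprn_gt0// ler_eXnr// ler1n.
have PA l : (l <= L.+1)%N -> (P (A l) <= (L.+1%:R * (v + 1) / a ^+ 2 * (148 / i.+1%:R))%:E)%E.
  move=> lL; apply: le_trans (chebyshev_brv P (bSm (l * b)%N) a0) _.
  rewrite lee_fin mulrAC ler_wpM2r ?invr_ge0 ?sqr_ge0//.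
  apply: le_trans (Ex_sqr_increments levyX (l * b) n mst bst) _.
  have z0 : 0 <= Ex P (fun w => small_test h i (D n 0 w) ^+ 2).
    by apply: Ex_ge0 => w; exact: sqr_ge0.
  apply: (@le_trans _ _ (L.+1%:R * (n%:R * Ex P (fun w => Z 0 w ^+ 2)))).
    rewrite natrM -mulrA; apply: ler_pM => //; rewrite ?mulr_ge0 ?ler_nat//.
    by rewrite ler_wpM2r// (le_trans bt)// ler_piMr// ltW.
  by rewrite -mulrA ler_wpM2l// (mulrC (v + 1)).
exists (\big[setU/set0]_(l < L.+2) A l); split.
- exact: bigsetU_measurable.
- apply: (le_trans (Boole_inequality P (fun l _ => mA l))).
  apply: (@le_trans _ _ (\sum_(l < L.+2) (L.+1%:R * (v + 1) / a ^+ 2 * (148 / i.+1%:R))%:E)%E).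
    by apply: lee_sum => l _; apply: PA; rewrite -ltnS.
  rewrite sumEFin lee_fin sumr_const card_ord -[leLHS]mulr_natl.
  have -> : L.+2%:R * (L.+1%:R * (v + 1) / a ^+ 2 * (148 / i.+1%:R)) = 148 * C * i.+1%:R^-1.
    by rewrite /C; ring.
  apply: (@le_trans _ _ (148 * (C + 1) * i.+1%:R^-1)).
    by rewrite ler_pM2r ?invr_gt0// ler_pM2l// lerDl.
  by move: hi2; rewrite ltr_pdivlMr ?mulr_gt0 ?ltr_wpDl// mulrC => /ltW.
- move=> w; rewrite -bigcup_mkord => nbad k kT.
  have good l : (l <= L.+1)%N -> `|S (l * b)%N w - (l * b)%:R * m| <= a.
    move=> lL; rewrite leNgt; apply/negP => hl; apply: nbad; exists l => //=.
    by rewrite /A /= ltW.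
  have Smono k1 k2 : (k1 <= k2)%N -> S k1 w <= S k2 w.
    move=> /subnKC <-; rewrite /S big_split_ord/= lerDl; apply: sumr_ge0 => j _.
    by have /andP[] := Zb (D n (k1 + j) w).
  (* [k] lies between two consecutive block ends. The error is at most [a] at a block end, [a] for
     the mean of a block and [a] for replacing [n m] by [v]. *)
  pose l := (k %/ b)%N.
  have lk : (l * b <= k)%N by exact: leq_trunc_div.
  have kl : (k <= l.+1 * b)%N by rewrite ltnW// ltn_ceil.
  have lL : (l <= L)%N.
    rewrite ltnW// -(ltr_nat R); apply: le_lt_trans (truncnS_gt _).
    rewrite ler_pdivlMr//.
    have h1 : l%:R * (n%:R * tau / 2) <= n%:R * T.
      apply: le_trans kT; apply: (@le_trans _ _ (l * b)%:R); last by rewrite ler_nat.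
      by rewrite natrM ler_wpM2l.
    rewrite -(ler_pM2l nR); apply: (@le_trans _ _ (2 * (l%:R * (n%:R * tau / 2)))).
      by rewrite le_eqVlt; apply/orP; left; apply/eqP; field.
    by rewrite [leRHS]mulrCA ler_pM2l.
  have g1 := good l (leqW lL); have g2 := good l.+1 lL.
  have s1 := Smono _ _ lk; have s2 := Smono _ _ kl.
  have bm : b%:R * m <= a.
    apply: le_trans tauv; apply: (@le_trans _ _ (tau * (n%:R * m))).
      by rewrite mulrA ler_wpM2r// mulrC.
    by rewrite ler_pM2l.
  have km : `|k%:R * m - v * (k%:R / n%:R)| <= a.
    have -> : k%:R * m - v * (k%:R / n%:R) = k%:R / n%:R * (n%:R * m - v).
      by field; rewrite gt_eqF.
    rewrite normrM ger0_norm ?divr_ge0//; apply: le_trans e'T; apply: ler_pM => //.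
    by rewrite ler_pdivrMr// mulrC.
  have lk' : (l * b)%:R * m <= k%:R * m by rewrite ler_wpM2r// ler_nat.
  have kl' : k%:R * m <= (l.+1 * b)%:R * m by rewrite ler_wpM2r// ler_nat.
  have lS : (l.+1 * b)%:R * m = (l * b)%:R * m + b%:R * m.
    by rewrite mulSn natrD; ring.
  have eE : e = 4 * a by rewrite /a; field.
  move: g1 g2 km; rewrite !ler_norml -/(S k w) eE lS => /andP[? ?] /andP[? ?] /andP[? ?].
  by apply/andP; split; lra.
Qed.

Lemma log_excess_sums_whp e : 0 < e -> holds_whp (fun n w => forall k, k%:R <= n%:R * T ->
  `|\sum_(j < k) h (D n j w) -
    (v * (k%:R / n%:R) + jump_integral (X^~ w) h (k%:R / n%:R))| <= e).
Proof.
move=> e0 eta eta0.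
have e30 : 0 < e / 3 by rewrite divr_gt0.
have eta30 : 0 < eta / 3 by rewrite divr_gt0.
have [i1 h1] := small_increments_whp e30 eta30.
have [i2 h2] := small_jumps_whp e30 eta30.
pose i := maxn i1 i2.
have [N1 {}h1] := h1 i (leq_maxl _ _).
have [bad2 [mb2 Pb2 {}h2]] := h2 i (leq_maxr _ _).
have [N3 h3] := large_increments_whp i e30 eta30.
exists (maxn (maxn N1 N3) 1) => n; rewrite !geq_max -andbA => /and3P[/h1[bad1 [mb1 Pb1 {}h1]] /h3[bad3 [mb3 Pb3 {}h3]] n0].
exists (bad1 `|` bad2 `|` bad3); split.
- by apply: measurableU => //; exact: measurableU.
- apply: le_trans (measureU2 _ _ _) _ => //; first exact: measurableU.
  have -> : eta = eta / 3 + eta / 3 + eta / 3 by field.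
  rewrite !EFinD; apply: leeD => //.
  by apply: le_trans (measureU2 _ _ _) _ => //; exact: leeD.
- move=> w Gw; rewrite !not_orP => -[[nb1 nb2] nb3] k kT.
  have nR : 0 < n%:R :> R by rewrite ltr0n.
  have {}h1 := h1 w nb1 k kT; have {}h2 := h2 w Gw nb2; have {}h3 := h3 w Gw nb3 k kT.
  have [_ cw] := goodG Gw; have [K hK] := finG Gw.
  have k0 : 0 <= k%:R / n%:R :> R by rewrite divr_ge0.
  have kT' : k%:R / n%:R <= T by rewrite ler_pdivrMr// mulrC.
  have /andP[t1 t2] := jump_integral_tail cw h0 mh T0 hK i k0 kT'.
  have {}t2 := le_trans t2 h2.
  have E : \sum_(j < k) h (D n j w) = \sum_(j < k) h (D n j w) * cut i (D n j w) +
      \sum_(j < k) small_test h i (D n j w).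
    by rewrite -big_split/=; apply: eq_bigr => j _; rewrite /small_test; ring.
  rewrite E.
  set a1 := \sum_(j < k) small_test h i (D n j w) in h1 *.
  set a3 := \sum_(j < k) _ in h3 *.
  set I := jump_integral _ _ _ in t1 t2 *.
  set J := jump_sum _ _ _ in h3 t1 t2 *.
  move: h1 h3; rewrite !ler_norml => /andP[? ?] /andP[? ?].
  by apply/andP; split; lra.
Qed.

End log_excess_sums.

(** * Convergence of the wealth processes *)

Lemma Ex_cvg_in_prob d (Omega : measurableType d) (R : realType) (P : probability Omega R)
    (G : set Omega) (g_ : nat -> Omega -> R) (g : Omega -> R) (K : R) :
  measurable G -> P (~` G) = 0%E ->
  (forall n, measurable_fun setT (g_ n)) -> measurable_fun setT g ->
  (forall n w, `|g_ n w| <= K) -> (forall w, `|g w| <= K) ->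
  (forall e eta : R, 0 < e -> 0 < eta -> exists N, forall n, (N <= n)%N ->
    exists bad : set Omega, [/\ measurable bad, (P bad <= eta%:E)%E &
      forall w, G w -> ~ bad w -> `|g_ n w - g w| <= e]) ->
  Ex P (g_ n) @[n --> \oo] --> Ex P g.
Proof.
move=> mG PG mg_ mg bg_ bg h.
apply/cvgrPdist_le => e e0; have e20 : 0 < e / 2 by rewrite divr_gt0.
have [w0 _] : exists w : Omega, True.
  apply: contrapT => hw; have := probability_setT P.
  rewrite (_ : setT = set0) ?measure0; first by move=> /eqP; rewrite eqe eq_sym oner_eq0.
  by apply/seteqP; split => // w _; apply: hw; exists w.
have K0 : 0 <= K by exact: le_trans (bg w0).
have eta0 : 0 < e / (4 * (K + 1)) by rewrite divr_gt0// mulr_gt0// ltr_wpDl.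
have [N hN] := h _ _ e20 eta0; exists N => // n /= /hN[bad [mb Pb hb]].
have b1 : brv (g_ n) by split=> //; exists K.
have b2 : brv g by split=> //; exists K.
have mI : measurable_fun setT (\1_bad : Omega -> R) by exact: measurable_indic.
have bA : brv (fun w => `|g w - g_ n w|).
  have [m1 [C hC]] := brvB b2 b1; split; first exact: measurableT_comp.
  by exists C => w; rewrite normr_id.
rewrite -ExB//; apply: (@le_trans _ _ (Ex P (fun w => `|g w - g_ n w|))).
  by apply: Ex_le_norm => //; exact: brvB.
rewrite -lee_fin -ExE//.
have d2 w : `|g w - g_ n w| <= 2 * K.
  by apply: le_trans (ler_normB _ _) _; rewrite mulr_natl mulr2n lerD.
apply: (@le_trans _ _ (\int[P]_w (e / 2 + 2 * K * \1_bad w)%:E)%E).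
  apply: (le_integral_on mG PG) => //.
    by move=> w; rewrite addr_ge0 ?(ltW e20)// mulr_ge0// mulr_ge0.
  move=> w Gw; rewrite indicE; case: (boolP (w \in bad)) => [_|/negP nb].
    by rewrite mulr1 ler_wpDl// ltW.
  by rewrite mulr0 addr0 distrC; apply: hb => // bw; apply: nb; exact: mem_set.
have bI : brv (\1_bad : Omega -> R).
  by split=> //; exists 1 => w; rewrite ger0_norm// indicE; case: (_ \in _).
rewrite ExE; last by apply: brvD; [exact: brv_cst|exact: brvZ].
rewrite (ExD P (@brv_cst _ Omega R (e / 2)) (brvZ (2 * K) bI)) Ex_cst (ExZ P _ bI) lee_fin.
have PI : Ex P \1_bad <= e / (4 * (K + 1)).
  by rewrite -lee_fin -ExE// integral_indic// setIT.
rewrite [leRHS]splitr lerD2l.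
apply: (@le_trans _ _ (2 * (K + 1) * (e / (4 * (K + 1))))).
  apply: ler_pM => //; first by rewrite mulr_ge0.
    by apply: Ex_ge0 => w; rewrite indicE.
  by rewrite ler_pM2l// lerDl.
have K1 : K + 1 != 0 by rewrite gt_eqF// ltr_wpDl.
by rewrite le_eqVlt; apply/orP; left; apply/eqP; field.
Qed.

Lemma continuous_measurable_skorokhod (R : realType) (T : R) (phi : skorokhod T -> R) :
  continuous phi ->
  measurable_fun setT (phi : g_sigma_algebraType (@open (skorokhod T)) -> R).
Proof.
move=> cphi; apply: (measurability _ (RGenOpens.measurableE R)).
move=> _ [_ [a [b ->] <-]]; rewrite setTI; apply: sub_sigma_algebra.
by move/continuousP : cphi; apply; exact: interval_open.
Qed.

Lemma expR_dist_le (R : realType) (u r : R) : `|u| <= r -> r <= 1 / 2 -> `|expR u - 1| <= 2 * r.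
Proof.
rewrite ler_norml => /andP[u1 u2] r2; rewrite ler_norml; apply/andP; split.
  by have := expR_ge1Dx u; lra.
have h1 := expR_ge1Dx (- u); have h2 : 0 < 1 - u by lra.
have h3 : expR u * (1 - u) <= 1.
  by rewrite -[leRHS](mulVf (x := expR u)) ?gt_eqF ?expR_gt0// mulrC ler_pM2r ?expR_gt0// -expRN.
have := expR_gt0 u; nra.
Qed.

Section wealth_paths.
Context (R : realType) d (Omega : measurableType d) (P : probability Omega R).
Variables (mu sigma : R) (X B M : R -> Omega -> R).
Hypothesis levyX : is_levy_process P X.
Hypothesis brownianB : is_brownian_motion P B.
Variable G : set Omega.
Hypotheses (mG : measurable G) (PG : P (~` G) = 0%E).
Hypothesis goodG : forall w, G w -> X 0 w = 0 /\ cadlag0 (X^~ w).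
Variable F : {measure set R -> \bar R}.
Hypothesis levyF : is_levy_measure P X F.
Hypothesis smallM : is_small_jump_integral P X F M.
Hypothesis decG : forall w, G w -> forall t, 0 <= t ->
  X t w = mu * t + sigma * B t w + M t w + large_jump_sum X t w.
Variables (f T : R).
Hypotheses (f0 : 0 <= f) (f1 : f <= 1) (T0 : 0 < T).
Local Notation h := (log_excess f).
Hypothesis finG : forall w, G w ->
  exists K, forall i, jump_sum (X^~ w) (fun y => h y * cut i y) T <= K.
Local Notation D := (grid_inc X).
Local Notation W := (limit_wealth X sigma f).

Let h0 y : 0 <= h y. Proof. exact: log_excess_ge0. Qed.

Let ch : continuous h. Proof. exact: continuous_log_excess. Qed.

Let mh : measurable_fun setT h. Proof. exact: continuous_measurable_fun. Qed.

Let chc i : continuous (fun y => h y * cut i y).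
Proof. by move=> y; apply: cvgM; [exact: continuous_log_excess|exact: continuous_cut]. Qed.

Let I t w := jump_integral (X^~ w) h t.

Let WE t w : W t w = expR (f * X t w + f * (1 - f) * sigma ^+ 2 / 2 * t + I t w).
Proof. by []. Qed.

Lemma wealthE n t w : wealth X f n t w =
  expR (f * (X ((Num.truncn (n%:R * t))%:R / n%:R) w - X 0 w) +
    \sum_(j < Num.truncn (n%:R * t)) h (D n j w)).
Proof.
rewrite /wealth; elim: (Num.truncn _) => [|k IH].
  by rewrite big_nil big_ord0 mul0r subrr mulr0 addr0 expR0.
rewrite big_nat_recr//= IH big_ord_recr/= /simple_return /= -/(D n k w).
rewrite -(@lnK _ (1 + f * (expR (D n k w) - 1))); last exact: growth_gt0.
rewrite -expRD; congr expR; rewrite /log_excess /grid_inc; ring.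
Qed.

Lemma cadlag_limit_wealth w : G w -> cadlag_on [set t | 0 < t < T] (W^~ w).
Proof.
move=> Gw t /andP[t0 tT]; have [_ cw] := goodG Gw; have [K hK] := finG Gw.
have [_ /(_ t t0)[xr xl]] := cw.
have Ir := jump_integral_right cw h0 mh (ltW T0) hK (ltW t0) tT.
have Il := jump_integral_left cw h0 mh (ltW T0) hK t0 tT.
pose e u := f * X u w + f * (1 - f) * sigma ^+ 2 / 2 * u + I u w.
have EW : W^~ w = expR \o e by [].
have idr : (u : R) @[u --> t^'+] --> t by exact: cvg_within.
have idl : (u : R) @[u --> t^'-] --> t by exact: cvg_within.
rewrite EW; split.
  apply: (@cvg_comp _ _ _ e expR _ (nbhs (e t))); last exact: continuous_expR.
  apply: cvgD => //; apply: cvgD; first by apply: cvgM => //; exact: cvg_cst.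
  by apply: cvgM => //; exact: cvg_cst.
move/cvg_ex : xl => [lx xl]; move/cvg_ex : Il => [li Il].
apply/cvg_ex; exists (expR (f * lx + f * (1 - f) * sigma ^+ 2 / 2 * t + li)).
apply: (@cvg_comp _ _ _ e expR _ (nbhs _)); last exact: continuous_expR.
apply: cvgD => //; apply: cvgD; first by apply: cvgM => //; exact: cvg_cst.
by apply: cvgM => //; exact: cvg_cst.
Qed.

Let IG t w : R := if w \in G then I t w else 0.

Lemma measurable_jump_integral t : 0 <= t -> t <= T -> measurable_fun setT (IG t).
Proof.
move=> t0 tT.
apply: (@measurable_fun_cvg _ _ _ _ (fun i => good_jump_sum X G (fun y => h y * cut i y) t)).
  by move=> i; exact: (measurable_good_jump_sum levyX mG goodG (@chc i) (vanishing_mul_cut h i)).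
move=> w _; rewrite /IG /good_jump_sum; case: ifPn => [/set_mem Gw|_]; last exact: cvg_cst.
have [_ cw] := goodG Gw; have [K hK] := finG Gw.
exact: (jump_integral_cvg cw h0 mh hK).
Qed.

Definition wealth_path n w : skorokhod T :=
  step_skor T (fun k => expR (f * (X (k%:R / n%:R) w - X 0 w) + \sum_(j < k) h (D n j w))) n.

Definition limit_path w : skorokhod T :=
  if pselect (G w) is left Gw then skor_of (cadlag_limit_wealth Gw) else skor0 T.

Lemma limit_pathE w t : G w -> 0 < t < T -> limit_path w t = W t w.
Proof. by move=> Gw tT; rewrite /limit_path; case: pselect => // Gw'; rewrite /= tT. Qed.

Let mX t : 0 <= t -> measurable_fun setT (X t).
Proof. by case: levyX => mX _ _ _ _; exact: mX. Qed.

Lemma random_wealth_path n : random_path P (wealth X f n) (wealth_path n).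
Proof.
split; last first.
  by apply: aeW => w t tT; rewrite /wealth_path step_skorE// wealthE.
apply: measurable_skorokhod => // t tT; under eq_fun do rewrite step_skorE//.
apply: measurableT_comp => //; apply: measurable_funD.
  apply: measurable_funM => //; apply: measurable_funB; apply: mX => //.
apply: (measurable_ord_sum (Z := fun j w => h (D n j w))) => j.
by apply: measurableT_comp => //; exact: (measurable_grid_inc levyX).
Qed.

Lemma random_limit_path : random_path P W limit_path.
Proof.
split; last by apply: (aeG mG PG) => w Gw t; exact: limit_pathE.
apply: measurable_skorokhod => // t tT; have /andP[/ltW t0 /ltW t1] := tT.
have -> : (fun w => limit_path w t) = (fun w => expR (f * X t w +
    f * (1 - f) * sigma ^+ 2 / 2 * t + IG t w)) \_ G.
  apply/funext => w; rewrite patchE /IG; case: (boolP (w \in G)) => [Gw|/negP Gw].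
    by rewrite limit_pathE//; exact: set_mem.
  rewrite /limit_path; case: pselect => [Gw'|_]//.
  by exfalso; apply: Gw; exact: mem_set.
apply/(measurable_restrictT _ mG).1; apply: measurable_funTS.
apply: measurableT_comp => //; apply: measurable_funD; last exact: measurable_jump_integral.
by apply: measurable_funD => //; apply: measurable_funM => //; exact: mX.
Qed.

Let v := f * (1 - f) / 2 * sigma ^+ 2.

Let close e n w := forall k, k%:R <= n%:R * T ->
  `|\sum_(j < k) h (D n j w) - (v * (k%:R / n%:R) + I (k%:R / n%:R) w)| <= e.

(** At grid times the wealth is [W] times the exponential of an error at most [1 / (m + 1)], and [W]
    is at most [Kw] on [[0, T]], so the absolute error is at most [2 Kw / (m + 1)]. Both [Kw] and
    the radius [e] depend on the path, hence so does [m]. *)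
Lemma wealth_path_near w (A : set (skorokhod T)) : G w -> nbhs (limit_path w) A ->
  exists m, forall n, (m <= n)%N -> close m.+1%:R^-1 n w -> A (wealth_path n w).
Proof.
move=> Gw /nbhs_unif_near[e e0 hA]; have [X0 cw] := goodG Gw; have [K hK] := finG Gw.
have [N hN] := discretization_near T0 (limit_path w) e0.
have [Kx hKx] := cadlag_bounded cw (ltW T0).
have v0 : 0 <= f * (1 - f) * sigma ^+ 2 / 2.
  by rewrite divr_ge0// mulr_ge0 ?sqr_ge0// mulr_ge0// subr_ge0.
pose Kw := expR (f * Kx + f * (1 - f) * sigma ^+ 2 / 2 * T + I T w).
have hW t : 0 <= t <= T -> 0 < W t w <= Kw.
  move=> tT; have /andP[t0 t1] := tT; rewrite WE expR_gt0 ler_expR lerD//.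
    apply: lerD; last by rewrite ler_wpM2l.
    by rewrite ler_wpM2l// (le_trans (ler_norm _))// hKx.
  exact: (jump_integral_nondecreasing cw h0 mh hK t0 t1 (lexx T)).
have Kw0 : 0 < Kw by exact: expR_gt0.
have : 0 < Num.min (1 / 2) (e / (4 * Kw)) by rewrite lt_min !divr_gt0// mulr_gt0.
move=> /inv_nat_lt[N' hN'].
exists (maxn N N') => n; rewrite geq_max => /andP[Nn N'n] cl.
have [_] := hN' (maxn N N').+1 (leqW (leq_maxr N N')).
set r := _^-1 in cl *; rewrite lt_min => /andP[r2 rK].
apply: hA; apply: (hN n Nn) => t tT nt; have /andP[t0 t1] := tT.
pose k := Num.truncn (n%:R * t).
have n0 : (0 < n)%N by case: (hN' n N'n).
have nR : 0 < n%:R :> R by rewrite ltr0n.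
have kt : k%:R / n%:R <= t.
  by rewrite ler_pdivrMr// mulrC truncn_le// mulr_ge0// ltW.
have kT : k%:R <= n%:R * T.
  by rewrite mulrC -ler_pdivrMr// (le_trans kt)// ltW.
(* Here [t >= 1 / n] enters: the grid point is positive, so [limit_path] takes the value of [W]
   there and not its default value. *)
have kI : (0 : R) < k%:R / n%:R < T.
  rewrite (le_lt_trans kt t1) andbT divr_gt0// ltr0n truncn_gt0.
  by rewrite mulrC -ler_pdivrMr// mul1r.
have kI' : (0 : R) <= k%:R / n%:R <= T by have /andP[/ltW -> /ltW ->] := kI.
rewrite -/k limit_pathE// /wealth_path step_skorE// -/k.
have := cl k kT; set s := \sum_(j < k) _ => clk.
have -> : f * (X (k%:R / n%:R) w - X 0 w) + s = (f * X (k%:R / n%:R) w +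
    f * (1 - f) * sigma ^+ 2 / 2 * (k%:R / n%:R) + I (k%:R / n%:R) w) +
    (s - (v * (k%:R / n%:R) + I (k%:R / n%:R) w)).
  by rewrite X0 /v; ring.
rewrite expRD -WE; have /andP[w0 w1] := hW _ kI'.
set u := s - _ in clk *; have := expR_dist_le clk (ltW r2) => hu.
rewrite -{2}[W _ w]mulr1 -mulrBr normrM (gtr0_norm w0).
apply: (@le_trans _ _ (Kw * (2 * r))); first exact: ler_pM (ltW w0) (normr_ge0 _) w1 hu.
move: rK; rewrite ltr_pdivlMr ?mulr_gt0// => /ltW rK.
have -> : Kw * (2 * r) = r * (4 * Kw) / 2 by field.
by rewrite ler_pM2r.
Qed.

Lemma wealth_cvg_in_law : cvg_in_law P T (wealth X f) W.
Proof.
exists wealth_path, limit_path; split; [exact: random_wealth_path|exact: random_limit_path|].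
move=> phi cphi [K hK].
have mphi := continuous_measurable_skorokhod cphi.
have mn n : measurable_fun setT (phi \o wealth_path n).
  by apply: (measurableT_comp mphi); case: (random_wealth_path n).
have ml : measurable_fun setT (phi \o limit_path).
  by apply: (measurableT_comp mphi); case: random_limit_path.
have b (f' : Omega -> skorokhod T) : measurable_fun setT (phi \o f') -> brv (phi \o f').
  by move=> mf; split=> //; exists K => w; exact: hK.
rewrite unlock ExE; last exact: b.
have -> : (fun n => \int[P]_w ((phi \o wealth_path n) w)%:E)%E = (fun n => (Ex P (phi \o wealth_path n))%:E).
  by apply/funext => n; rewrite ExE//; exact: b.
apply: cvg_EFin; first exact: nearW.
apply: (@Ex_cvg_in_prob _ _ _ _ G (fun n => phi \o wealth_path n) _ K mG PG mn ml).
- by move=> n w; exact: hK.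
- by move=> w; exact: hK.
move=> e eta e0 eta0.
(* [phi] is not uniformly continuous.  The sets [A m] on which, for [n >= m], the
   [phi]-values of the wealth path and of its limit are close whenever the paths
   are [1/(m+1)]-close, are measurable and exhaust [G]. *)
pose S n k w := \sum_(j < k) h (D n j w) - (v * (k%:R / n%:R) + IG (k%:R / n%:R) w).
pose C m n := \bigcap_(k in [set k : nat | k%:R <= n%:R * T]) [set w | `|S n k w| <= m.+1%:R^-1].
have kT n k : k%:R <= n%:R * T -> (0 : R) <= k%:R / n%:R <= T.
  move=> kn; rewrite divr_ge0//=; case: n kn => [|n] kn; first by rewrite invr0 mulr0 ltW.
  by rewrite ler_pdivrMr// mulrC.
have CE m n w : G w -> C m n w <-> close m.+1%:R^-1 n w.
  by move=> Gw; split=> Cw k kn; have := Cw k kn; rewrite /S /IG /= mem_set.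
have mC m n : measurable (C m n).
  apply: bigcap_measurableType => k /= kn; have /andP[k0 k1] := kT n k kn.
  rewrite -[X in measurable X]setTI; apply: measurable_fun_ler => //.
  apply: measurableT_comp; first exact: normr_measurable.
  apply: measurable_funB.
    apply: (measurable_ord_sum (Z := fun j w => h (D n j w))) => j.
    by apply: measurableT_comp => //; exact: (measurable_grid_inc levyX).
  by apply: measurable_funD => //; exact: measurable_jump_integral.
pose E n := [set w | `|phi (wealth_path n w) - phi (limit_path w)| <= e].
have mE n : measurable (E n).
  rewrite -[X in measurable X]setTI; apply: measurable_fun_ler => //.
  apply: measurableT_comp; first exact: normr_measurable.
  exact: (measurable_funB (mn n) ml).
pose A m := \bigcap_(n in [set n | (m <= n)%N]) (~` C m n `|` E n).
have mA m : measurable (A m).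
  apply: bigcap_measurableType => n _; apply: measurableU => //.
  exact: measurableC.
have eta20 : 0 < eta / 2 by rewrite divr_gt0.
have [|m0 hm0] := prob_eventually mG PG mA _ eta20.
  move=> w Gw; have nE : nbhs (limit_path w) [set z | `|phi z - phi (limit_path w)| <= e].
    have := cphi (limit_path w) => /cvgrPdist_le /(_ _ e0).
    by apply: filterS => z; rewrite distrC.
  have [m hm] := wealth_path_near Gw nE; exists m => m' mm' n /= m'n.
  have [Cw|] := pselect (C m' n w); last by left.
  right; apply: hm; first exact: leq_trans m'n.
  move=> k kn; have /CE := Cw => /(_ Gw k kn) h1; apply: le_trans h1 _.
  by rewrite lef_pV2 ?posrE// ler_nat.
have m00 : 0 < m0.+1%:R^-1 :> R by rewrite invr_gt0.
have [N hN] := log_excess_sums_whp levyX brownianB mG PG goodG levyF smallM decG f0 f1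
  (ltW T0) finG m00 eta20.
exists (maxn N m0) => n; rewrite geq_max => /andP[/hN[bad [mb Pb hb]] m0n].
exists (~` A m0 `|` bad); split.
- by apply: measurableU => //; exact: measurableC.
- apply: le_trans (measureU2 _ _ _) _ => //; first exact: measurableC.
  by rewrite [eta]splitr EFinD; apply: leeD => //; exact: hm0.
- move=> w Gw; rewrite not_orP => -[/contrapT Aw nb].
  have [nC|//] := Aw n m0n; exfalso; apply: nC; apply/(CE _ _ _ Gw).
  by move=> k kn; exact: hb.
Qed.

End wealth_paths.

Theorem theorem4p3 (R : realType) (d : measure_display)
  (Omega : measurableType d) (P : probability Omega R)
  (mu sigma : R) (X B : R -> Omega -> R) (F : {measure set R -> \bar R})
  (sigma_ge0 : 0 <= sigma)
  (levyX : is_levy_process P X)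
  (brownianB : is_brownian_motion P B)
  (levyF : is_levy_measure P X F)
  (decX : levy_ito_decomposition P X mu sigma B F)
  (intX1 : P.-integrable setT (EFin \o X 1))
  (f T : R) (f_ge0 : 0 <= f) (f_le1 : f <= 1) (T_gt0 : 0 < T) :
  cvg_in_law P T (wealth X f) (limit_wealth X sigma f).
Proof.
case: decX => M smallM [N1 [mN1 PN1 dec]].
have [G0 [mG0 PG0 good0]] := levy_good_set levyX.
have [N2 [mN2 PN2 fin]] :=
  jump_sums_bounded levyX mG0 PG0 good0 levyF f_ge0 f_le1 (ltW T_gt0).
pose G := G0 `&` ~` (N1 `|` N2).
have mG : measurable G.
  by apply: measurableI => //; apply: measurableC; exact: measurableU.
have PG : P (~` G) = 0%E.
  rewrite setCI setCK !measureU0//; first exact: measurableC.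
  exact: measurableU.
have decG w : G w -> forall t, 0 <= t ->
    X t w = mu * t + sigma * B t w + M t w + large_jump_sum X t w.
  move=> [_ nN]; apply: contrapT => h; apply: nN; left; exact: dec.
have finG w : G w -> exists K, forall i,
    jump_sum (X^~ w) (fun y => log_excess f y * cut i y) T <= K.
  move=> [_ nN]; apply: contrapT => h; apply: nN; right; exact: fin.
apply: (wealth_cvg_in_law levyX brownianB mG PG _ levyF smallM decG) => //.
by move=> w [/good0].
Qed.
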